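(* Let $\rho\in(0,1)$ and consider in dimension $1$ the East model, or the FA-1f model (with either two empty boundaries or one empty boundary), at density $\rho$. Then there exist $\alpha_1<\alpha_0<0$ and a constant $\Sigma>0$ such that the function $\varphi(\alpha)=\limsup_{N\to\infty}\varphi^{(N)}(\alpha/N)$ satisfies: (i) $\varphi(\alpha)=\mathbb A\,\alpha$ for all $\alpha>\alpha_0$; (ii) $\varphi(\alpha)=-\Sigma$ for all $\alpha<\alpha_1$.
   Context: Models. Let $\Lambda_N=\{1,\dots,N\}$, $\Omega_N=\{0,1\}^{\Lambda_N}$. The dynamics is the continuous-time Markov process on $\Omega_N$ with generator $\mathcal L_N f(\eta)=\sum_{i\in\Lambda_N}c_i(\eta)\,(f(\eta^i)-f(\eta))$, where $\eta^i$ is $\eta$ flipped at $i$ and $c_i(\eta)=r_i(\eta)[\eta_i(1-\rho)+(1-\eta_i)\rho]$. The constraint $r_i$ is: for East, $r_i(\eta)=1-\eta_{i+1}$ with the convention $\eta_{N+1}=0$; for FA-1f, $r_i(\eta)=1-\eta_{i-1}\eta_{i+1}$ with the convention $\eta_0=\eta_{N+1}=0$ (two empty boundaries) or $\eta_0=1,\ \eta_{N+1}=0$ (one empty boundary). The process is reversible with respect to the Bernoulli product measure $\nu$ with $\nu(\eta_i=1)=\rho$. Activity. $\mathcal A(t)$ is the total number of configuration changes (flips) during $[0,t]$ in $\Lambda_N$. $\langle\cdot\rangle$ is the expectation over the process with initial configuration distributed according to $\nu$. $\varphi^{(N)}(\lambda)=\lim_{t\to\infty}\frac1t\log\langle\exp(\lambda\mathcal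 A(t))\rangle$. Mean instantaneous activity. $\mathbb A=\nu(c_j)$ for any $2\le j\le N-1$ (independent of $j$ and $N$): $\mathbb A=2\rho(1-\rho)^2$ for East, $\mathbb A=2\rho(1-\rho)(1-\rho^2)$ for FA-1f. *)

(* Defs.v *)
From HB Require Import structures.
From mathcomp Require Import all_boot all_order all_algebra.
From mathcomp Require Import finmap.
From mathcomp Require Import all_classical all_reals all_analysis.
From mathcomp Require Import zify ring lra.

Set Implicit Arguments.
Unset Strict Implicit.
Unset Printing Implicit Defensive.

Import Order.TTheory GRing.Theory Num.Theory.
Import numFieldNormedType.Exports.

Local Open Scope classical_set_scope.
Local Open Scope ring_scope.

Section finite_state_processes.
Context {R : realType} {S : finType}.

Record transition_function (p : R -> S -> S -> R) : Prop := {
  transition_ge0 : forall (t : R) x y, 0 <= t -> 0 <= p t x y ;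
  transition_sum1 : forall (t : R) x, 0 <= t -> \sum_(y : S) p t x y = 1 ;
  transition0 : forall x y, p 0 x y = (x == y)%:R ;
  transitionD : forall (s t : R) x y, 0 <= s -> 0 <= t ->
    p (s + t) x y = \sum_(z : S) p s x z * p t z y }.

Definition has_generator (p : R -> S -> S -> R)
    (L : (S -> R) -> (S -> R)) : Prop :=
  forall (f : S -> R) (x : S),
    h^-1 * (\sum_(y : S) p h x y * f y - f x) @[h --> 0^'+] --> L f x.

Section process.
Context {d : measure_display} {T : measurableType d}.
Variables (P : probability T R) (X : R -> T -> S).

(* The finite list [past] of pairs (time, state) prescribes an event of the
   past of [s]; these events generate the natural filtration at [s]. *)
Definition markov_property (p : R -> S -> S -> R) : Prop :=
  forall (past : seq (R * S)) (s h : R) (x y : S), 0 <= s -> 0 <= h ->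
    (forall q, q \in past -> 0 <= q.1 <= s) ->
    let H := [set w | (forall q, q \in past -> X q.1 w = q.2) /\ X s w = x] in
    (P (H `&` [set w | X (s + h) w = y]) = P H * (p h x y)%:E)%E.

(* Only the times [0 <= t] are meaningful. *)
Record markov_process (mu : S -> R) (L : (S -> R) -> (S -> R)) : Prop := {
  process_measurable : forall (t : R) x, 0 <= t -> measurable [set w | X t w = x] ;
  process_right_cts : forall w (t : R), 0 <= t -> \forall s \near t^'+, X s w = X t w ;
  process_left_lim : forall w (t : R), 0 < t ->
    exists x, \forall s \near t^'-, X s w = x ;
  process_initial : forall x, P [set w | X 0 w = x] = (mu x)%:E ;
  process_markov : exists p : R -> S -> S -> R,
    [/\ transition_function p, has_generator p L & markov_property p] }.

Definition jump_times (t : R) (w : T) : set R :=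
  [set s | 0 < s <= t /\ ~ \forall u \near s^'-, X u w = X s w].

(* [fset_set] returns the empty set on infinite sets, but [jump_times] is
   finite for the paths of a [markov_process]; see [finite_jump_times]. *)
Definition activity (t : R) (w : T) : nat := #|` fset_set (jump_times t w) |.

(* The scaled cumulant generating function of the activity. *)
Definition activity_scgf (lambda : R) : \bar R :=
  lim ((t^-1%:E * lne 'E_P[fun w => expR (lambda * (activity t w)%:R)])%E
       @[t --> +oo]).

End process.
End finite_state_processes.

Variant kcm := East | FA1f_two_empty | FA1f_one_empty.

(* [i : 'I_N] stands for the site [i.+1] of {1, ..., N}; [true] is "occupied". *)
Definition config (N : nat) := {ffun 'I_N -> bool}.

Definition flip N (eta : config N) (i : 'I_N) : config N :=
  [ffun j => if j == i then ~~ eta j else eta j].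

(* The boundary values [eta_0] and [eta_{N+1}]; [eta_0] is irrelevant for East. *)
Definition left_boundary (m : kcm) : bool :=
  if m is FA1f_one_empty then true else false.
Definition right_boundary (m : kcm) : bool := false.

(* [occ m eta k] is [eta_k], for [0 <= k <= N + 1]. *)
Definition occ (m : kcm) N (eta : config N) (k : nat) : bool :=
  if k is k'.+1 then oapp eta (right_boundary m) (insub k')
  else left_boundary m.

Section kcm_dynamics.
Context {R : realType}.
Variables (m : kcm) (rho : R).

Definition constraint N (eta : config N) (i : 'I_N) : R :=
  let k := i.+1 in
  match m with
  | East => 1 - (occ m eta k.+1)%:R
  | FA1f_two_empty | FA1f_one_empty =>
      1 - (occ m eta k.-1)%:R * (occ m eta k.+1)%:R
  end.

Definition rate N (eta : config N) (i : 'I_N) : R :=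
  constraint eta i *
  ((eta i)%:R * (1 - rho) + (1 - (eta i)%:R) * rho).

Definition generator N (f : config N -> R) (eta : config N) : R :=
  \sum_(i < N) rate eta i * (f (flip eta i) - f eta).

Definition bernoulli_weight N (eta : config N) : R :=
  \prod_(i < N) (if eta i then rho else 1 - rho).

(* The common value of nu(c_j), 2 <= j <= N - 1; see [mean_rateE]. *)
Definition mean_activity : R :=
  match m with
  | East => 2 * rho * (1 - rho) ^+ 2
  | FA1f_two_empty | FA1f_one_empty => 2 * rho * (1 - rho) * (1 - rho ^+ 2)
  end.

Definition kcm_process N d (T : measurableType d) (P : probability T R)
    (X : R -> T -> config N) : Prop :=
  markov_process P X (@bernoulli_weight N) (@generator N).

End kcm_dynamics.

Lemma bernoulli_weight_prod (R : realType) (rho : R) N (g : 'I_N -> bool -> R) :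
  \sum_(eta : config N) bernoulli_weight rho eta * \prod_(i < N) g i (eta i) =
  \prod_(i < N) (rho * g i true + (1 - rho) * g i false).
Proof.
transitivity (\sum_(eta : config N)
    \prod_(i < N) ((if eta i then rho else 1 - rho) * g i (eta i))).
  by apply: eq_bigr => eta _; rewrite -big_split.
rewrite -(bigA_distr_bigA (fun i b => (if b then rho else 1 - rho) * g i b)).
by apply: eq_bigr => i _; rewrite big_bool.
Qed.

Lemma mean_rateE (R : realType) (m : kcm) (rho : R) N (i : 'I_N) :
  (2 <= i.+1 <= N.-1)%N ->
  \sum_(eta : config N) bernoulli_weight rho eta * rate m rho eta i =
  mean_activity m rho.
Proof.
case: i => [k hkN] /= hk.
have hl : (k.-1 < N)%N by lia.
have hr : (k.+1 < N)%N by lia.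
pose i := Ordinal hkN; pose l := Ordinal hl; pose r := Ordinal hr.
have il : l != i by apply/eqP => -[]; lia.
have ir : r != i by apply/eqP => -[]; lia.
have lr : r != l by apply/eqP => -[]; lia.
have occr eta : occ m eta k.+2 = eta r :> bool by rewrite /occ insubT.
have occl eta : occ m eta k = eta l :> bool.
  by rewrite /occ; case: (k) hk hl @l {il lr} => // k' _ hl l; rewrite insubT.
pose w (b : bool) : R := b%:R * (1 - rho) + (1 - b%:R) * rho.
pose g (u v : bool -> R) (j : 'I_N) : bool -> R :=
  if j == i then w else if j == r then u else if j == l then v
  else fun=> 1.
have gE u v eta : \prod_(j < N) g u v j (eta j) = w (eta i) * (u (eta r) * v (eta l)).
  rewrite (bigD1 i)//= (bigD1 r)//= (bigD1 l)/=; last first.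
    by rewrite il eq_sym lr.
  rewrite big1 ?mulr1; last first.
    by move=> j /andP[/andP[ji jr] jl]; rewrite /g (negbTE ji) (negbTE jr) (negbTE jl).
  by rewrite /g !eqxx (negbTE il) (negbTE ir) eq_sym (negbTE lr).
have gS u v : \sum_(eta : config N) bernoulli_weight rho eta *
    (w (eta i) * (u (eta r) * v (eta l))) =
    (2 * rho * (1 - rho)) * ((rho * u true + (1 - rho) * u false) *
      (rho * v true + (1 - rho) * v false)).
  under eq_bigr do rewrite -gE.
  rewrite bernoulli_weight_prod.
  rewrite (bigD1 i)//= (bigD1 r)//= (bigD1 l)/=; last first.
    by rewrite il eq_sym lr.
  rewrite big1 ?mulr1; last first.
    move=> j /andP[/andP[ji jr] jl].
    by rewrite /g (negbTE ji) (negbTE jr) (negbTE jl); ring.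
  rewrite /g !eqxx (negbTE il) (negbTE ir) eq_sym (negbTE lr) /w /=; ring.
have gS1 := gS (fun=> 1) (fun=> 1).
have gSr := gS (fun b => 1 - b%:R) (fun=> 1).
have gSrl := gS (fun b => b%:R) (fun b => b%:R).
case: m occr occl => /= occr occl.
- transitivity (\sum_(eta : config N) bernoulli_weight rho eta *
    (w (eta i) * ((1 - (eta r)%:R) * 1))).
    by apply: eq_bigr => eta _; rewrite /rate /constraint /= occr /w; ring.
  by rewrite gSr /=; ring.
all: transitivity (\sum_(eta : config N) (bernoulli_weight rho eta *
    (w (eta i) * (1 * 1)) - bernoulli_weight rho eta *
    (w (eta i) * ((eta r)%:R * (eta l)%:R)))).
1,3: by apply: eq_bigr => eta _; rewrite /rate /constraint /= occr occl /w; ring.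
all: by rewrite sumrB gS1 gSrl /=; ring.
Qed.

Lemma finite_jump_times (R : realType) (S : finType) d (T : measurableType d)
    (P : probability T R) (X : R -> T -> S) mu L (t : R) (w : T) :
  markov_process P X mu L -> finite_set (jump_times X t w).
Proof.
move=> [_ rc ll _ _].
have loc (i : R) : exists e : R, 0 < e /\ (0 <= i -> forall s : R, 0 < s -> s != i ->
    i - e < s < i + e -> \forall u \near s^'-, X u w = X s w).
  have [i0|i0] := ltP i 0; first by exists 1; split=> // /(lt_le_trans i0); rewrite ltxx.
  have [e1 /= e1_gt0 he1] := rc w i i0.
  have [e2 [e2_gt0 he2]] : exists e2, 0 < e2 /\ (0 < i -> exists x, forall u,
      i - e2 < u < i -> X u w = x).
    move: i0; rewrite le_eqVlt => /predU1P[<-|i0].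
      by exists 1; split=> //; rewrite ltxx.
    have [x [e2 /= e2_gt0 he2]] := ll w i i0; exists e2; split=> // _.
    exists x => u /andP[u1 u2]; apply: he2 => //=.
    by rewrite ger0_norm; lra.
  exists (Num.min e1 e2); split; first by rewrite lt_min e1_gt0.
  move=> _ s s0 si /andP[].
  have m1 : Num.min e1 e2 <= e1 by rewrite ge_min lexx.
  have m2 : Num.min e1 e2 <= e2 by rewrite ge_min lexx orbT.
  move=> s1 s2; case: (ltgtP s i) si => // ltsi _.
    have [x hx] := he2 (lt_trans s0 ltsi).
    near=> u; have us : u < s by near: u; exact: nbhs_left_lt.
    have ui : i - e2 < u by near: u; apply: nbhs_left_gt; lra.
    by rewrite !hx//; apply/andP; split; lra.
  near=> u; have us : u < s by near: u; exact: nbhs_left_lt.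
  have ui : i < u by near: u; apply: nbhs_left_gt; lra.
  by rewrite (he1 u) ?(he1 s)//= ltr0_norm; lra.
have /choice[e he] := loc.
have := @segment_compact R 0 t; rewrite compact_cover.
move=> /(_ R `[0, t]%classic (fun i => ball i (e i))) [].
- by move=> i _; apply: ball_open; have [] := he i.
- by move=> s ts; exists s => //; apply: ballxx; have [] := he s.
move=> D' D'sub cov; apply: (@sub_finite_set _ _ [set` D']); last exact: finite_fset.
move=> s [/andP[s0 st] jump].
have [|i iD] := cov s; first by rewrite /= in_itv /= (ltW s0).
rewrite ball_itv /= in_itv /= => si.
have [->//|neq] := eqVneq s i.
have := D'sub _ iD; rewrite inE /= in_itv /= => /andP[i0 _].
by case: jump; have [_ /(_ i0 s s0 neq si)] := he i.
Unshelve. all: by end_near.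
Qed.

(* Main.v *)
(** The generating function of the activity grows at the rate of the largest Rayleigh quotient of a
symmetric tilted generator, namely the supremum over normalized f of
[(e^lambda - 1) E[H f^2] - e^lambda D(f)], where D is the Dirichlet form and H the total flip rate.
At lambda = alpha / N this tends to [max (A alpha, - Sigma)], where Sigma is the infimum of D(f) over
all sizes and all normalized f supported on the configurations in which two given neighbours are
both occupied. Both regimes of the statement are read off this formula.

Lower bound: f = 1 gives A alpha; for - Sigma, inserting occupied sites between the two occupied
neighbours turns f into a function on a larger system with the same Rayleigh quotient, so the
activity of that function stays bounded while N grows.

Upper bound: conditionally on the last empty site of a bounded window, the sites to its left follow
an East dynamics with empty boundary, and the Poincare inequality forces f^2 to be close to
equilibrium there, at a cost D(f) / N per site. Hence E[H f^2] / N is close to A as soon as f^2 gives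
a small weight to long fully occupied windows. When alpha < 0, an IMS partition of unity
splits off the configurations containing such windows; those parts cost Sigma each. When alpha >= 0,
such windows can only lower the activity.

Sigma > 0 follows from Barta's argument for the East dynamics resampled in blocks of length l with
rho^l small: the supersolution is 2 to the power of the number of consecutive fully occupied blocks. *)

Require Import Defs.
From mathcomp Require Import all_boot all_order all_algebra.
From mathcomp Require Import finmap.
From mathcomp Require Import all_classical all_reals all_analysis.
From mathcomp Require Import measurable_realfun.
From mathcomp Require Import zify ring lra.

Set Implicit Arguments.
Unset Strict Implicit.
Unset Printing Implicit Defensive.

Import Order.TTheory GRing.Theory Num.Theory.
Import numFieldNormedType.Exports.

Local Open Scope classical_set_scope.
Local Open Scope ring_scope.

(** * Counting jumps on a grid *)

(** No spectral theorem is used. The process is known only through a transition function whose right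
    derivative at time 0 is the generator, so the semigroup is never written as an exponential. The
    activity is the limit of the number of changes along a grid, which turns its generating function
    into n-fold products of the tilted kernel of step t / n; these are bounded in L2, from above by
    a one-step estimate and from below by log-convexity.

    The Poincare constant grows exponentially with the window. This is harmless because the window
    is fixed before N: the constant multiplies D(f) together with a factor e^lambda - 1 = O(1 / N).

    The FA-1f constraints dominate the East ones, so one Poincare inequality and one killing
    estimate serve all three models. Two neighbours are taken occupied because an occupied site
    inserted between them is frozen in every model and leaves the other constraints unchanged.

    The IMS partition must cost O(1) although N sites may flip: it is a normalized vector with one
    component sqrt N, which makes each flip cost O(1 / N). *)

Section path_discretization.
Context {R : realType} {S : eqType}.
Variable x : R -> S.
Hypothesis x_right_cts : forall t : R, 0 <= t -> \forall s \near t^'+, x s = x t.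

(** Continuous induction along [a, b]: at the supremum [s] of the times up to which the path is
    constant, the absence of a jump transfers the value to [s], and right continuity carries it past
    [s] unless [s = b]. *)
Lemma path_cst_no_jump (a b : R) : 0 <= a -> a <= b ->
  (forall s, a < s <= b -> \forall u \near s^'-, x u = x s) -> x b = x a.
Proof.
move=> a0 ab nojump.
pose E := [set u | a <= u <= b /\ forall v, a <= v <= u -> x v = x a].
have Ea : E a.
  split; first by rewrite lexx ab.
  by move=> v va; congr x; apply/eqP; rewrite eq_le andbC.
have Eub : ubound E b by move=> u [/andP[]].
have hsE : has_sup E by split; [exists a|exists b].
pose s := sup E.
have as_ : a <= s by apply: sup_upper_bound.
have sb : s <= b by apply: ge_sup => //; exists a.
have below v : a <= v < s -> x v = x a.
  move=> /andP[av vs].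
  have [u [_ Eu] vu] : exists2 u, E u & v < u.
    have vs' : 0 < s - v by rewrite subr_gt0.
    by have [u Eu] := sup_adherent vs' hsE; rewrite opprB addrC subrK => vu; exists u.
  by apply: Eu; rewrite av ltW.
have xs : x s = x a.
  move: as_; rewrite le_eqVlt => /predU1P[<-//|as_].
  have nj := nojump s; rewrite as_ sb in nj.
  have : \forall u \near s^'-, x s = x a.
    near=> u.
    have us : u < s by near: u; exact: nbhs_left_lt.
    have au : a < u by near: u; exact: nbhs_left_gt.
    rewrite -(below u) ?us ?(ltW au)//; apply/esym.
    by near: u; exact: nj.
  by move=> /filter_ex[].
have Es v : a <= v <= s -> x v = x a.
  move=> /andP[av]; rewrite le_eqVlt => /predU1P[->//|vs].
  by apply: below; rewrite av.
move: sb; rewrite le_eqVlt => /predU1P[<-//|sb].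
have : \forall u \near s^'+, False.
  have [e /= e0 he] := x_right_cts (le_trans a0 as_).
  near=> u.
  have su : s < u by near: u; exact: nbhs_right_gt.
  have ub : u <= b by near: u; apply: nbhs_right_le.
  have ue : u < s + e by near: u; apply: nbhs_right_lt; rewrite ltrDl.
  have : E u.
    split; first by rewrite ub (le_trans as_ (ltW su)).
    move=> v /andP[av vu]; have [vs|sv] := leP v s; first by apply: Es; rewrite av.
    rewrite (he v) //= ltr0_norm; lra.
  by move=> /(sup_upper_bound hsE); rewrite leNgt su.
by move=> /filter_ex[].
Unshelve. all: by end_near.
Qed.

Variable t : R.
Hypothesis t_gt0 : 0 < t.
Let J := [set s | 0 < s <= t /\ ~ \forall u \near s^'-, x u = x s].
Hypothesis finJ : finite_set J.

Definition grid_changes (n : nat) : nat :=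
  \sum_(k < n) (x (k%:R * (t / n%:R)) != x (k.+1%:R * (t / n%:R))).

(** Half-open cells partition the times 0 < s <= t, so every jump is counted exactly once. *)
Let cell (n k : nat) (s : R) := k%:R * (t / n%:R) < s <= k.+1%:R * (t / n%:R).

Let cell_sum (n : nat) (s : R) : (0 < n)%N -> 0 < s <= t ->
  (\sum_(k < n) cell n k s = 1)%N.
Proof.
move=> n0 /andP[s0 st]; have h0 : 0 < t / n%:R by rewrite divr_gt0 ?ltr0n.
apply/eqP; rewrite -(eqr_nat R) natr_sum.
rewrite -(big_mkord xpredT (fun k => (cell n k s)%:R)) /=.
have E k : (cell n k s)%:R =
    (s <= k.+1%:R * (t / n%:R))%R%:R - (s <= k%:R * (t / n%:R))%R%:R :> R.
  rewrite /cell ltNge; case: (leP s (k%:R * _)) => //= [sk|_]; last by rewrite subr0.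
  by rewrite (le_trans sk) ?subrr// ler_wpM2r ?ler_nat// ltW.
under eq_bigr do rewrite E.
rewrite telescope_sumr// mul0r (leNgt s 0) s0 subr0 mulrCA divff ?pnatr_eq0 -?lt0n// mulr1.
by rewrite st.
Qed.

Let jump_count (n : nat) : (0 < n)%N ->
  #|` fset_set J| = (\sum_(k < n) \sum_(s <- fset_set J) cell n k s)%N.
Proof.
move=> n0; rewrite exchange_big /= [RHS]big_seq.
rewrite (eq_bigr (fun=> 1%N)) -?big_seq ?sum1_size// => s.
by rewrite in_fset_set// inE => -[s0t _]; rewrite cell_sum.
Qed.

Let node_ge0 (n k : nat) : 0 <= k%:R * (t / n%:R).
Proof. by rewrite mulr_ge0// divr_ge0// ltW. Qed.

Let node_le (n k : nat) : k%:R * (t / n%:R) <= k.+1%:R * (t / n%:R).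
Proof. by rewrite ler_wpM2r ?ler_nat// divr_ge0// ltW. Qed.

Let node_t (n : nat) (k : 'I_n) : k.+1%:R * (t / n%:R) <= t.
Proof.
rewrite mulrCA -[leRHS]mulr1 ler_wpM2l ?(ltW t_gt0)//.
case: n k => [[]//|n] k.
by rewrite ler_pdivrMr ?ltr0n// mul1r ler_nat.
Qed.

(** A cell whose end values differ contains a jump; several jumps in one cell count at most once,
    hence only an inequality. *)
Lemma grid_changes_le (n : nat) : (0 < n)%N -> (grid_changes n <= #|` fset_set J|)%N.
Proof.
move=> n0; rewrite (jump_count n0); apply: leq_sum => k _.
case: eqP => //= ne; rewrite lt0n; apply/negP => /eqP c0; apply: ne.
apply/esym/path_cst_no_jump => // s /andP[s1 s2]; apply: contrapT => nj.
have sJ : s \in fset_set J.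
  rewrite in_fset_set// inE; split => //.
  by rewrite (le_lt_trans (node_ge0 n k) s1) (le_trans s2 (node_t k)).
by move: c0; rewrite (big_fsetD1 s)//= /cell s1 s2.
Qed.

Let jump_gap : exists2 e : R, 0 < e & forall s s', s \in fset_set J ->
  s' \in fset_set J -> s != s' -> e <= `|s - s'|.
Proof.
pose pairs := [seq p <- [seq (a, b) | a <- fset_set J, b <- fset_set J] | p.1 != p.2].
have [e e0 he] : exists2 e : R, 0 < e & forall p, p \in pairs -> e <= `|p.1 - p.2|.
  have : all (fun p => p.1 != p.2) pairs by exact: filter_all.
  elim: pairs => [|p r IH] /=; first by exists 1.
  move=> /andP[p12 /IH[e e0 he]].
  exists (Num.min e `|p.1 - p.2|); first by rewrite lt_min e0 normr_gt0 subr_eq0.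
  by move=> q; rewrite inE ge_min => /predU1P[->|/he ->//]; rewrite lexx orbT.
exists e => // s s' sJ s'J ne.
apply: (he (s, s')); rewrite mem_filter ne/=; apply/allpairsP; exists (s, s'); split => //.
Qed.

(** Once the mesh is below the smallest gap between jumps, a cell has at most one jump, and this
    jump is visible at the ends of the cell: equal end values would make the path left continuous at
    the jump time. *)
Lemma grid_changes_near :
  \forall n \near \oo, grid_changes n = #|` fset_set J|.
Proof.
have [e e0 he] := jump_gap.
near=> n.
have n0 : (0 < n)%N by near: n; exact: nbhs_infty_gt.
have hn : t / n%:R < e.
  rewrite ltr_pdivrMr ?ltr0n// -ltr_pdivrMl//.
  by near: n; exact: nbhs_infty_gtr.
apply/eqP; rewrite eqn_leq grid_changes_le//= (jump_count n0).
apply: leq_sum => k _.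
have uniq_cell s s' : s \in fset_set J -> s' \in fset_set J -> cell n k s -> cell n k s' -> s = s'.
  move=> sJ s'J /andP[s1 s2] /andP[s3 s4]; apply/eqP/negPn/negP => ne.
  have := he _ _ sJ s'J ne; rewrite leNgt => /negP; apply.
  apply: lt_trans hn; move: s1 s2 s3 s4; rewrite -natr1 mulrDl mul1r.
  by rewrite ltr_norml; lra.
have [/hasP[s sJ cs]|/hasPn nocell] := boolP (has (cell n k) (fset_set J)); last first.
  by rewrite big_seq big1// => s /nocell/negbTE->.
rewrite (big_fsetD1 s)//= cs big_seq big1 ?addn0; last first.
  move=> s'; rewrite !inE => /andP[ne s'J]; apply/eqP; rewrite eqb0; apply/negP => cs'.
  by rewrite (uniq_cell s s') ?eqxx in ne.
rewrite lt0b; apply/negP => /eqP xx.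
move: (sJ); rewrite in_fset_set// inE => -[s0t]; apply.
move: cs => /andP[s1 s2].
have xs : x (k.+1%:R * (t / n%:R)) = x s.
  apply: path_cst_no_jump => //; first by rewrite (le_trans (node_ge0 n k))// ltW.
  move=> s' /andP[s'1 s'2]; apply: contrapT => nj.
  have s'J : s' \in fset_set J.
    rewrite in_fset_set// inE; split => //; move: s0t => /andP[s0 _].
    by rewrite (lt_trans s0 s'1) (le_trans s'2 (node_t k)).
  have := uniq_cell s s' sJ s'J; rewrite /cell s1 s2 s'2 (lt_trans s1 s'1).
  by move=> /(_ isT isT) ss'; rewrite ss' ltxx in s'1.
near=> u.
have us : u < s by near: u; exact: nbhs_left_lt.
have ku : k%:R * (t / n%:R) < u by near: u; exact: nbhs_left_gt.
rewrite -xs -xx; apply: path_cst_no_jump => //; first exact: ltW.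
move=> s' /andP[s'1 s'2]; apply: contrapT => nj.
have s's : s' < s by exact: le_lt_trans us.
have s'J : s' \in fset_set J.
  rewrite in_fset_set// inE; split => //; move: s0t => /andP[_ st].
  by rewrite (le_lt_trans (node_ge0 n k) s'1) (le_trans (ltW s's) st).
have := uniq_cell s s' sJ s'J; rewrite /cell s1 s2 s'1 (le_trans (ltW s's) s2).
by move=> /(_ isT isT) ss'; rewrite ss' ltxx in s's.
Unshelve. all: by end_near.
Qed.
End path_discretization.

(** * Exponential moments of the activity as limits of iterated tilted kernels *)

Section tilted_kernel.
Context {R : realType} {S : finType}.
Implicit Types (p : R -> S -> S -> R) (f : S -> R).

Definition tilt (lambda : R) (a b : S) : R := if a == b then 1 else expR lambda.

Definition tilted_op p (lambda h : R) f (a : S) : R :=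
  \sum_(b : S) p h a b * tilt lambda a b * f b.

Lemma tilt_gt0 lambda a b : 0 < tilt lambda a b.
Proof. by rewrite /tilt; case: ifP => // _; rewrite expR_gt0. Qed.

Lemma tilted_op_ge0 p lambda h f : transition_function p -> 0 <= h ->
  (forall a, 0 <= f a) -> forall a, 0 <= tilted_op p lambda h f a.
Proof.
move=> [p0 _ _ _] h0 f0 a; apply: sumr_ge0 => b _.
by rewrite !mulr_ge0// ?p0// ltW// tilt_gt0.
Qed.

End tilted_kernel.

Section tilted_process.
Context {R : realType} {S : finType} {d : measure_display} {T : measurableType d}.
Variables (P : probability T R) (X : R -> T -> S).
Variables (mu : S -> R) (L : (S -> R) -> (S -> R)).
Hypothesis mp : markov_process P X mu L.

Let measurable_level (t : R) (x : S) : 0 <= t -> measurable [set w | X t w = x].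
Proof. by have [+ _ _ _ _] := mp; apply. Qed.

Let measurable_tilt (lambda s t : R) : 0 <= s -> 0 <= t ->
  measurable_fun setT (fun w => tilt lambda (X s w) (X t w)).
Proof.
move=> s0 t0 _ B mB; rewrite setTI.
rewrite (_ : _ @^-1` B = \bigcup_(q in [set q : S * S | B (tilt lambda q.1 q.2)])
  ([set w | X s w = q.1] `&` [set w | X t w = q.2])).
  by apply: fin_bigcup_measurable => // q _; apply: measurableI; exact: measurable_level.
apply/seteqP; split => w /=; first by move=> Bw; exists (X s w, X t w).
by move=> [[a b] /= Bab [-> ->]].
Qed.

Definition tilted_path (lambda s h : R) (m : nat) (w : T) : R :=
  \prod_(j < m) tilt lambda (X (s + j%:R * h) w) (X (s + j.+1%:R * h) w).

Let tilted_path_ge0 lambda s h m w : 0 <= tilted_path lambda s h m w.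
Proof. by apply: prodr_ge0 => j _; rewrite ltW// tilt_gt0. Qed.

Lemma measurable_tilted_path lambda s h m : 0 <= s -> 0 <= h ->
  measurable_fun setT (tilted_path lambda s h m).
Proof.
move=> s0 h0; elim: m => [|m IH].
  rewrite (_ : tilted_path _ _ _ _ = cst 1); first exact: measurable_cst.
  by apply/funext => w; rewrite /tilted_path big_ord0.
rewrite (_ : tilted_path _ _ _ _ = tilted_path lambda s h m \*
    (fun w => tilt lambda (X (s + m%:R * h) w) (X (s + m.+1%:R * h) w))); last first.
  by apply/funext => w; rewrite /tilted_path big_ord_recr.
by apply: measurable_realfun.measurable_funM => //; apply: measurable_tilt; rewrite addr_ge0// mulr_ge0.
Qed.

Let past_event (past : seq (R * S)) (s : R) (x : S) :=
  [set w | (forall q, q \in past -> X q.1 w = q.2) /\ X s w = x].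

Let measurable_past_event past s x : 0 <= s ->
  (forall q, q \in past -> 0 <= q.1 <= s) -> measurable (past_event past s x).
Proof.
move=> s0 hpast; rewrite /past_event.
rewrite (_ : [set w | _] = (\bigcap_(q in [set` past]) [set w | X q.1 w = q.2]) `&`
  [set w | X s w = x]); last by apply/seteqP; split.
apply: measurableI; last exact: measurable_level.
apply: fin_bigcap_measurable => // q /= /hpast/andP[q0 _].
exact: measurable_level.
Qed.

(** An arbitrary finite past makes the induction go through: each step moves the present pair
    [(s, x)] into the past before the path is continued from [s + h]. *)
Lemma integral_tilted_path p lambda h m (past : seq (R * S)) (s : R) (x : S) :
  markov_property P X p -> transition_function p -> 0 <= h -> 0 <= s ->
  (forall q, q \in past -> 0 <= q.1 <= s) ->
  (\int[P]_(w in past_event past s x) (tilted_path lambda s h m w)%:E =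
   P (past_event past s x) * (iter m (tilted_op p lambda h) (fun=> 1) x)%:E)%E.
Proof.
move=> markov tp h0; elim: m past s x => [|m IH] past s x s0 past_s.
  under eq_integral do rewrite /tilted_path big_ord0.
  by rewrite integral_cst ?mul1e ?mule1//; exact: measurable_past_event.
pose Hy y := past_event ((s, x) :: past) (s + h) y.
have shE (k : nat) : s + k.+1%:R * h = s + h + k%:R * h.
  by rewrite -natr1 mulrDl mul1r addrA addrAC.
have sh0 : 0 <= s + h by rewrite addr_ge0.
have past_sh q : q \in (s, x) :: past -> 0 <= q.1 <= s + h.
  rewrite inE => /predU1P[->/=|/past_s/andP[-> qs]]; first by rewrite s0 lerDl.
  by rewrite (le_trans qs)// lerDl.
have HyE y : Hy y = past_event past s x `&` [set w | X (s + h) w = y].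
  apply/seteqP; split => w; rewrite /Hy /past_event /=.
    move=> [h1 <-]; split => //; split; last by apply: (h1 (s, x)); rewrite inE eqxx.
    by move=> q qp; apply: h1; rewrite inE qp orbT.
  by move=> [[h1 h2] h3]; split => // q; rewrite inE => /predU1P[->//|/h1].
have HE : past_event past s x = \big[setU/set0]_(y <- index_enum S) Hy y.
  apply/seteqP; split => w.
    move=> Hw; rewrite -bigcup_seq; exists (X (s + h) w) => /=.
      by rewrite mem_index_enum.
    by rewrite HyE.
  by rewrite -bigcup_seq => -[y _]; rewrite HyE => -[].
have mH y : measurable (Hy y) by exact: measurable_past_event.
have mpath q k : 0 <= q -> measurable_fun setT (EFin \o tilted_path lambda q h k).
  by move=> q0; apply/measurable_EFinP; exact: measurable_tilted_path.
rewrite [in LHS]HE ge0_integral_bigsetU//=; first last.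
- by move=> w _; rewrite lee_fin.
- by apply: measurable_funTS; exact: mpath.
- apply/trivIsetP => y z _ _ yz; rewrite !HyE; apply/seteqP; split => // w /= [[_ e1] [_ e2]].
  by move: yz; rewrite -e1 -e2 eqxx.
- exact: index_enum_uniq.
under eq_bigr => y _.
  rewrite (eq_integral (fun w => (tilt lambda x y)%:E * (tilted_path lambda (s + h) h m w)%:E)%E); last first.
    move=> w; rewrite inE HyE => -[[_ xs] xsh].
    rewrite -EFinM /tilted_path big_ord_recl mul0r addr0 mul1r xs xsh; congr (_ * _)%:E.
    by apply: eq_bigr => j _; rewrite !shE.
  rewrite ge0_integralZl//; last 3 first.
  - by apply: measurable_funTS; exact: mpath.
  - by move=> w _; rewrite lee_fin.
  - by rewrite lee_fin ltW// tilt_gt0.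
  rewrite [X in (_ * X)%E]IH//.
  have -> : P (past_event ((s, x) :: past) (s + h) y) = (P (past_event past s x) * (p h x y)%:E)%E.
    by rewrite -/(Hy y) HyE; exact: markov.
  rewrite muleCA -muleA -!EFinM mulrA.
  over.
rewrite /= -ge0_sume_distrr ?sumEFin//.
move=> y _; rewrite lee_fin !mulr_ge0//; last 1 first.
- by elim: (m) y => [//|k IHk] y /=; apply: tilted_op_ge0.
- by case: tp => + _ _ _; apply.
- by rewrite ltW// tilt_gt0.
Qed.

Lemma expectation_tilted_path p lambda h m :
  markov_property P X p -> transition_function p -> 0 <= h ->
  (\int[P]_w (tilted_path lambda 0 h m w)%:E =
   (\sum_x mu x * iter m (tilted_op p lambda h) (fun=> 1) x)%:E)%E.
Proof.
move=> markov tp h0.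
pose H x := past_event [::] 0 x.
have HE x : H x = [set w | X 0 w = x] by apply/seteqP; split => w; [case|].
have TE : setT = \big[setU/set0]_(x <- index_enum S) H x.
  apply/seteqP; split => w // _; rewrite -bigcup_seq; exists (X 0 w) => /=.
    by rewrite mem_index_enum.
  by rewrite HE.
rewrite [X in integral _ X]TE ge0_integral_bigsetU//=; first last.
- by move=> w _; rewrite lee_fin.
- by apply: measurable_funTS; apply/measurable_EFinP; exact: measurable_tilted_path.
- apply/trivIsetP => y z _ _ yz; rewrite !HE; apply/seteqP; split => // w /= [e1 e2].
  by move: yz; rewrite -e1 -e2 eqxx.
- exact: index_enum_uniq.
- by move=> x; rewrite HE; exact: measurable_level.
rewrite -sumEFin; apply: eq_bigr => x _.
rewrite (integral_tilted_path _ _ _ markov tp)// EFinM; congr (_ * _)%E.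
by rewrite -/(H x) HE; have [_ _ _ -> _] := mp.
Qed.

Variable t : R.
Hypothesis t_gt0 : 0 < t.

Let rc w (s : R) : 0 <= s -> \forall u \near s^'+, X u w = X s w.
Proof. by have [_ + _ _ _] := mp; apply. Qed.

Let tilted_path_grid lambda n w :
  tilted_path lambda 0 (t / n%:R) n w =
  expR (lambda * (grid_changes (X ^~ w) t n)%:R).
Proof.
rewrite /tilted_path /grid_changes natr_sum mulr_sumr expR_sum.
apply: eq_bigr => j _; rewrite !add0r /tilt.
by case: eqP => /=; rewrite ?mulr0 ?expR0 ?mulr1.
Qed.

Let Z (lambda : R) n w := (tilted_path lambda 0 (t / n%:R) n w)%:E.
Let A (lambda : R) w := (expR (lambda * (activity X t w)%:R))%:E.

Let cvg_Z lambda w : Z lambda n w @[n --> \oo] --> A lambda w.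
Proof.
apply: cvg_near_cst; have fin := finite_jump_times t w mp.
have := grid_changes_near (rc w) t_gt0 fin.
by apply: filterS => n; rewrite /Z tilted_path_grid => ->.
Qed.

Let measurable_Z lambda n : measurable_fun setT (Z lambda n).
Proof. by apply/measurable_EFinP; apply: measurable_tilted_path; rewrite ?divr_ge0// ltW. Qed.

Let measurable_A lambda : measurable_fun setT (A lambda).
Proof. by apply: (emeasurable_fun_cvg (Z lambda)) => // w _; exact: cvg_Z. Qed.

Let Z_ge0 lambda n w : (0 <= Z lambda n w)%E.
Proof. by rewrite lee_fin. Qed.

(** Fatou's lemma, which needs no domination and so covers every sign of [lambda]. *)
Lemma expectation_activity_le lambda (c : \bar R) :
  (\forall n \near \oo, (\int[P]_w (tilted_path lambda 0 (t / n%:R) n w)%:E <= c)%E) ->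
  ('E_P[fun w => expR (lambda * (activity X t w)%:R)] <= c)%E.
Proof.
move=> hc; rewrite unlock.
have [N _ hN] := hc.
(* The bound is only eventual in [n]; the shift by [N] makes it hold for every index. *)
have -> : (\int[P]_w (expR (lambda * (activity X t w)%:R))%:E =
    \int[P]_w limn_einf (fun n => Z lambda (n + N)%N w))%E.
  apply: eq_integral => w _.
  have cvgN : Z lambda (n + N)%N w @[n --> \oo] --> A lambda w.
    by rewrite (cvg_shiftn N (fun n => Z lambda n w)); exact: cvg_Z.
  by rewrite (cvg_limn_einf_sup cvgN).
apply: le_trans (fatou _ _ (fun n => measurable_Z lambda (n + N)%N) _) _ => //.
rewrite limn_einf_lim; apply: lime_le; first exact: is_cvg_einfs.
near=> n; apply: (@le_trans _ _ (\int[P]_x Z lambda (n + N)%N x)%E).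
  by apply: ereal_inf_lbound; exists n => //=.
by apply: hN => /=; rewrite leq_addl.
Unshelve. all: by end_near.
Qed.

(** For [lambda >= 0] the grid undercounts the jumps, so a single grid suffices; for [lambda < 0]
    the integrands are at most 1 and dominated convergence applies. *)
Lemma expectation_activity_ge lambda (c : \bar R) :
  (\forall n \near \oo, (c <= \int[P]_w (tilted_path lambda 0 (t / n%:R) n w)%:E)%E) ->
  (c <= 'E_P[fun w => expR (lambda * (activity X t w)%:R)])%E.
Proof.
move=> hc; rewrite unlock.
have [l0|l0] := leP 0 lambda.
  have [n [n0 hn]] : exists n, (0 < n)%N /\ (c <= \int[P]_w Z lambda n w)%E.
    by have [n [hn n0]] := filter_ex (filterI hc (nbhs_infty_gt 0)); exists n.
  apply: le_trans hn _; apply: ge0_le_integral => //; try exact: measurable_A.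
  move=> w _; rewrite /Z tilted_path_grid lee_fin ler_expR ler_wpM2l// ler_nat.
  have fin := finite_jump_times t w mp.
  exact: (grid_changes_le (rc w) t_gt0 fin n0).
have [] := @dominated_convergence _ _ _ P setT measurableT (Z lambda) (A lambda) (cst 1%E).
- exact: measurable_Z.
- exact: measurable_A.
- by apply: aeW => w _; exact: cvg_Z.
- exact: finite_measure_integrable_cst.
- apply: aeW => w n _; rewrite /Z tilted_path_grid lee_fin ger0_norm ?expR_ge0//.
  by rewrite expR_le1 mulr_le0_ge0// ltW.
move=> _ _ cvgI.
have E : (fun n => \int[P]_w Z lambda n w)%E n @[n --> \oo] --> (\int[P]_w A lambda w)%E by exact: cvgI.
rewrite -(cvg_lim _ E)//; apply: lime_ge => //; first by apply/cvg_ex; eexists; exact: E.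
Unshelve. all: by end_near.
Qed.
End tilted_process.

(** * Discretized semigroups of symmetric kernels *)

Section weighted_form.
Context {R : realType} {S : finType}.
Variable mu : S -> R.
Hypothesis mu_gt0 : forall x, 0 < mu x.
Implicit Types (f g u v : S -> R) (K : S -> S -> R).

Definition wform f g : R := \sum_x mu x * (f x * g x).
Definition kapp K f (x : S) : R := \sum_y K x y * f y.

Lemma wformC f g : wform f g = wform g f.
Proof. by apply: eq_bigr => x _; rewrite (mulrC (f x)). Qed.

Lemma wform_ge0 f : 0 <= wform f f.
Proof. by apply: sumr_ge0 => x _; exact: mulr_ge0 (ltW _) (sqr_ge0 _). Qed.

Lemma wformDl f g u : wform (f \+ g) u = wform f u + wform g u.
Proof. by rewrite -big_split; apply: eq_bigr => x _ /=; rewrite mulrDl mulrDr. Qed.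

Lemma wformDr f g u : wform u (f \+ g) = wform u f + wform u g.
Proof. by rewrite wformC wformDl !(wformC u). Qed.

Lemma wformZl (c : R) f g : wform (fun x => c * f x) g = c * wform f g.
Proof. by rewrite mulr_sumr; apply: eq_bigr => x _; ring. Qed.

Lemma wformZr (c : R) f g : wform f (fun x => c * g x) = c * wform f g.
Proof. by rewrite wformC wformZl wformC. Qed.

Lemma wform_AMGM f g (e : R) : 0 < e -> 2 * wform f g <= e * wform f f + e^-1 * wform g g.
Proof.
move=> e0; rewrite !mulr_sumr -big_split; apply: ler_sum => x _ /=.
rewrite -subr_ge0.
rewrite (_ : _ - _ = mu x * (e^-1 * (e * f x - g x) ^+ 2)); last by field; exact: lt0r_neq0.
rewrite mulr_ge0 ?(ltW (mu_gt0 x))// mulr_ge0 ?sqr_ge0//.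
by rewrite invr_ge0 ltW.
Qed.

Lemma wform_cauchy_schwarz f g : wform f g ^+ 2 <= wform f f * wform g g.
Proof.
have [g0|g0] := leP (wform g g) 0.
  have g_ge0 x : 0 <= mu x * (g x * g x) by exact: mulr_ge0 (ltW _) (sqr_ge0 _).
  have gz x : g x = 0.
    have : wform g g = 0 by apply/eqP; rewrite eq_le g0 wform_ge0.
    move=> /psumr_eq0P => /(_ (fun y _ => g_ge0 y))/(_ x isT)/eqP.
    by rewrite mulf_eq0 (gt_eqF (mu_gt0 x)) mulf_eq0 orbb => /eqP.
  rewrite [X in X ^+ 2]big1 ?expr0n/= => [|x _]; last by rewrite gz !mulr0.
  by rewrite mulr_ge0// wform_ge0.
have : 0 <= wform (fun x => wform g g * f x + - wform f g * g x)
                 (fun x => wform g g * f x + - wform f g * g x) by exact: wform_ge0.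
rewrite -[X in wform X _]/((fun x => wform g g * f x) \+ (fun x => - wform f g * g x)).
rewrite -[X in wform _ X]/((fun x => wform g g * f x) \+ (fun x => - wform f g * g x)).
rewrite wformDl !wformDr !wformZl !wformZr (wformC g f).
set a := wform f f; set b := wform f g; set c := wform g g in g0 *.
rewrite (_ : _ + _ = c * (a * c - b ^+ 2)); last by ring.
by rewrite pmulr_rge0// subr_ge0.
Qed.

Lemma wform_kapp K f g : (forall x y, mu x * K x y = mu y * K y x) ->
  wform f (kapp K g) = wform (kapp K f) g.
Proof.
move=> symK; rewrite /wform /kapp.
transitivity (\sum_x \sum_y mu x * K x y * (f x * g y)).
  by apply: eq_bigr => x _; rewrite !mulr_sumr; apply: eq_bigr => y _; ring.
rewrite exchange_big; apply: eq_bigr => x _; rewrite mulr_suml mulr_sumr.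
by apply: eq_bigr => y _; rewrite (symK y x); ring.
Qed.

(** Cauchy-Schwarz with the row [K x y / mu y]. The constant is crude, but it will be multiplied by
    a vanishing time step. *)
Lemma wform_kapp_le K f (k : R) : (forall x y, `|K x y| <= k) ->
  wform (kapp K f) (kapp K f) <= (\sum_x mu x) * (\sum_y (mu y)^-1) * k ^+ 2 * wform f f.
Proof.
move=> Kk.
have pt x : kapp K f x ^+ 2 <= (\sum_y (mu y)^-1) * k ^+ 2 * wform f f.
  have -> : kapp K f x = wform (fun y => (mu y)^-1 * K x y) f.
    by apply: eq_bigr => y _; rewrite !mulrA divff ?mul1r// gt_eqF.
  apply: le_trans (wform_cauchy_schwarz _ _) _; apply: ler_wpM2r; first exact: wform_ge0.
  rewrite mulr_suml; apply: ler_sum => y _ /=.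
  rewrite (_ : mu y * _ = (mu y)^-1 * K x y ^+ 2); last by field; rewrite gt_eqF.
  apply: ler_wpM2l; first by rewrite invr_ge0 ltW.
  have := Kk x y; rewrite ler_norml => /andP[? ?].
  by rewrite -subr_ge0 subr_sqr mulr_ge0//; lra.
apply: (@le_trans _ _ (\sum_x mu x * ((\sum_y (mu y)^-1) * k ^+ 2 * wform f f))).
  by apply: ler_sum => x _; rewrite -expr2 ler_wpM2l// ltW.
by rewrite -mulr_suml !mulrA.
Qed.


Section discretized_semigroup.
Hypothesis mu_sum1 : \sum_x mu x = 1.
Variables (B : S -> S -> R) (M : R -> S -> S -> R).
Hypothesis symB : forall x y, mu x * B x y = mu y * B y x.
Hypothesis M_ge0 : forall h x y, 0 <= h -> 0 <= M h x y.
Hypothesis M_approx : forall e, 0 < e -> exists2 h0, 0 < h0 &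
  forall h x y, 0 < h < h0 -> `|M h x y - (x == y)%:R - h * B x y| <= e * h.

Let kapp_id f : kapp (fun x y => (x == y)%:R) f =1 f.
Proof.
move=> x; rewrite /kapp (bigD1 x)//= eqxx mul1r big1 ?addr0// => y yx.
by rewrite eq_sym (negbTE yx) mul0r.
Qed.

Let C0 := \sum_y (mu y)^-1.
Let C0_ge0 : 0 <= C0.
Proof. by apply: sumr_ge0 => y _; rewrite invr_ge0 ltW. Qed.

Let bB := \sum_x \sum_y `|B x y|.
Let B_le x y : `|B x y| <= bB.
Proof.
rewrite /bB (bigD1 x)//= (bigD1 y)//= -addrA lerDl addr_ge0//; first exact: sumr_ge0.
by apply: sumr_ge0 => z _; apply: sumr_ge0.
Qed.
Let bB_ge0 : 0 <= bB.
Proof. by apply: sumr_ge0 => z _; apply: sumr_ge0. Qed.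

Lemma eq_form f f' g g' : f =1 f' -> g =1 g' -> wform f g = wform f' g'.
Proof. by move=> ff gg; apply: eq_bigr => x _; rewrite ff gg. Qed.

(** In one step the squared norm grows by a factor at most 1 + 2h(s + e): the form of [B] gives 2hs,
    and the two error terms give he each. Cauchy-Schwarz against the constant 1 then bounds the sum
    by the norm of the iterate. *)
Lemma discretized_semigroup_le (s : R) (e : R) : 0 < e ->
  (forall f, wform f (kapp B f) <= s * wform f f) ->
  exists2 h0, 0 < h0 & forall h n, 0 < h < h0 ->
    \sum_x mu x * iter n (kapp (M h)) (fun=> 1) x <= expR (n%:R * h * (s + e)).
Proof.
move=> e0 hs.
(* AM-GM with weight [e1] turns the approximation error into [e1 * (1 + C0)], which is at most
   [e]. *)
pose e1 := Num.min 1 (e / (1 + C0)).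
have C1 : 0 < 1 + C0 by rewrite ltr_pwDl.
have e1_gt0 : 0 < e1 by rewrite lt_min ltr01 divr_gt0.
have [h0 h0_gt0 hM] := M_approx e1_gt0.
pose c := C0 * (bB + 1) ^+ 2.
have c_ge0 : 0 <= c by rewrite mulr_ge0// sqr_ge0.
exists (Num.min h0 (e / (1 + c))).
  by rewrite lt_min h0_gt0 divr_gt0// ltr_pwDl.
move=> h n /andP[h_gt0]; rewrite lt_min => /andP[hh0 hc].
pose E x y := h^-1 * (M h x y - (x == y)%:R) - B x y.
have E_le x y : `|E x y| <= e1.
  rewrite -(ler_pM2l h_gt0) -{1}(gtr0_norm h_gt0) -normrM.
  rewrite (_ : h * E x y = M h x y - (x == y)%:R - h * B x y).
    by rewrite [leRHS]mulrC; apply: hM; rewrite h_gt0.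
  by rewrite /E; field; rewrite gt_eqF.
pose G x y := B x y + E x y.
have G_le x y : `|G x y| <= bB + 1.
  apply: le_trans (ler_normD _ _) _; rewrite lerD//.
  by apply: le_trans (E_le x y) _; rewrite ge_min lexx.
have ME f : kapp (M h) f =1 (f \+ (fun x => h * kapp G f x)).
  move=> x /=; rewrite -(kapp_id f x) /kapp mulr_sumr -big_split.
  by apply: eq_bigr => y _ /=; rewrite /G /E; field; rewrite gt_eqF.
have GE f : kapp G f =1 kapp B f \+ kapp E f.
  by move=> x; rewrite /kapp /= -big_split; apply: eq_bigr => y _; rewrite mulrDl.
have step f : wform (kapp (M h) f) (kapp (M h) f) <= (1 + 2 * h * (s + e)) * wform f f.
  rewrite (eq_form (ME f) (ME f)) wformDl !wformDr !wformZl !wformZr (wformC _ f).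
  rewrite [wform f (kapp G f)](eq_form (frefl f) (GE f)) wformDr.
  have h1 := hs f.
  have h2 := wform_kapp_le f G_le; rewrite mu_sum1 mul1r -/C0 -/c in h2.
  have h3 := wform_kapp_le f E_le; rewrite mu_sum1 mul1r -/C0 in h3.
  have h4 := wform_AMGM f (kapp E f) e1_gt0.
  have f0 := wform_ge0 f.
  set ff := wform f f in h1 h2 h3 h4 f0 *.
  have h5 : 2 * wform f (kapp E f) <= e * ff.
    apply: le_trans h4 _.
    have : e1 ^-1 * wform (kapp E f) (kapp E f) <= e1^-1 * (C0 * e1 ^+ 2 * ff).
      by rewrite ler_wpM2l// invr_ge0 ltW.
    rewrite (_ : e1^-1 * (C0 * e1 ^+ 2 * ff) = C0 * e1 * ff); last first.
      by field; rewrite gt_eqF.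
    move=> h6; apply: le_trans (lerD (lexx _) h6) _.
    rewrite (_ : _ + _ = (e1 * (1 + C0)) * ff); last by ring.
    by rewrite ler_wpM2r// -ler_pdivlMr// ge_min lexx orbT.
  have h7 : h * wform (kapp G f) (kapp G f) <= e * ff.
    apply: (@le_trans _ _ (h * c * ff)); first by rewrite -mulrA ler_wpM2l// ltW.
    rewrite ler_wpM2r//; move: hc; rewrite ltr_pdivlMr; last by rewrite ltr_pwDl.
    by move=> /ltW; apply: le_trans; rewrite ler_wpM2l ?(ltW h_gt0)// lerDr.
  have h8 : h * (2 * wform f (kapp B f)) <= h * (2 * (s * ff)).
    by rewrite !ler_wpM2l// ltW.
  have h9 : h * (2 * wform f (kapp E f)) <= h * (e * ff) by rewrite ler_wpM2l// ltW.
  have h10 : h * (h * wform (kapp G f) (kapp G f)) <= h * (e * ff) by rewrite ler_wpM2l// ltW.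
  lra.
have one : wform (fun=> 1) (fun=> 1) = 1.
  by rewrite -[RHS]mu_sum1; apply: eq_bigr => x _; rewrite !mulr1.
have r_ge0 : 0 <= 1 + 2 * h * (s + e).
  by have := le_trans (wform_ge0 _) (step (fun=> 1)); rewrite one mulr1.
have it m : wform (iter m (kapp (M h)) (fun=> 1)) (iter m (kapp (M h)) (fun=> 1)) <=
    (1 + 2 * h * (s + e)) ^+ m.
  elim: m => [|m IH] /=; first by rewrite one.
  by apply: le_trans (step _) _; rewrite exprS ler_wpM2l.
have {}it m : wform (iter m (kapp (M h)) (fun=> 1)) (iter m (kapp (M h)) (fun=> 1)) <=
    expR (m%:R * h * (s + e)) ^+ 2.
  apply: le_trans (it m) _.
  rewrite (_ : expR _ ^+ 2 = expR (2 * h * (s + e)) ^+ m); last first.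
    by rewrite -!expRM_natl; congr expR; ring.
  by rewrite lerXn2r ?nnegrE ?expR_ge0// expR_ge1Dx.
have -> : \sum_x mu x * iter n (kapp (M h)) (fun=> 1) x =
    wform (fun=> 1) (iter n (kapp (M h)) (fun=> 1)).
  by apply: eq_bigr => x _; rewrite mul1r.
apply: le_trans (ler_norm _) _.
rewrite -ler_sqr ?nnegrE ?expR_ge0// real_normK ?num_real//.
by apply: le_trans (wform_cauchy_schwarz _ _) _; rewrite one mul1r.
Qed.


Let N f := \sum_x `|f x|.

Let N_kapp K f (k : R) : (forall x y, `|K x y| <= k) -> N (kapp K f) <= #|S|%:R * k * N f.
Proof.
move=> Kk; apply: (@le_trans _ _ (\sum_(x : S) k * N f)); last first.
  by rewrite sumr_const -(mulr_natl (k * N f)) mulrA.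
apply: ler_sum => x _; apply: le_trans (ler_norm_sum _ _ _) _.
by rewrite mulr_sumr; apply: ler_sum => y _; rewrite normrM ler_wpM2r.
Qed.

Let N_ge0 f : 0 <= N f. Proof. exact: sumr_ge0. Qed.

Let ND f g : N (f \+ g) <= N f + N g.
Proof. by rewrite -big_split; apply: ler_sum => x _; exact: ler_normD. Qed.

Let NZ c f : N (fun x => c * f x) = `|c| * N f.
Proof. by rewrite mulr_sumr; apply: eq_bigr => x _; rewrite normrM. Qed.

Let eq_N f g : f =1 g -> N f = N g.
Proof. by move=> fg; apply: eq_bigr => x _; rewrite fg. Qed.

(* [T] is a symmetric square root of [M h] up to [O(h^2)]; being symmetric, it
   makes [n |-> wform (T^n f) (T^n f)] log-convex. *)
Let T h f x := f x + h / 2 * kapp B f x.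

Let T_sym h f g : wform f (T h g) = wform (T h f) g.
Proof.
rewrite /T -[X in wform f X]/(g \+ (fun x => h / 2 * kapp B g x)).
rewrite -[X in _ = wform X _]/(f \+ (fun x => h / 2 * kapp B f x)).
by rewrite wformDl wformDr wformZl wformZr (wform_kapp f g symB).
Qed.

(** With b(k) = |T^k f|^2, symmetry gives b(k+1)^2 <= b(k) b(k+2). The ratios b(k+1) / b(k)
    therefore do not decrease, and the first one is at least r^2. *)
Let wform_iter_T h f n (r : R) : 0 < r -> 0 < wform f f ->
  r * wform f f <= wform f (T h f) ->
  r ^+ n.*2 * wform f f <= wform (iter n (T h) f) (iter n (T h) f).
Proof.
move=> r0 f0 rT; pose b n := wform (iter n (T h) f) (iter n (T h) f).
have bE k : b k.+1 = wform (iter k (T h) f) (iter k.+2 (T h) f) by rewrite [RHS]T_sym.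
have b_step k : b k.+1 ^+ 2 <= b k * b k.+2 by rewrite bE wform_cauchy_schwarz.
have b1 : r ^+ 2 * b 0%N <= b 1%N.
  rewrite -[b 0%N]/(wform f f) -(ler_pM2l f0).
  rewrite (_ : wform f f * (r ^+ 2 * _) = (r * wform f f) ^+ 2); last by ring.
  apply: (@le_trans _ _ (wform f (T h f) ^+ 2)); last exact: wform_cauchy_schwarz.
  rewrite ler_sqr ?nnegrE//; first by rewrite mulr_ge0// ltW.
  by apply: le_trans rT; rewrite mulr_ge0// ltW.
have pos k : 0 < b k /\ r ^+ 2 * b k <= b k.+1.
  elim: k => [|k [bk0 IH]]; first by split.
  have bk1 : 0 < b k.+1 by apply: lt_le_trans IH; rewrite mulr_gt0// exprn_gt0.
  split=> //; rewrite -(ler_pM2l bk0); apply: le_trans (b_step k).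
  by rewrite mulrCA mulrA expr2 ler_wpM2r// ltW.
rewrite -/(b n); elim: n => [|n IH]; first by rewrite mul1r.
apply: le_trans (proj2 (pos n)); rewrite doubleS -add2n exprD -mulrA.
by rewrite ler_wpM2l ?sqr_ge0.
Qed.

Let wform_iter_T_iter h f g n m :
  wform f (iter (n + m) (T h) g) = wform (iter n (T h) f) (iter m (T h) g).
Proof.
by elim: n m => [//|n IH] m; rewrite addSnnS IH [LHS]T_sym.
Qed.

Let N_T h f : 0 <= h -> N (T h f) <= expR (h / 2 * (#|S|%:R * bB)) * N f.
Proof.
move=> h0; have h20 : 0 <= h / 2 by rewrite divr_ge0.
apply: le_trans (ND _ _) _; rewrite NZ ger0_norm//.
apply: (@le_trans _ _ ((1 + h / 2 * (#|S|%:R * bB)) * N f)).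
  by rewrite mulrDl mul1r lerD2l -mulrA ler_wpM2l// N_kapp.
by rewrite ler_wpM2r// expR_ge1Dx.
Qed.

(** The slack [e] pays for the second-order term: with z = y(q - e), e^z <= 1 / (1 - z), and it
    remains to have y q (q - e) <= e. *)
Lemma expR_le1D (q e : R) : 0 < e ->
  exists2 y0, 0 < y0 & forall y, 0 < y < y0 -> expR (y * (q - e)) <= 1 + y * q.
Proof.
move=> e0; pose a := `|q| + e + 1.
have q1 : q <= `|q| by exact: ler_norm.
have q2 : - q <= `|q| by rewrite -normrN; exact: ler_norm.
have a1 : 1 <= a by rewrite /a; have := normr_ge0 q; lra.
exists (Num.min e 1 / a ^+ 2); first by rewrite divr_gt0 ?lt_min ?e0 ?exprn_gt0//; lra.
move=> y /andP[y0]; rewrite ltr_pdivlMr; last by apply: exprn_gt0; lra.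
rewrite lt_min => /andP[ye y1].
have ya : y * a <= y * a ^+ 2 by rewrite ler_wpM2l ?(ltW y0)// ler_eXnr.
have z1 : y * (q - e) <= y * a by rewrite ler_wpM2l ?(ltW y0)// /a; lra.
have : expR (y * (q - e)) * (1 - y * (q - e)) <= 1.
  rewrite -[leRHS](expR0 R) -(subrr (y * (q - e))) expRD ler_wpM2l ?expR_ge0//.
  exact: expR_ge1Dx.
rewrite -ler_pdivlMr; last by lra.
move=> h; apply: le_trans h _; rewrite ler_pdivrMr; last by lra.
have qa : q * (q - e) <= a ^+ 2.
  apply: le_trans (ler_norm _) _; rewrite normrM expr2 ler_pM//; first by rewrite /a; lra.
  by apply: le_trans (ler_normB _ _) _; rewrite (gtr0_norm e0) /a; lra.
have : y * (y * (q * (q - e))) <= y * (y * a ^+ 2) by rewrite !ler_wpM2l// ltW.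
have : y * (y * a ^+ 2) <= y * e by rewrite ler_wpM2l// ltW.
lra.
Qed.

(** Positivity gives <f, M^n f> <= k^2 <1, M^n 1>. Then M^n f is compared with T^(2n) f, whose
    product with [f] is |T^n f|^2; for fixed [t] the discrepancy vanishes as [n] grows, and half of
    the main term survives. The prefactor is independent of [t], so it disappears from the
    exponential rate. *)
Lemma discretized_semigroup_ge (f : S -> R) (t q e k : R) : 0 < t -> 0 < e ->
  0 < wform f f -> (forall x, `|f x| <= k) -> q * wform f f <= wform f (kapp B f) ->
  \forall n \near \oo, wform f f / (2 * k ^+ 2) * expR (t * (q - e)) <=
    \sum_x mu x * iter n (kapp (M (t / n%:R))) (fun=> 1) x.
Proof.
move=> t0 e0 f0 fk hq.
have k0 : 0 < k.
  rewrite lt_neqAle; apply/andP; split; last first.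
    have [x _] : exists x : S, True.
      apply: contrapT => nx; move: f0; rewrite /wform big1 ?ltxx// => x.
      by case: nx; exists x.
    exact: le_trans (fk x).
  apply: contraTN f0 => /eqP k0; rewrite /wform big1 ?ltxx// => x _.
  by move: (fk x); rewrite -k0 normr_le0 => /eqP ->; rewrite !mulr0.
pose s := #|S|%:R : R; have s0 : 0 <= s by exact: ler0n.
pose c := s * (bB + 1).
have c0 : 0 <= c by rewrite mulr_ge0// addr_ge0.
(* Chosen so that the accumulated error [k * t * eta0 * expR (c * t) * (N f + 1)] is exactly half of
   the main term. *)
pose eta0 := wform f f * expR (t * (q - e)) / (2 * k * t * expR (c * t) * (N f + 1)).
have N1 : 0 < N f + 1 by rewrite ltr_wpDl.
have eta0_gt0 : 0 < eta0 by rewrite divr_gt0 ?mulr_gt0 ?expR_gt0.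
pose e1 := Num.min 1 (eta0 / (2 * (s + 1))).
have s1 : 0 < 2 * (s + 1) by rewrite mulr_gt0// ltr_wpDl.
have e1_gt0 : 0 < e1 by rewrite lt_min ltr01 divr_gt0.
have [h0 h0_gt0 hM] := M_approx e1_gt0.
have [y0 y0_gt0 hy] := expR_le1D q e0.
pose h2 := eta0 / ((s * bB) ^+ 2 + 1).
have sB1 : 0 < (s * bB) ^+ 2 + 1 by rewrite ltr_wpDl// sqr_ge0.
have h2_gt0 : 0 < h2 by rewrite divr_gt0.
pose q2 := (`|q| + 1)^-1.
have q2_gt0 : 0 < q2 by rewrite invr_gt0 ltr_wpDl.
have main h n : (0 < n)%N -> h * n%:R = t -> 0 < h -> h < h0 -> h < y0 -> h < h2 -> h < q2 ->
    wform f f / (2 * k ^+ 2) * expR (t * (q - e)) <=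
    \sum_x mu x * iter n (kapp (M h)) (fun=> 1) x.
  move=> n0 hnt h_gt0 hh0 hhy hh2 hhq.
  have h_ge0 := ltW h_gt0.
  pose E x y := M h x y - (x == y)%:R - h * B x y.
  have E_le x y : `|E x y| <= e1 * h by apply: hM; rewrite h_gt0.
  have Me g : kapp (M h) g =1 (g \+ (fun x => h * kapp B g x)) \+ kapp E g.
    move=> x /=; rewrite -{1}(kapp_id g x) /kapp mulr_sumr -!big_split.
    by apply: eq_bigr => y _ /=; rewrite /E; ring.
  have e1_1 : e1 <= 1 by rewrite ge_min lexx.
  have N_M g : N (kapp (M h) g) <= expR (h * c) * N g.
    rewrite (eq_N (Me g)); apply: le_trans (ND _ _) _.
    apply: le_trans (lerD (ND _ _) (lexx _)) _; rewrite NZ ger0_norm//.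
    have := N_kapp g E_le; rewrite -/s.
    have : h * N (kapp B g) <= h * (s * bB * N g) by rewrite ler_wpM2l// N_kapp.
    have : s * (e1 * h) * N g <= s * (1 * h) * N g.
      by rewrite ler_wpM2r// ler_wpM2l// ler_wpM2r.
    have : (1 + h * c) * N g <= expR (h * c) * N g by rewrite ler_wpM2r// expR_ge1Dx.
    by rewrite /c; lra.
  have N_TT g : N (T h (T h g)) <= expR (h * c) * N g.
    apply: le_trans (N_T _ h_ge0) _.
    apply: (@le_trans _ _ (expR (h / 2 * (s * bB)) * (expR (h / 2 * (s * bB)) * N g))).
      by rewrite ler_wpM2l ?expR_ge0// N_T.
    rewrite mulrA -expRD ler_wpM2r// ler_expR -mulrDl -splitr ler_wpM2l//.
    by rewrite /c ler_wpM2l// lerDl.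
  pose eta := s * e1 + h * (s * bB) ^+ 2 / 4.
  have eta_ge0 : 0 <= eta.
    by rewrite addr_ge0// ?mulr_ge0 ?sqr_ge0// ltW.
  have eta_le : eta <= eta0.
    have : s * e1 <= eta0 / 2.
      apply: (@le_trans _ _ ((s + 1) * e1)); first by rewrite ler_wpM2r ?(ltW e1_gt0)// lerDl.
      rewrite -ler_pdivlMl; last by rewrite ltr_wpDl.
      by rewrite ge_min; apply/orP; right; rewrite le_eqVlt; apply/orP; left; apply/eqP;
        field; rewrite gt_eqF// ltr_wpDl.
    have : h * (s * bB) ^+ 2 <= eta0.
      move: hh2; rewrite ltr_pdivlMr// => /ltW; apply: le_trans.
      by rewrite ler_wpM2l// lerDl.
    by have := mulr_ge0 h_ge0 (sqr_ge0 (s * bB)); rewrite /eta; lra.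
  have N_diff g : N (fun x => kapp (M h) g x - T h (T h g) x) <= h * eta * N g.
    have D : (fun x => kapp (M h) g x - T h (T h g) x) =1
        kapp E g \+ (fun x => - (h ^+ 2 / 4) * kapp B (kapp B g) x).
      move=> x; rewrite Me /= /T.
      have -> : kapp B (fun y => g y + h / 2 * kapp B g y) x =
          kapp B g x + h / 2 * kapp B (kapp B g) x.
        rewrite {1}/kapp [kapp B (kapp B g) x]/kapp [in RHS]mulr_sumr -big_split.
        by apply: eq_bigr => y _ /=; ring.
      by field.
    rewrite (eq_N D); apply: le_trans (ND _ _) _.
    rewrite NZ normrN ger0_norm; last by rewrite divr_ge0// sqr_ge0.
    have h3 := N_kapp g E_le.
    have h4 : h ^+ 2 / 4 * N (kapp B (kapp B g)) <= h ^+ 2 / 4 * (s * bB * (s * bB * N g)).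
      rewrite ler_wpM2l ?divr_ge0 ?sqr_ge0//; apply: le_trans (N_kapp _ B_le) _.
      by rewrite ler_wpM2l ?mulr_ge0// N_kapp.
    apply: le_trans (lerD h3 h4) _; rewrite -/s /eta.
    by rewrite le_eqVlt; apply/orP; left; apply/eqP; ring.
  have N_iterT m : N (iter m.*2 (T h) f) <= expR (h * c * m%:R) * N f.
    elim: m => [|m IH]; first by rewrite mulr0 expR0 mul1r.
    rewrite doubleS; apply: le_trans (N_TT _) _.
    rewrite -natr1 mulrDr mulr1 addrC expRD -mulrA.
    by rewrite ler_wpM2l ?expR_ge0.
  have N_delta m : N (fun x => iter m (kapp (M h)) f x - iter m.*2 (T h) f x) <=
      m%:R * h * eta * expR (h * c * m%:R) * N f.
    elim: m => [|m IH].
      rewrite !mul0r /N big1// => x _; by rewrite subrr normr0.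
    set d := (fun x => _ - _) in IH.
    have D : (fun x => iter m.+1 (kapp (M h)) f x - iter m.+1.*2 (T h) f x) =1
        kapp (M h) d \+ (fun x => kapp (M h) (iter m.*2 (T h) f) x -
          T h (T h (iter m.*2 (T h) f)) x).
      move=> x; rewrite doubleS /= addrA; congr (_ - _).
      by rewrite /kapp -big_split; apply: eq_bigr => y _ /=; rewrite /d; ring.
    rewrite (eq_N D); apply: le_trans (ND _ _) _.
    have h3 : N (kapp (M h) d) <= expR (h * c) * (m%:R * h * eta * expR (h * c * m%:R) * N f).
      by apply: le_trans (N_M _) _; rewrite ler_wpM2l ?expR_ge0.
    have h4 : h * eta * N (iter m.*2 (T h) f) <=
        h * eta * (expR (h * c) * (expR (h * c * m%:R) * N f)).
      rewrite ler_wpM2l ?mulr_ge0//; apply: le_trans (N_iterT m) _.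
      rewrite ler_peMl ?mulr_ge0 ?expR_ge0//.
      by apply: le_trans (expR_ge1Dx _); rewrite lerDl mulr_ge0.
    apply: le_trans (lerD h3 (le_trans (N_diff _) h4)) _.
    rewrite -[m.+1%:R]natr1 (mulrDr (h * c) m%:R) (mulr1 (h * c)) expRD.
    by rewrite le_eqVlt; apply/orP; left; apply/eqP; ring.
  have iter_pos m x : `|iter m (kapp (M h)) f x| <= k * iter m (kapp (M h)) (fun=> 1) x.
    elim: m x => [|m IH] x /=; first by rewrite mulr1.
    rewrite /kapp; apply: le_trans (ler_norm_sum _ _ _) _.
    rewrite mulr_sumr; apply: ler_sum => y _.
    by rewrite normrM ger0_norm ?M_ge0// mulrCA ler_wpM2l ?M_ge0.
  have up : wform f (iter n (kapp (M h)) f) <=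
      k ^+ 2 * \sum_x mu x * iter n (kapp (M h)) (fun=> 1) x.
    rewrite mulr_sumr; apply: ler_sum => x _.
    rewrite [leRHS]mulrCA ler_wpM2l ?(ltW (mu_gt0 x))//.
    apply: le_trans (ler_norm _) _; rewrite normrM expr2 -mulrA.
    by rewrite ler_pM.
  have split_form : wform f (iter n (kapp (M h)) f) =
      wform (iter n (T h) f) (iter n (T h) f) +
      wform f (fun x => iter n (kapp (M h)) f x - iter n.*2 (T h) f x).
    rewrite -wform_iter_T_iter addnn -wformDr; apply: eq_form => // x /=.
    by rewrite addrC subrK.
  have err : - wform f (fun x => iter n (kapp (M h)) f x - iter n.*2 (T h) f x) <=
      k * (t * eta0 * expR (c * t) * N f).
    set d := (fun x => _ - _).
    apply: (@le_trans _ _ (k * N d)); last first.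
      rewrite ler_wpM2l ?(ltW k0)//; apply: le_trans (N_delta n) _.
      rewrite (mulrC n%:R h) hnt (_ : h * c * n%:R = c * t); last by rewrite -hnt; ring.
      by rewrite ler_wpM2r// ler_wpM2r ?expR_ge0// ler_wpM2l// ltW.
    apply: le_trans (ler_norm _) _; rewrite normrN.
    apply: le_trans (ler_norm_sum _ _ _) _; rewrite mulr_sumr; apply: ler_sum => x _.
    rewrite normrM normrM gtr0_norm//.
    apply: (@le_trans _ _ (1 * (`|f x| * `|d x|))).
      rewrite ler_wpM2r ?mulr_ge0// -mu_sum1 (bigD1 x)//= lerDl.
      by apply: sumr_ge0 => y _; exact: ltW.
    by rewrite mul1r ler_wpM2r.
  have low : expR (t * (q - e)) * wform f f <= wform (iter n (T h) f) (iter n (T h) f).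
    have h20 : 0 < h / 2 by rewrite divr_gt0.
    have r0 : 0 < 1 + h / 2 * q.
      have : `|h / 2 * q| < 1.
        rewrite normrM gtr0_norm// mulrAC.
        apply: (@le_lt_trans _ _ (h * (`|q| + 1))).
          have := mulr_ge0 h_ge0 (normr_ge0 q); lra.
        rewrite -ltr_pdivlMr ?ltr_wpDl// mul1r; exact: hhq.
      by rewrite ltr_norml => /andP[]; lra.
    apply: le_trans (wform_iter_T _ r0 f0 _); last first.
      have -> : wform f (T h f) = wform f f + h / 2 * wform f (kapp B f) by rewrite -wformZr -wformDr.
      by rewrite mulrDl mul1r -mulrA lerD2l ler_wpM2l// ltW.
    rewrite ler_wpM2r ?(ltW f0)//.
    rewrite (_ : t * (q - e) = n.*2%:R * (h / 2 * (q - e))); last first.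
      by rewrite -hnt -muln2 natrM; field.
    rewrite expRM_natl lerXn2r ?nnegrE ?expR_ge0 ?(ltW r0)//.
    by apply: hy; rewrite h20/=; lra.
  have fin : k * (t * eta0 * expR (c * t) * N f) <= wform f f * expR (t * (q - e)) / 2.
    apply: (@le_trans _ _ (k * (t * eta0 * expR (c * t) * (N f + 1)))).
      rewrite ler_wpM2l ?(ltW k0)// ler_wpM2l ?lerDl//.
      by rewrite mulr_ge0 ?expR_ge0// mulr_ge0 ?(ltW t0) ?(ltW eta0_gt0).
    rewrite le_eqVlt; apply/orP; left; apply/eqP; rewrite /eta0; field.
    by rewrite !gt_eqF// expR_gt0.
  rewrite -(ler_pM2l (_ : 0 < k ^+ 2)); last by rewrite exprn_gt0.
  apply: le_trans up; rewrite split_form.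
  have -> : k ^+ 2 * (wform f f / (2 * k ^+ 2) * expR (t * (q - e))) =
      wform f f * expR (t * (q - e)) / 2 by field; rewrite gt_eqF.
  lra.
near=> n.
have n0 : (0 < n)%N by near: n; exact: nbhs_infty_gt.
have n0R : 0 < n%:R :> R by rewrite ltr0n.
apply: main => //; first by rewrite divfK// gt_eqF.
- by rewrite divr_gt0.
- rewrite ltr_pdivrMr// -ltr_pdivrMl//; near: n; exact: nbhs_infty_gtr.
- rewrite ltr_pdivrMr// -ltr_pdivrMl//; near: n; exact: nbhs_infty_gtr.
- rewrite ltr_pdivrMr// -ltr_pdivrMl//; near: n; exact: nbhs_infty_gtr.
- rewrite ltr_pdivrMr// -ltr_pdivrMl//; near: n; exact: nbhs_infty_gtr.
Unshelve. all: by end_near.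
Qed.

End discretized_semigroup.
End weighted_form.

(** * The scaled cumulant generating function as a Rayleigh supremum *)

Section scgf_rayleigh.
Context {R : realType} {S : finType} {d : measure_display} {T : measurableType d}.
Variables (P : probability T R) (X : R -> T -> S).
Variables (mu : S -> R) (L : (S -> R) -> (S -> R)) (lambda : R).
Hypothesis mu_gt0 : forall x, 0 < mu x.
Hypothesis mu_sum1 : \sum_x mu x = 1.

(** The derivative at time 0 of the tilted kernels: the matrix of [L] with its off-diagonal entries
    multiplied by [expR lambda]. *)
Definition tilted_generator (x y : S) : R :=
  tilt lambda x y * L (fun z => (z == y)%:R) x.

Hypothesis symL : forall x y,
  mu x * tilted_generator x y = mu y * tilted_generator y x.
Hypothesis mp : markov_process P X mu L.

Let tilted_kernel (p : R -> S -> S -> R) h x y := p h x y * tilt lambda x y.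

Let tilted_kernel_approx p : has_generator p L ->
  forall e, 0 < e -> exists2 h0, 0 < h0 & forall h x y, 0 < h < h0 ->
  `|tilted_kernel p h x y - (x == y)%:R - h * tilted_generator x y| <= e * h.
Proof.
move=> gen e e0.
pose c := 1 + expR lambda.
have c0 : 0 < c by rewrite addr_gt0// expR_gt0.
have tc x y : tilt lambda x y <= c.
  by rewrite /tilt /c; case: ifP => _; rewrite ?lerDl ?lerDr// expR_ge0.
have ev : \forall h \near 0^'+, forall q : S * S,
    `|L (fun z => (z == q.2)%:R) q.1 -
      h^-1 * (\sum_z p h q.1 z * (z == q.2)%:R - (q.1 == q.2)%:R)| <= e / c.
  apply: filter_forall => -[x y] /=.
  have /cvgrPdist_le := gen (fun z => (z == y)%:R) x; apply.
  by rewrite divr_gt0.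
have [h0 /= h0_gt0 hh0] := ev.
exists h0 => // h x y /andP[h_gt0 hh].
have : ball_ [eta Num.norm] 0 h0 h by rewrite /ball_ /= sub0r normrN gtr0_norm.
move=> /hh0/(_ h_gt0)/(_ (x, y)) /=.
rewrite (bigD1 y)//= eqxx mulr1 big1 ?addr0; last by move=> z /negbTE ->; rewrite mulr0.
move=> hb.
rewrite (_ : _ - _ - _ = - (h * tilt lambda x y) *
  (L (fun z => (z == y)%:R) x - h^-1 * (p h x y - (x == y)%:R))); last first.
  rewrite /tilted_kernel /tilted_generator /tilt; case: eqP => _ /=; field; by rewrite gt_eqF.
rewrite normrM normrN normrM (gtr0_norm h_gt0) (gtr0_norm (tilt_gt0 _ _ _)).
apply: (@le_trans _ _ (h * c * (e / c))); last first.
  by rewrite le_eqVlt; apply/orP; left; apply/eqP; field; rewrite gt_eqF.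
by rewrite ler_pM// ?mulr_ge0 ?(ltW h_gt0) ?(ltW (tilt_gt0 _ _ _))// ler_wpM2l// ltW.
Qed.

(** For every [e] the expectation lies between c e^(t(s - e)) and e^(t(s + e)) with [c] independent
    of [t]. This makes the logarithm finite and the limit exist, so that [lim] is not a default
    value. *)
Lemma activity_scgf_rayleigh (s : R) :
  (forall f, wform mu f (kapp tilted_generator f) <= s * wform mu f f) ->
  (forall e, 0 < e -> exists f, 0 < wform mu f f /\
    (s - e) * wform mu f f <= wform mu f (kapp tilted_generator f)) ->
  activity_scgf P X lambda = s%:E.
Proof.
move=> s_ub s_adh.
have [_ _ _ _ [p [tp gen mk]]] := mp.
have Mge0 h x y : 0 <= h -> 0 <= tilted_kernel p h x y.
  by move=> h0; have [p0 _ _ _] := tp; rewrite mulr_ge0 ?p0 ?(ltW (tilt_gt0 _ _ _)).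
have Mapp := tilted_kernel_approx gen.
pose E t := ('E_P[fun w => expR (lambda * (activity X t w)%:R)])%E.
have E_le t e : 0 < t -> 0 < e -> (E t <= (expR (t * (s + e)))%:E)%E.
  move=> t0 e0; have [h0 h0_gt0 hM] := discretized_semigroup_le mu_gt0 mu_sum1 Mapp e0 s_ub.
  apply: (expectation_activity_le mp t0); near=> n.
  have n0 : (0 < n)%N by near: n; exact: nbhs_infty_gt.
  have n0R : 0 < n%:R :> R by rewrite ltr0n.
  rewrite (expectation_tilted_path mp _ _ mk tp) ?divr_ge0 ?(ltW t0)// lee_fin.
  rewrite (_ : t * _ = n%:R * (t / n%:R) * (s + e)); last by field; rewrite gt_eqF.
  apply: hM; rewrite divr_gt0//=.
  rewrite ltr_pdivrMr// -ltr_pdivrMl//; near: n; exact: nbhs_infty_gtr.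
have E_ge e : 0 < e -> exists2 c, 0 < c & forall t, 0 < t -> ((c * expR (t * (s - e)))%:E <= E t)%E.
  move=> e0; have e20 : 0 < e / 2 by rewrite divr_gt0.
  have [f [f0 hf]] := s_adh _ e20.
  pose k := 1 + \sum_x `|f x|.
  have fk x : `|f x| <= k.
    by rewrite /k (bigD1 x)//= addrCA lerDl addr_ge0// sumr_ge0.
  have k0 : 0 < k by rewrite ltr_pwDl// sumr_ge0.
  exists (wform mu f f / (2 * k ^+ 2)); first by rewrite divr_gt0// mulr_gt0// exprn_gt0.
  move=> t t0; apply: (expectation_activity_ge mp t0).
  have := discretized_semigroup_ge mu_gt0 mu_sum1 symL Mge0 Mapp t0 e20 f0 fk hf.
  apply: filterS => n; rewrite -addrA -opprD -splitr => hn.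
  by rewrite (expectation_tilted_path mp _ _ mk tp) ?divr_ge0 ?(ltW t0)// lee_fin.
have E_fin t : 0 < t -> exists2 x, 0 < x & E t = x%:E.
  move=> t0; have [c c0 hc] := E_ge 1 ltr01.
  have := hc t t0; have := E_le t 1 t0 ltr01.
  case: (E t) => [x _| |]//.
  by rewrite lee_fin => cx; exists x => //; apply: lt_le_trans cx; rewrite mulr_gt0// expR_gt0.
rewrite /activity_scgf; apply: cvg_lim => //.
apply/fine_cvgP; split.
  near=> t; have t0 : 0 < t by near: t; exact: nbhs_pinfty_gt.
  have [x x0] := E_fin t t0; rewrite /E => ->.
  by rewrite lne_EFin.
apply/cvgrPdist_le => e e0.
have e20 : 0 < e / 2 by rewrite divr_gt0.
have [c c0 hc] := E_ge _ e20.
near=> t; have t0 : 0 < t by near: t; exact: nbhs_pinfty_gt.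
have [x x0 Et] := E_fin t t0.
have := hc t t0; have := E_le t e t0 e0.
rewrite /= Et; rewrite /E in Et; rewrite Et lne_EFin//= !lee_fin => xu xl.
rewrite ler_distlC.
have lnx_u : ln x <= t * (s + e) by rewrite -(expRK (t * _)) ler_ln ?posrE ?expR_gt0.
have lnx_l : ln c + t * (s - e / 2) <= ln x.
  rewrite -(expRK (t * _)) -lnM ?posrE ?expR_gt0// ler_ln ?posrE//.
  by rewrite mulr_gt0// expR_gt0.
rewrite (mulrC t^-1) ler_pdivlMr// ler_pdivrMr//.
have : - ln c <= t * (e / 2).
  rewrite -ler_pdivrMr//; near: t; exact: nbhs_pinfty_ge.
by move=> h; apply/andP; split; lra.
Unshelve. all: by end_near.
Qed.
End scgf_rayleigh.

(** * Partial averages under the Bernoulli measure *)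

Section bernoulli_mean.
Context {R : realType}.
Variable rho : R.
Hypothesis hrho : 0 < rho < 1.
Variable N : nat.
Implicit Types (f g : config N -> R) (eta xi zeta : config N) (S T : pred 'I_N).

Let w := @bernoulli_weight R rho N.

Let rho_gt0 : 0 < rho. Proof. by case/andP: hrho. Qed.
Let rho_lt1 : 0 < 1 - rho. Proof. by rewrite subr_gt0; case/andP: hrho. Qed.

Lemma bernoulli_weight_gt0 eta : 0 < w eta.
Proof. by apply: prodr_gt0 => i _; case: ifP. Qed.

Lemma bernoulli_weight_sum1 : \sum_eta w eta = 1.
Proof.
have := bernoulli_weight_prod rho (fun (_ : 'I_N) (_ : bool) => 1).
under eq_bigr do rewrite big1_eq mulr1; move=> ->.
by rewrite big1// => i _; ring.
Qed.

Definition mean f : R := \sum_eta w eta * f eta.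

Definition resample S xi eta : config N := [ffun j => if S j then xi j else eta j].

(** The conditional expectation of [f] given the configuration outside [S]. *)
Definition avg S f eta : R := mean (fun xi => f (resample S xi eta)).

Definition indep S f := forall xi eta, f (resample S xi eta) = f eta.

Lemma mean_ge0 f : (forall eta, 0 <= f eta) -> 0 <= mean f.
Proof. by move=> f0; apply: sumr_ge0 => eta _; rewrite mulr_ge0// ltW// bernoulli_weight_gt0. Qed.

Lemma ler_mean f g : (forall eta, f eta <= g eta) -> mean f <= mean g.
Proof.
by move=> fg; apply: ler_sum => eta _; rewrite ler_wpM2l// ltW// bernoulli_weight_gt0.
Qed.

Lemma eq_mean f g : f =1 g -> mean f = mean g.
Proof. by move=> fg; apply: eq_bigr => eta _; rewrite fg. Qed.

Lemma mean_cst c : mean (fun=> c) = c.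
Proof. by rewrite /mean -mulr_suml bernoulli_weight_sum1 mul1r. Qed.

Lemma meanZ c f : mean (fun eta => c * f eta) = c * mean f.
Proof. by rewrite mulr_sumr; apply: eq_bigr => eta _; ring. Qed.

Lemma meanD f g : mean (fun eta => f eta + g eta) = mean f + mean g.
Proof. by rewrite -big_split; apply: eq_bigr => eta _; rewrite mulrDr. Qed.

Lemma meanB f g : mean (fun eta => f eta - g eta) = mean f - mean g.
Proof. by rewrite -sumrB; apply: eq_bigr => eta _; rewrite mulrBr. Qed.

Lemma mean_sum (I : Type) (r : seq I) (Q : pred I) (F : I -> config N -> R) :
  mean (fun eta => \sum_(i <- r | Q i) F i eta) = \sum_(i <- r | Q i) mean (F i).
Proof.
rewrite /mean exchange_big; apply: eq_bigr => eta _; exact: mulr_sumr.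
Qed.

Lemma ler_norm_mean f : `|mean f| <= mean (fun eta => `|f eta|).
Proof.
apply: le_trans (ler_norm_sum _ _ _) _; apply: ler_sum => eta _.
by rewrite normrM gtr0_norm// bernoulli_weight_gt0.
Qed.

Lemma mean_coord (i : 'I_N) (phi : bool -> R) :
  mean (fun xi => phi (xi i)) = rho * phi true + (1 - rho) * phi false.
Proof.
have := bernoulli_weight_prod rho (fun (j : 'I_N) b => if j == i then phi b else 1).
rewrite [RHS](bigD1 i)//= eqxx [X in _ * X]big1 ?mulr1 => [<-|j /negbTE->]; last by ring.
apply: eq_bigr => eta _; congr (_ * _); rewrite (bigD1 i)//= eqxx big1 ?mulr1//.
by move=> j /negbTE->.
Qed.

Lemma mean_filled S : mean (fun xi => [forall j, S j ==> xi j]%:R) = rho ^+ #|S|.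
Proof.
have := bernoulli_weight_prod rho (fun (j : 'I_N) (b : bool) => (S j ==> b)%:R).
have -> : \prod_(i < N) (rho * (S i ==> true)%:R + (1 - rho) * (S i ==> false)%:R) = rho ^+ #|S|.
  rewrite -prodr_const [RHS]big_mkcond; apply: eq_bigr => i _.
  by rewrite unfold_in; case: (S i) => /=; ring.
move=> <-; apply: eq_bigr => eta _; congr (_ * _).
have [/forallP h|] := boolP [forall j, S j ==> eta j].
  by rewrite big1// => j _; rewrite h.
by rewrite negb_forall => /existsP[j /negbTE h]; rewrite (bigD1 j)//= h mul0r.
Qed.

(** Exchanging the coordinates in [T] of two independent configurations is an involution that
    preserves the product weight. *)
Lemma mean_avg T f : mean (avg T f) = mean f.
Proof.
rewrite /mean /avg /mean.
transitivity (\sum_(q : config N * config N) w q.1 * w q.2 * f (resample T q.2 q.1)).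
  rewrite -(pair_bigA_idem _ (fun x y => w x * w y * f (resample T y x)))/= ?addr0//.
  by apply: eq_bigr => x _; rewrite mulr_sumr; apply: eq_bigr => y _; rewrite mulrA.
pose s (q : config N * config N) := (resample T q.2 q.1, resample T q.1 q.2).
have sK : involutive s.
  by move=> [x y]; rewrite /s /=; congr pair; apply/ffunP => j; rewrite !ffunE; case: (T j).
rewrite (reindex_inj (inv_inj sK)) /=.
transitivity (\sum_(q : config N * config N) w q.1 * w q.2 * f q.1).
  apply: eq_bigr => -[x y] _ /=; congr (_ * _).
    rewrite /w /bernoulli_weight -!big_split; apply: eq_bigr => j _; rewrite !ffunE.
    by case: (T j) => //=; rewrite mulrC.
  by congr f; apply/ffunP => j; rewrite !ffunE; case: (T j).
rewrite -(pair_bigA_idem _ (fun x y => w x * w y * f x))/= ?addr0//.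
apply: eq_bigr => x _; rewrite -mulr_suml -mulr_sumr.
by rewrite bernoulli_weight_sum1 mulr1.
Qed.

Lemma avgU S T f eta : avg S (avg T f) eta = avg (predU S T) f eta.
Proof.
rewrite -[RHS](mean_avg T); apply: eq_mean => xi; apply: eq_mean => zeta.
by congr f; apply/ffunP => j; rewrite !ffunE /=; case: (T j) => /=; rewrite ?orbT ?orbF.
Qed.

Lemma eq_avgl S T f eta : S =1 T -> avg S f eta = avg T f eta.
Proof. by move=> ST; apply: eq_mean => xi; congr f; apply/ffunP => j; rewrite !ffunE ST. Qed.

Lemma avg_avg_sub S T f eta : subpred T S -> avg S (avg T f) eta = avg S f eta.
Proof.
move=> TS; rewrite avgU; apply: eq_avgl => j /=.
by have := TS j; case: (T j) => [->//|]; rewrite orbF.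
Qed.

Lemma indep_avg S f : indep S (avg S f).
Proof.
move=> xi eta; apply: eq_mean => zeta; congr f.
by apply/ffunP => j; rewrite !ffunE; case: (S j).
Qed.

Lemma avg_indepM S g f eta : indep S g ->
  avg S (fun zeta => g zeta * f zeta) eta = g eta * avg S f eta.
Proof. by move=> ig; rewrite -meanZ; apply: eq_mean => xi; rewrite ig. Qed.

Lemma mean_indepM S g f : indep S g ->
  mean (fun eta => g eta * avg S f eta) = mean (fun eta => g eta * f eta).
Proof.
by move=> ig; rewrite -[RHS](mean_avg S); apply: eq_mean => eta; rewrite avg_indepM.
Qed.

Definition upd eta (i : 'I_N) b : config N := [ffun j => if j == i then b else eta j].

Lemma avg1 i f eta :
  avg (pred1 i) f eta = rho * f (upd eta i true) + (1 - rho) * f (upd eta i false).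
Proof.
rewrite -(mean_coord i (fun b => f (upd eta i b))); apply: eq_mean => xi.
by congr f; apply/ffunP => j; rewrite !ffunE /=; case: eqP => // ->.
Qed.

Definition local_var S f eta : R := avg S (fun zeta => (f zeta - avg S f eta) ^+ 2) eta.

Lemma local_var_ge0 S f eta : 0 <= local_var S f eta.
Proof. by apply: mean_ge0 => xi; exact: sqr_ge0. Qed.

Lemma local_varE S f eta : local_var S f eta = avg S (fun zeta => f zeta ^+ 2) eta - avg S f eta ^+ 2.
Proof.
rewrite /local_var {1}/avg; set m := avg S f eta.
transitivity (mean (fun xi => f (resample S xi eta) ^+ 2 +
   (- (2 * m) * f (resample S xi eta) + m ^+ 2))).
  by apply: eq_mean => xi; ring.
rewrite !meanD mean_cst meanZ -/(avg S f eta) -/m -/(avg S (fun zeta => f zeta ^+ 2) eta).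
by ring.
Qed.

Lemma local_var_le S f eta m : local_var S f eta <= avg S (fun zeta => (f zeta - m) ^+ 2) eta.
Proof.
rewrite local_varE.
have -> : avg S (fun zeta => (f zeta - m) ^+ 2) eta =
    avg S (fun zeta => f zeta ^+ 2) eta + (- (2 * m) * avg S f eta + m ^+ 2).
  rewrite -meanZ -(mean_cst (m ^+ 2)) -!meanD.
  by apply: eq_mean => xi; ring.
by have := sqr_ge0 (avg S f eta - m); rewrite sqrrB; lra.
Qed.

Lemma avg_sqr_le S f eta : avg S f eta ^+ 2 <= avg S (fun zeta => f zeta ^+ 2) eta.
Proof. by have := local_var_ge0 S f eta; rewrite local_varE subr_ge0. Qed.

(** Law of total variance: conditioning on more sites can only lower the mean conditional
    variance. *)
Lemma avg_local_var_le S f eta T : subpred T S -> avg S (local_var T f) eta <= local_var S f eta.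
Proof.
move=> TS; rewrite local_varE.
have -> : avg S (local_var T f) eta =
    avg S (fun zeta => f zeta ^+ 2) eta - avg S (fun zeta => avg T f zeta ^+ 2) eta.
  rewrite -(avg_avg_sub (fun zeta => f zeta ^+ 2) eta TS) -meanB.
  by apply: eq_mean => xi; rewrite local_varE.
by rewrite lerD2l lerN2 -(avg_avg_sub f eta TS) avg_sqr_le.
Qed.

End bernoulli_mean.

(** * Poincare inequality on an interval *)

Section intervals.
Variable N : nat.
Implicit Types (eta xi : config N) (a b c x : nat).

(* Sites outside ['I_N] count as empty: this encodes the empty boundary on the right. *)
Definition filled eta x : bool := oapp eta false (insub x).

Lemma filled_ord eta (i : 'I_N) : filled eta i = eta i.
Proof. by rewrite /filled valK. Qed.

Lemma filled_ge eta x : (N <= x)%N -> filled eta x = false.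
Proof. by move=> Nx; rewrite /filled insubF// ltnNge Nx. Qed.

Definition intv a b : pred 'I_N := fun j => (a <= j < b)%N.

Lemma intv_ge a b (j : 'I_N) : (b <= j)%N -> ~~ intv a b j.
Proof. by rewrite /intv; lia. Qed.

Lemma intv_last a b (j : 'I_N) : (a <= b)%N -> j = b :> nat -> intv a b.+1 j.
Proof. by rewrite /intv; lia. Qed.

Lemma intv_neq_last a b (j : 'I_N) : intv a b.+1 j && (j != b :> nat) = intv a b j.
Proof. by rewrite /intv; lia. Qed.

Definition allfilled eta a b : bool := all (filled eta) (index_iota a b).

Lemma allfilledP eta a b :
  reflect (forall x, (a <= x < b)%N -> filled eta x) (allfilled eta a b).
Proof.
apply: (iffP allP) => h x; first by move=> xab; apply: h; rewrite mem_index_iota.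
by rewrite mem_index_iota; exact: h.
Qed.

Lemma allfilled_cat eta a b c : (a <= b <= c)%N ->
  allfilled eta a c = allfilled eta a b && allfilled eta b c.
Proof.
move=> abc; apply/allfilledP/andP => [h|[/allfilledP h1 /allfilledP h2] x xac].
  by split; apply/allfilledP => x ?; apply: h; lia.
by have [xb|bx] := ltnP x b; [apply: h1|apply: h2]; lia.
Qed.

Lemma allfilled_gt eta a b : (a < b)%N -> (N < b)%N -> allfilled eta a b = false.
Proof.
move=> ab Nb; apply/negP => /allfilledP/(_ b.-1); rewrite filled_ge; last by lia.
by move=> /(_ ltac:(lia)).
Qed.

Lemma filled_resample (S : pred 'I_N) eta xi x :
  (forall j : 'I_N, j = x :> nat -> ~~ S j) -> filled (resample S xi eta) x = filled eta x.
Proof.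
move=> nS; have [xN|Nx] := ltnP x N; last by rewrite !filled_ge.
have -> : x = Ordinal xN by [].
by rewrite !filled_ord ffunE (negbTE (nS _ _)).
Qed.

Lemma allfilled_resample (S : pred 'I_N) eta xi a b :
  (forall j : 'I_N, (a <= j < b)%N -> ~~ S j) -> allfilled (resample S xi eta) a b = allfilled eta a b.
Proof.
move=> nS; apply: eq_in_all => x; rewrite mem_index_iota => xab.
by apply: filled_resample => j jx; apply: nS; rewrite jx.
Qed.

Definition last_empty eta x c : bool := ~~ filled eta x && allfilled eta x.+1 c.

Lemma allfilled_recl eta b c : (b < c)%N ->
  allfilled eta b c = filled eta b && allfilled eta b.+1 c.
Proof.
move=> bc; rewrite (@allfilled_cat _ b b.+1 c) ?leqnSn//; congr (_ && _).
by apply/allfilledP/idP => [|fb x xb]; [apply; rewrite leqnn ltnSn|have -> : x = b by lia].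
Qed.

Lemma sum_last_empty eta b c : (b <= c)%N ->
  (\sum_(b <= x < c) last_empty eta x c = ~~ allfilled eta b c)%N.
Proof.
move=> bc; rewrite -(subKn bc); have : (c - b <= c)%N by lia.
elim: (c - b)%N => [|n IH] nc.
  by rewrite subn0 big_geq// (_ : allfilled _ _ _)//; apply/allfilledP => x; lia.
rewrite big_ltn; last by lia.
rewrite (_ : (c - n.+1).+1 = c - n)%N; last by lia.
rewrite IH; last by lia.
rewrite /last_empty [in RHS]allfilled_recl; last by lia.
rewrite (_ : (c - n.+1).+1 = c - n)%N; last by lia.
by case: filled; case: allfilled.
Qed.

(** Read from the right, the last empty site is a stopping site: it reveals nothing about the sites
    to its left, which stay Bernoulli and now have an empty right boundary. *)
Lemma indep_last_empty (R : realType) a x c :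
  indep (intv a x) (fun eta => (last_empty eta x c)%:R : R).
Proof.
move=> xi eta; congr ((nat_of_bool _)%:R).
by rewrite /last_empty filled_resample ?allfilled_resample// => j; rewrite /intv; lia.
Qed.

End intervals.

Section poincare.
Context {R : realType}.
Variable rho : R.
Hypothesis hrho : 0 < rho < 1.
Variable N : nat.
Implicit Types (f : config N -> R) (eta xi zeta : config N) (a b c : nat).

Let rho_gt0 : 0 < rho. Proof. by case/andP: hrho. Qed.
Let rho_lt1 : 0 < 1 - rho. Proof. by rewrite subr_gt0; case/andP: hrho. Qed.

Definition local_dirichlet (i : 'I_N) f eta : R :=
  rho * (1 - rho) * (f (flip eta i) - f eta) ^+ 2.

Definition east_constraint eta (i : 'I_N) : R := 1 - (filled eta i.+1)%:R.

Definition east_dirichlet_on a b f eta : R :=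
  \sum_(j | intv a b j) east_constraint eta j * local_dirichlet j f eta.

Lemma local_dirichlet_ge0 i f eta : 0 <= local_dirichlet i f eta.
Proof. by rewrite mulr_ge0 ?sqr_ge0// mulr_ge0// ltW. Qed.

Lemma east_constraint_ge0 eta i : 0 <= east_constraint eta i.
Proof. by rewrite /east_constraint; case: filled; rewrite ?subrr ?subr0. Qed.

Lemma east_term_ge0 i f eta : 0 <= east_constraint eta i * local_dirichlet i f eta.
Proof. by rewrite mulr_ge0 ?east_constraint_ge0 ?local_dirichlet_ge0. Qed.

Lemma east_dirichlet_on_ge0 a b f eta : 0 <= east_dirichlet_on a b f eta.
Proof. by apply: sumr_ge0 => i _; exact: east_term_ge0. Qed.

Lemma flipK (i : 'I_N) : involutive (fun eta => flip eta i).
Proof. by move=> eta; apply/ffunP => j; rewrite !ffunE; case: eqP => //; rewrite negbK. Qed.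

Lemma flip_upd eta i (b : bool) : flip (upd eta i b) i = upd eta i (~~ b).
Proof. by apply/ffunP => j; rewrite !ffunE; case: eqP. Qed.

Definition east_gap_const : R := 2 / (1 - rho).

Lemma east_gap_const_ge1 : 1 <= east_gap_const.
Proof. by rewrite ler_pdivlMr// mul1r; move: rho_gt0; lra. Qed.

(** Induction on the length, adding the rightmost site, which flips freely because [b] is empty.
    When it is empty, the rest of the interval has an empty boundary and the induction hypothesis
    applies; when it is occupied, it is flipped first, at the price of its own Dirichlet term. A
    site costs a factor 2 / (1 - rho): 2 for squaring a sum, 1 - rho for the probability that the
    new site is empty. *)
Lemma local_var_interval_le a b f eta : (a <= b)%N -> ~~ filled eta b ->
  local_var rho (intv a b) f eta <=
  east_gap_const ^+ (b - a) * avg rho (intv a b) (east_dirichlet_on a b f) eta.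
Proof.
move=> ab; rewrite -(subnKC ab) addKn; have C1 := east_gap_const_ge1.
set C := east_gap_const in C1 *; have C0 : 0 <= C by lra.
elim: (b - a)%N eta => {b ab} [|n IH] eta nb.
  rewrite addn0 expr0 mul1r.
  have S0 : intv a a =1 (pred0 : pred 'I_N) by move=> j; rewrite /intv /=; lia.
  rewrite /local_var (eq_avgl _ _ _ S0); apply: (@le_trans _ _ 0); last first.
    by apply: mean_ge0 => // xi; exact: east_dirichlet_on_ge0.
  rewrite (eq_avgl _ _ _ S0).
  have av0 g : avg rho pred0 g eta = g eta.
    rewrite -[RHS](mean_cst rho N (g eta)); apply: eq_mean => xi; congr g.
    by apply/ffunP => j; rewrite ffunE.
  by rewrite !av0 subrr expr0n.
rewrite addnS; move: nb; rewrite addnS => nb.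
(* Beyond the last site the interval gains no element, and its new right end is empty by
   convention. *)
have [Ns|sN] := leqP N (a + n)%N.
  have S0 : intv a (a + n).+1 =1 (intv a (a + n) : pred 'I_N).
    by move=> j; rewrite /intv /=; have := ltn_ord j; lia.
  have VE : local_var rho (intv a (a + n).+1) f eta = local_var rho (intv a (a + n)) f eta.
    by rewrite /local_var !(eq_avgl _ _ _ S0).
  rewrite VE (eq_avgl _ _ _ S0).
  have -> : avg rho (intv a (a + n)) (east_dirichlet_on a (a + n).+1 f) eta =
      avg rho (intv a (a + n)) (east_dirichlet_on a (a + n) f) eta.
    by apply: eq_mean => xi; apply: eq_bigl => j; rewrite S0.
  apply: le_trans (IH _ _) _; first by rewrite filled_ge.
  rewrite ler_wpM2r ?exprS ?ler_peMl// ?exprn_ge0//.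
  by apply: mean_ge0 => // xi; exact: east_dirichlet_on_ge0.
pose si : 'I_N := Ordinal sN.
pose A : pred 'I_N := intv a (a + n).
pose S : pred 'I_N := intv a (a + n).+1.
have sA : A si = false by rewrite /A /intv /=; lia.
have SE : S =1 predU (pred1 si) A.
  by move=> j; rewrite /S /A /intv /= -val_eqE /=; lia.
pose e0 := upd eta si false; pose e1 := upd eta si true.
have avgS g : avg rho S g eta = rho * avg rho A g e1 + (1 - rho) * avg rho A g e0.
  by rewrite (eq_avgl _ _ _ SE) -avgU avg1.
have flipA xi : flip (resample A xi e1) si = resample A xi e0.
  apply/ffunP => j; rewrite !ffunE; case: (j =P si) => [->|//].
  by rewrite sA.
have avg_flip g : avg rho A (fun zeta => g (flip zeta si)) e1 = avg rho A g e0.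
  by apply: eq_mean => xi; rewrite flipA.
pose m0 := avg rho A f e0.
pose X := avg rho A (fun zeta => (f (flip zeta si) - f zeta) ^+ 2) e1.
pose v0 := local_var rho A f e0.
have v0_ge0 : 0 <= v0 by exact: local_var_ge0.
have h1 : local_var rho S f eta <= rho * avg rho A (fun zeta => (f zeta - m0) ^+ 2) e1 + (1 - rho) * v0.
  by apply: le_trans (local_var_le _ _ _ _ m0) _ => //; rewrite avgS.
have h2 : avg rho A (fun zeta => (f zeta - m0) ^+ 2) e1 <= 2 * X + 2 * v0.
  rewrite /v0 /local_var -/m0 -[X in _ + 2 * X]avg_flip -!meanZ -meanD; apply: ler_mean => // xi.
  set u := f (resample _ _ _); set v := f (flip _ _).
  rewrite -subr_ge0 (_ : _ - _ = ((v - u) + (v - m0)) ^+ 2); last by ring.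
  exact: sqr_ge0.
have h3 : avg rho S (local_dirichlet si f) eta = rho * (1 - rho) * X.
  have ldE e : avg rho A (local_dirichlet si f) e =
      rho * (1 - rho) * avg rho A (fun zeta => (f (flip zeta si) - f zeta) ^+ 2) e.
    by rewrite -meanZ.
  have XE : avg rho A (fun zeta => (f (flip zeta si) - f zeta) ^+ 2) e0 = X.
    by rewrite -avg_flip; apply: eq_mean => xi; rewrite flipK -sqrrN opprB.
  by rewrite avgS !ldE XE -/X; ring.
pose g := avg rho A (east_dirichlet_on a (a + n) f) e0.
have g0 : 0 <= g by apply: mean_ge0 => // xi; exact: east_dirichlet_on_ge0.
have h4 : v0 <= C ^+ n * g.
  apply: IH; rewrite (_ : (a + n)%N = si)// filled_ord ffunE eqxx//.
pose aG := avg rho S (east_dirichlet_on a (a + n) f) eta.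
have h5 : (1 - rho) * g <= aG.
  rewrite /aG avgS lerDr mulr_ge0 ?(ltW rho_gt0)//.
  by apply: mean_ge0 => // xi; exact: east_dirichlet_on_ge0.
have h6 : avg rho S (east_dirichlet_on a (a + n).+1 f) eta = aG + rho * (1 - rho) * X.
  rewrite -h3 -meanD; apply: eq_mean => xi.
  rewrite /east_dirichlet_on (bigD1 si)/=; last exact: intv_last (leq_addr _ _) _.
  rewrite addrC; congr (_ + _).
    by apply: eq_bigl => j; exact: (intv_neq_last a (a + n) j).
  rewrite /east_constraint filled_resample; last by move=> j jE; apply: intv_ge; rewrite jE.
  by rewrite (negbTE nb) subr0 mul1r.
have X0 : 0 <= X by apply: mean_ge0 => // xi; exact: sqr_ge0.
have Cn1 : 1 <= C ^+ n by rewrite exprn_ege1.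
rewrite -/S h6 exprS; apply: le_trans h1 _.
have h7 : rho * avg rho A (fun zeta => (f zeta - m0) ^+ 2) e1 <= rho * (2 * X + 2 * v0).
  by rewrite ler_wpM2l ?(ltW rho_gt0).
have h8 : C * (C ^+ n * ((1 - rho) * g)) <= C * (C ^+ n * aG).
  by rewrite !ler_wpM2l ?exprn_ge0.
have h9 : C * (1 - rho) = 2 by rewrite /C /east_gap_const divfK// gt_eqF.
have h10 : rho * X <= C ^+ n * (rho * X) by rewrite ler_peMl// mulr_ge0 ?(ltW rho_gt0).
have h11 : rho * v0 <= v0 by rewrite ler_piMl//; move: rho_lt1; lra.
have h12 : C * (C ^+ n * ((1 - rho) * g)) = 2 * (C ^+ n * g) by rewrite -h9; ring.
have h13 : C * C ^+ n * (rho * (1 - rho) * X) = 2 * (C ^+ n * (rho * X)) by rewrite -h9; ring.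
by rewrite mulrDr h13 -mulrA; lra.
Qed.

(** Given the last empty site [x], the interval from [a] to [x] has an empty right boundary. The
    events are disjoint in [x], so the Dirichlet forms add up to at most one. *)
Lemma sum_mean_local_var_le a b c f : (a <= b)%N -> (b <= c)%N ->
  \sum_(b <= x < c) mean rho (fun eta => (last_empty eta x c)%:R * local_var rho (intv a x) f eta) <=
  east_gap_const ^+ (c - a) * mean rho (east_dirichlet_on a c f).
Proof.
move=> ab bc; have C1 := east_gap_const_ge1; set C := east_gap_const in C1 *.
apply: (@le_trans _ _ (\sum_(b <= x < c) C ^+ (c - a) *
    mean rho (fun eta => (last_empty eta x c)%:R * east_dirichlet_on a c f eta))).
  rewrite big_nat [leRHS]big_nat; apply: ler_sum => x /andP[bx xc].
  have ind : indep (intv a x) (fun eta : config N => (last_empty eta x c)%:R : R).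
    exact: indep_last_empty.
  apply: (@le_trans _ _ (mean rho (fun eta => (last_empty eta x c)%:R *
      (C ^+ (c - a) * avg rho (intv a x) (east_dirichlet_on a x f) eta)))).
    apply: ler_mean => // eta; have [/andP[nx _]|] := boolP (last_empty eta x c); last by rewrite !mul0r.
    rewrite !mul1r; apply: le_trans (local_var_interval_le _ (leq_trans ab bx) nx) _.
    rewrite ler_wpM2r ?ler_weXn2l ?leq_sub2r 1?ltnW//.
    by apply: mean_ge0 => // xi; exact: east_dirichlet_on_ge0.
  rewrite [leLHS](_ : _ = C ^+ (c - a) * mean rho (fun eta => (last_empty eta x c)%:R *
      avg rho (intv a x) (east_dirichlet_on a x f) eta)); last first.
    by rewrite -meanZ; apply: eq_mean => eta; ring.
  rewrite mean_indepM// ler_wpM2l ?exprn_ge0//; first by lra.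
  apply: ler_mean => // eta; rewrite ler_wpM2l//.
  rewrite /east_dirichlet_on big_mkcond [leRHS]big_mkcond; apply: ler_sum => j _.
  have := east_term_ge0 j f eta; rewrite /intv; case: ifP => [h|_]; case: ifP => // h'.
  by move: h h'; lia.
rewrite -mulr_sumr ler_wpM2l ?exprn_ge0//; first by lra.
rewrite -mean_sum; apply: ler_mean => // eta.
rewrite -mulr_suml -natr_sum sum_last_empty// ler_piMl ?east_dirichlet_on_ge0//.
by case: (~~ _).
Qed.
End poincare.

(** * Killing on an occupied site *)

Section barta.
Context {R : realType}.
Variable rho : R.
Hypothesis hrho : 0 < rho < 1.
Variable N : nat.
Implicit Types (f psi g : config N -> R) (eta xi zeta : config N).

(** Cauchy-Schwarz for the product of f / sqrt psi and sqrt psi. *)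
Lemma avg_sqr_le_weighted S f psi eta : (forall zeta, 0 < psi zeta) ->
  avg rho S f eta ^+ 2 <=
  avg rho S (fun zeta => f zeta ^+ 2 / psi zeta) eta * avg rho S psi eta.
Proof.
move=> psi0; set m := avg rho S f eta; set A := avg rho S psi eta.
have A0 : 0 < A.
  rewrite /A /avg /mean (bigD1 eta)//= ltr_pwDl ?mulr_gt0 ?bernoulli_weight_gt0//.
  by apply: sumr_ge0 => zeta _; rewrite mulr_ge0// ltW// bernoulli_weight_gt0.
have : 0 <= avg rho S (fun zeta => psi zeta * (f zeta / psi zeta - m / A) ^+ 2) eta.
  by apply: mean_ge0 => // xi; rewrite mulr_ge0 ?sqr_ge0// ltW.
have -> : avg rho S (fun zeta => psi zeta * (f zeta / psi zeta - m / A) ^+ 2) eta =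
    avg rho S (fun zeta => f zeta ^+ 2 / psi zeta) eta +
    (- (2 * (m / A)) * m + (m / A) ^+ 2 * A).
  rewrite -[X in _ * X + _]/(mean rho (fun xi => f (resample S xi eta))).
  rewrite -[X in _ + _ * X]/(mean rho (fun xi => psi (resample S xi eta))).
  rewrite -!meanZ -!meanD; apply: eq_mean => xi.
  by field; rewrite !gt_eqF.
rewrite (_ : _ + _ * A = - (m ^+ 2 / A)); last by field; rewrite gt_eqF.
by rewrite subr_ge0 ler_pdivrMr.
Qed.

(* Barta's argument: a positive [psi] with [avg psi <= (1 - c) psi] forces [c] to
   be a lower bound of the Dirichlet form of the resampling of [S]. *)
Lemma mean_local_var_ge S (g psi f : config N -> R) : indep S g -> (forall eta, 0 <= g eta) ->
  (forall eta, 0 < psi eta) ->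
  mean rho (fun eta => f eta ^+ 2 * (g eta * (1 - avg rho S psi eta / psi eta))) <=
  mean rho (fun eta => g eta * local_var rho S f eta).
Proof.
move=> ig g0 psi0.
have -> : mean rho (fun eta => f eta ^+ 2 * (g eta * (1 - avg rho S psi eta / psi eta))) =
    mean rho (fun eta => g eta * avg rho S (fun zeta => f zeta ^+ 2) eta) -
    mean rho (fun eta => g eta * avg rho S psi eta *
      avg rho S (fun zeta => f zeta ^+ 2 / psi zeta) eta).
  rewrite !mean_indepM//; last by move=> xi eta; rewrite ig (indep_avg rho S psi).
  by rewrite -meanB; apply: eq_mean => eta; ring.
rewrite -meanB; apply: ler_mean => // eta.
rewrite -mulrA -mulrBr ler_wpM2l// local_varE lerD2l lerN2 mulrC.
exact: avg_sqr_le_weighted.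
Qed.

End barta.

Section east_killing.
Context {R : realType}.
Variable rho : R.
Hypothesis hrho : 0 < rho < 1.

Lemma card_intv N a b : (a <= b <= N)%N -> #|(intv a b : pred 'I_N)| = (b - a)%N.
Proof.
move=> /andP[ab bN]; rewrite -sum1_card.
rewrite (eq_bigl (fun i : 'I_N => (a <= i < b)%N)) //.
rewrite -(big_mkord (fun i => (a <= i < b)%N) (fun=> 1%N)).
rewrite (@big_cat_nat _ _ _ a)//=; last exact: leq_trans bN.
rewrite big_nat_cond big_pred0 ?add0n; last by move=> i; lia.
rewrite (@big_cat_nat _ _ _ b)//= [X in (_ + X)%N]big_nat_cond.
rewrite [X in (_ + X)%N]big_pred0 ?addn0; last by move=> i; lia.
rewrite big_nat_cond (eq_bigl (fun i => (a <= i < b)%N)); last by move=> i; lia.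
by rewrite -big_nat sum_nat_const_nat muln1.
Qed.

Section blocks.
Variables (N : nat) (k : 'I_N) (l : nat).
Hypothesis l_gt0 : (0 < l)%N.
Implicit Types (eta xi zeta : config N) (J b : nat).

(** Block 0 is the single site [k], where [f] is killed unless occupied; all later blocks have
    length [l]. *)
Let block_start J : nat := if J is J'.+1 then (k.+1 + J' * l)%N else k.
Let T J : pred 'I_N := intv (block_start J) (block_start J.+1).

(** Mind the shift: [full eta J] concerns block [J.+1], whose empty site, if any, provides the
    boundary needed to resample block [J]. *)
Let full eta J : bool := allfilled eta (block_start J.+1) (block_start J.+2).

Let not_full_far eta : exists J, ~~ full eta J.
Proof. by exists N; rewrite /full allfilled_gt//=; have := ltn_ord k; nia. Qed.

Let run eta : nat := ex_minn (not_full_far eta).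

Let run_leN eta : (run eta <= N)%N.
Proof.
rewrite /run; case: ex_minnP => b _; apply.
by rewrite /full allfilled_gt//=; have := ltn_ord k; nia.
Qed.

Let full_run eta : ~~ full eta (run eta).
Proof. by rewrite /run; case: ex_minnP. Qed.

Let full_lt_run eta J : (J < run eta)%N -> full eta J.
Proof.
rewrite /run; case: ex_minnP => b _ h Jb; apply: contraLR Jb => /h.
by rewrite -leqNgt.
Qed.

Let runE eta b : (forall J, (J < b)%N -> full eta J) -> ~~ full eta b -> run eta = b.
Proof.
move=> h nb; rewrite /run; case: ex_minnP => c nc hc; apply/eqP; rewrite eqn_leq hc//=.
by rewrite leqNgt; apply: contra nc => /h.
Qed.

Let full_resample eta xi J J' : J' != J.+1 -> full (resample (T J') xi eta) J = full eta J.
Proof.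
move=> JJ; apply: allfilled_resample => j.
by rewrite /T /intv; case: J' JJ => [|J'] JJ /=; nia.
Qed.

Let mean_full eta J : mean rho (fun xi => (full (resample (T J.+1) xi eta) J)%:R) <= rho ^+ l.
Proof.
have [hN|hN] := leqP (block_start J.+2) N; last first.
  rewrite (@eq_mean _ _ _ _ (fun=> 0)); last by move=> xi; rewrite /full allfilled_gt//=; nia.
  by rewrite mean_cst exprn_ge0// ltW//; case/andP: hrho.
have := mean_filled rho (T J.+1); rewrite card_intv; last by rewrite hN andbT /=; nia.
rewrite [X in _ ^+ X](_ : _ = l); last by rewrite /=; lia.
move=> <-; apply: ler_mean => // xi; rewrite ler_nat.
case E: (full _ _) => //; move/allfilledP: E => h; rewrite lt0b; apply/forallP => j; apply/implyP => Tj.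
have := h j Tj; rewrite filled_ord ffunE.
by rewrite -/(T J.+1 j) Tj.
Qed.

(* When the run is nonempty, resampling its last block halves [psi] with probability at least
   [1 - rho ^+ l], while resampling the next block doubles it with probability at most [rho ^+ l];
   when the run is empty, resampling [k] decreases the first factor. *)
Let psi eta : R := (1 + (eta k)%:R) * 2 ^+ run eta.

Let psi_gt0 eta : 0 < psi eta.
Proof. by rewrite mulr_gt0 ?exprn_gt0// ltr_pwDl. Qed.

(** The gain in Barta's inequality for block [J], resampled only when the next block contains an
    empty site. *)
Let term J eta : R := (~~ full eta J)%:R * (1 - avg rho (T J) psi eta / psi eta).

Let resample_k eta xi J : resample (T J.+1) xi eta k = eta k.
Proof. by rewrite ffunE /T /intv /=; case: ifP => //; lia. Qed.



(** Among the blocks that may be resampled, only two matter: the block ending the run gains at least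
    (1 - rho) / 4, and the one after it loses at most rho^l. Blocks strictly inside the run have a
    full successor and weight 0; blocks further away do not change [psi]. *)
Let term_ge (J : nat) eta : eta k -> (rho ^+ l <= (1 - rho) / 8) ->
  (1 - rho) / 4 * ((J == run eta)%:R - (J == (run eta).+1)%:R / 2) <= term J eta.
Proof.
move=> ek le; set b := run eta.
have [r0 r1] : 0 < rho /\ rho < 1 by case/andP: hrho.
have psiE : psi eta = 2 * 2 ^+ b by rewrite /psi ek.
have psi0 := psi_gt0 eta.
have [Jb|Jb|->] := ltngtP J b.
- rewrite (_ : J == b.+1 = false) ?mul0r ?subrr ?mulr0; last by lia.
  by rewrite /term (full_lt_run Jb) mul0r.
- rewrite sub0r; case: J Jb => [//|J] Jb.
  have fullE xi j : j != J -> full (resample (T J.+1) xi eta) j = full eta j.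
    by move=> jJ; apply: full_resample; rewrite eqSS eq_sym.
  rewrite eqSS; have [Jb'|Jb'] := eqVneq J b.
    rewrite /term; case: (full eta J.+1) (fullE^~ J.+1) => fJ1.
      by rewrite mul0r mulrN oppr_le0 !mulr_ge0//; lra.
    have pE xi : psi (resample (T J.+1) xi eta) =
        psi eta * (1 + (full (resample (T J.+1) xi eta) J)%:R).
      rewrite /psi resample_k ek -mulrA; congr (_ * _).
      have [fJ|fJ] := boolP (full (resample (T J.+1) xi eta) J).
        rewrite (_ : run _ = b.+1) ?exprS -/b; first by rewrite mulrC.
        apply: runE => [i|]; last by rewrite -Jb' fJ1//; lia.
        rewrite ltnS leq_eqVlt -{1}Jb' => /predU1P[->//|ib].
        by rewrite fullE ?full_lt_run//; lia.
      rewrite addr0 mulr1 (_ : run _ = b)//.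
      apply: runE => [i ib|]; last by rewrite -Jb'.
      by rewrite fullE ?full_lt_run//; lia.
    have -> : avg rho (T J.+1) psi eta / psi eta =
        1 + mean rho (fun xi => (full (resample (T J.+1) xi eta) J)%:R).
      rewrite /avg (eq_mean _ pE) meanZ mulrAC divff ?gt_eqF// mul1r.
      by rewrite meanD mean_cst.
    have := mean_full eta J; rewrite /= mul1r; lra.
  rewrite /term mul0r oppr0 mulr0 mulr_ge0//.
  rewrite subr_ge0 (_ : avg _ _ _ _ = psi eta) ?divff ?gt_eqF//.
  rewrite -[RHS](mean_cst rho N); apply: eq_mean => xi.
  rewrite /psi resample_k (_ : run _ = b)//.
  apply: runE => [i ib|]; first by rewrite fullE ?full_lt_run//; lia.
  by rewrite fullE ?full_run//; lia.
rewrite (_ : b == b.+1 = false) ?mul0r ?subr0 ?mulr1; last by lia.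
rewrite /term full_run mul1r.
case bE : b => [|b'].
  have pE xi : psi (resample (T 0) xi eta) = 1 + (xi k)%:R.
    have -> : xi k = resample (T 0) xi eta k by rewrite ffunE /T /intv /= mul0n addn0 !leqnn.
    rewrite /psi (_ : run _ = 0%N) ?mulr1//.
    apply: runE => //; rewrite full_resample// -bE; exact: full_run.
  have -> : avg rho (T 0) psi eta = 1 + rho.
    rewrite /avg (eq_mean _ pE) meanD mean_cst (mean_coord rho k (fun c : bool => c%:R)).
    by rewrite mulr1 mulr0 addr0.
  by rewrite psiE bE expr0 mulr1; lra.
have fullE xi j : j != b' -> full (resample (T b'.+1) xi eta) j = full eta j.
  by move=> jJ; apply: full_resample; rewrite eqSS eq_sym.
have pE xi : psi (resample (T b'.+1) xi eta) =
    psi eta / 2 * (1 + (full (resample (T b'.+1) xi eta) b')%:R).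
  rewrite psiE bE exprS /psi resample_k ek.
  have [fJ|fJ] := boolP (full (resample (T b'.+1) xi eta) b').
    rewrite (_ : run _ = b'.+1); first by rewrite exprS; field.
    apply: runE => [i|]; last by rewrite fullE -?bE ?full_run//; lia.
    rewrite ltnS leq_eqVlt => /predU1P[->//|ib].
    by rewrite fullE ?full_lt_run -/b ?bE//; lia.
  rewrite (_ : run _ = b'); first by rewrite /= mulr0n; field.
  apply: runE => [i ib|//].
  by rewrite fullE ?full_lt_run -/b ?bE//; lia.
have -> : avg rho (T b'.+1) psi eta / psi eta =
    (1 + mean rho (fun xi => (full (resample (T b'.+1) xi eta) b')%:R)) / 2.
  rewrite /avg (eq_mean _ pE) meanZ meanD mean_cst.
  by field; rewrite gt_eqF.
have := mean_full eta b'; lra.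
Qed.

(** The gains of [term_ge] add up to (1 - rho) / 4 - (1 - rho) / 8. The exponent [2 * l] bounds the
    length of two adjacent blocks, and the factor 2 comes from each site lying in at most two such
    pairs. *)
Lemma mean_sqr_le_east_dirichlet (f : config N -> R) :
  rho ^+ l <= (1 - rho) / 8 -> (forall eta, ~~ eta k -> f eta = 0) ->
  (1 - rho) / 8 * mean rho (fun eta => f eta ^+ 2) <=
  2 * east_gap_const rho ^+ (2 * l) * mean rho (east_dirichlet_on rho 0 N f).
Proof.
move=> le supp.
have [r0 r1] : 0 < rho /\ rho < 1 by case/andP: hrho.
have C1 := east_gap_const_ge1 hrho; set C := east_gap_const rho in C1 *.
pose M := N.+2.
have start_lt J : (block_start J < block_start J.+1)%N by case: J => [|J] /=; nia.
have start_le i j : (i <= j)%N -> (block_start i <= block_start j)%N.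
  move=> ij; elim: j ij => [|j IH]; first by case: i.
  by rewrite leq_eqVlt => /predU1P[->//|/IH h]; apply: leq_trans h (ltnW (start_lt j)).
have low : (1 - rho) / 8 * mean rho (fun eta => f eta ^+ 2) <=
    \sum_(J < M) mean rho (fun eta => (~~ full eta J)%:R * local_var rho (T J) f eta).
  apply: (@le_trans _ _ (\sum_(J < M) mean rho (fun eta => f eta ^+ 2 * term J eta))); last first.
    apply: ler_sum => J _; apply: mean_local_var_ge => //.
    by move=> xi eta; rewrite full_resample//; lia.
  rewrite -mean_sum -meanZ; apply: ler_mean => // eta.
  rewrite -mulr_sumr mulrC; have [ek|/supp->] := boolP (eta k); last by rewrite expr0n !mul0r.
  rewrite ler_wpM2l ?sqr_ge0//.
  apply: (@le_trans _ _ (\sum_(J < M) (1 - rho) / 4 *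
     ((nat_of_ord J == run eta)%:R - (nat_of_ord J == (run eta).+1)%:R / 2))); last first.
    by apply: ler_sum => J _; exact: term_ge.
  rewrite -mulr_sumr sumrB -mulr_suml.
  have one b : (b < M)%N -> \sum_(J < M) (nat_of_ord J == b)%:R = 1 :> R.
    move=> bM; rewrite (bigD1 (Ordinal bM))//= eqxx big1 ?addr0// => J.
    by rewrite -val_eqE /= => /negbTE ->.
  by have := run_leN eta => rN; rewrite !one//; [lra|rewrite /M; lia..].
apply: le_trans low _.
apply: (@le_trans _ _ (\sum_(J < M) C ^+ (2 * l) *
    mean rho (east_dirichlet_on rho (block_start J) (block_start J.+2) f))).
  apply: ler_sum => J _.
  have s1 := start_lt J; have s2 := start_lt J.+1.
  apply: (@le_trans _ _ (C ^+ (block_start J.+2 - block_start J) *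
      mean rho (east_dirichlet_on rho (block_start J) (block_start J.+2) f))); last first.
    rewrite ler_wpM2r//; first by apply: mean_ge0 => // eta; exact: east_dirichlet_on_ge0.
    by rewrite ler_weXn2l//; case: (nat_of_ord J) => [|j] /=; nia.
  apply: le_trans (sum_mean_local_var_le hrho f (ltnW s1) (ltnW s2)).
  rewrite (@eq_mean _ _ _ _ (fun eta => \sum_(block_start J.+1 <= x < block_start J.+2)
    (last_empty eta x (block_start J.+2))%:R * local_var rho (T J) f eta)); last first.
    by move=> eta; rewrite -mulr_suml -natr_sum sum_last_empty// ltnW.
  rewrite mean_sum big_nat [leRHS]big_nat; apply: ler_sum => x /andP[x1 x2].
  have ind : indep (intv (block_start J) x)
      (fun eta : config N => (last_empty eta x (block_start J.+2))%:R : R).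
    exact: indep_last_empty.
  rewrite -(mean_indepM rho _ ind); apply: ler_mean => // eta; rewrite ler_wpM2l//.
  by apply: avg_local_var_le => // j; rewrite /T /intv; lia.
rewrite -mulr_sumr [2 * _]mulrC -mulrA ler_wpM2l ?exprn_ge0//; first by lra.
rewrite -mean_sum -meanZ; apply: ler_mean => // eta.
rewrite /east_dirichlet_on.
under eq_bigr do rewrite big_mkcond.
rewrite exchange_big mulr_sumr [leRHS]big_mkcond; apply: ler_sum => j _ /=.
rewrite {2}/intv leq0n ltn_ord/=.
set Y := (X in 2 * X); have Y0 : 0 <= Y by exact: east_term_ge0.
apply: (@le_trans _ _ (\sum_(J < M) (((j < block_start J.+1)%N%:R - (j < block_start J)%N%:R) +
   ((j < block_start J.+2)%N%:R - (j < block_start J.+1)%N%:R)) * Y)).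
  apply: ler_sum => J _; rewrite /intv.
  have s1 := start_lt J; have s2 := start_lt J.+1.
  case: (ltnP j (block_start J)) => j1; case: (ltnP j (block_start J.+1)) => j2;
    case: (ltnP j (block_start J.+2)) => j3 /=; rewrite ?subrr ?subr0 ?add0r ?addr0 ?mul1r ?mul0r//; lia.
rewrite -mulr_suml ler_wpM2r// big_split /=.
have tele g : \sum_(J < M) ((j < g J.+1)%N%:R - (j < g J)%N%:R) = (j < g M)%N%:R - (j < g 0%N)%N%:R :> R.
  by rewrite -(big_mkord xpredT (fun J => (j < g J.+1)%N%:R - (j < g J)%N%:R)) telescope_sumr.
rewrite (tele block_start) (tele (fun J => block_start J.+1)).
by do 4 case: ltnP => _ /=; lra.
Qed.

End blocks.

(** The block length is chosen from [rho] alone, hence a constant uniform in the size and in the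
    killing site. *)
Lemma east_killing_gap : exists2 s, 0 < s &
  forall N (k : 'I_N) (f : config N -> R), (forall eta : config N, ~~ eta k -> f eta = 0) ->
  s * mean rho (fun eta => f eta ^+ 2) <= mean rho (east_dirichlet_on rho 0 N f).
Proof.
have [r0 r1] : 0 < rho /\ rho < 1 by case/andP: hrho.
have [l l0 le] : exists2 l, (0 < l)%N & rho ^+ l <= (1 - rho) / 8.
  have : (fun n => rho ^+ n) @ \oo --> (0 : R) by apply: cvg_expr; rewrite gtr0_norm.
  move=> /cvgrPdist_le/(_ ((1 - rho) / 8)) h.
  have e0 : 0 < (1 - rho) / 8 by lra.
  have [n [n0 hn]] := filter_ex (filterI (nbhs_infty_gt 0) (h e0)).
  by exists n => //; move: hn; rewrite sub0r normrN ger0_norm// exprn_ge0// ltW.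
have C1 := east_gap_const_ge1 hrho.
have C0 : 0 < 2 * east_gap_const rho ^+ (2 * l) by rewrite mulr_gt0// exprn_gt0//; lra.
exists ((1 - rho) / 8 / (2 * east_gap_const rho ^+ (2 * l))).
  by rewrite divr_gt0//; lra.
move=> N k f supp; rewrite mulrAC ler_pdivrMr// [leRHS]mulrC.
exact: (mean_sqr_le_east_dirichlet l0 le supp).
Qed.
End east_killing.

(** * Dirichlet forms of the constrained models *)

Section kcm_forms.
Context {R : realType}.
Variables (m : kcm) (rho : R).
Hypothesis hrho : 0 < rho < 1.
Variable N : nat.
Implicit Types (f g : config N -> R) (eta xi zeta : config N).

Let rho_gt0 : 0 < rho. Proof. by case/andP: hrho. Qed.
Let rho_lt1 : 0 < 1 - rho. Proof. by rewrite subr_gt0; case/andP: hrho. Qed.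

Local Notation constr := (@constraint R m N).
Local Notation c := (@rate R m rho N).
Local Notation w := (@bernoulli_weight R rho N).

Lemma occS eta x : occ m eta x.+1 = filled eta x.
Proof. by []. Qed.

Lemma occ_flip eta (i : 'I_N) x : x != i.+1 -> occ m (flip eta i) x = occ m eta x.
Proof.
case: x => [//|x]; rewrite !occS eqSS => xi.
have [xN|Nx] := ltnP x N; last by rewrite !filled_ge.
by rewrite -[x]/(nat_of_ord (Ordinal xN)) !filled_ord ffunE -val_eqE /= (negbTE xi).
Qed.

Lemma constraint_flip eta (i : 'I_N) : constr (flip eta i) i = constr eta i.
Proof. by rewrite /constraint !occ_flip// neq_ltn ltnSn ?orbT. Qed.

Lemma constraint_bounds eta i : 0 <= constr eta i <= 1.
Proof.
have key (a b : bool) : 0 <= (1 - a%:R * b%:R : R) <= 1 by case: a; case: b => /=; lra.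
have key1 (b : bool) : 0 <= (1 - b%:R : R) <= 1 by case: b => /=; lra.
by rewrite /constraint; case: m; [exact: key1|exact: key|exact: key].
Qed.

Lemma rate_bounds eta i : 0 <= c eta i <= 1.
Proof.
have [c0 c1] := andP (constraint_bounds eta i).
have s0 : 0 <= (eta i)%:R * (1 - rho) + (1 - (eta i)%:R) * rho <= 1.
  by case: (eta i) => /=; move: rho_gt0 rho_lt1; lra.
have [s1 s2] := andP s0.
by rewrite /rate mulr_ge0//= mulr_ile1.
Qed.

Lemma rate_ge0 eta i : 0 <= c eta i. Proof. by case/andP: (rate_bounds eta i). Qed.
Lemma rate_le1 eta i : c eta i <= 1. Proof. by case/andP: (rate_bounds eta i). Qed.

Lemma detailed_balance eta i : w (flip eta i) * c (flip eta i) i = w eta * c eta i.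
Proof.
rewrite /rate constraint_flip /bernoulli_weight (bigD1 i)//= [in RHS](bigD1 i)//=.
rewrite (eq_bigr (fun j => if eta j then rho else 1 - rho)); last first.
  by move=> j /negbTE ji; rewrite ffunE ji.
by rewrite ffunE eqxx; case: (eta i) => /=; ring.
Qed.

Lemma flip_neq eta i : flip eta i != eta.
Proof. by apply/eqP => /ffunP/(_ i); rewrite ffunE eqxx; case: (eta i). Qed.

Lemma mean_rate_flip i f :
  mean rho (fun eta => c eta i * f (flip eta i)) = mean rho (fun eta => c eta i * f eta).
Proof.
rewrite /mean (reindex_inj (inv_inj (flipK i))) /=; apply: eq_bigr => eta _.
by rewrite flipK mulrA detailed_balance mulrA.
Qed.

Definition kcm_dirichlet f : R :=
  2^-1 * \sum_(i < N) mean rho (fun eta => c eta i * (f (flip eta i) - f eta) ^+ 2).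

Definition total_rate eta : R := \sum_(i < N) c eta i.

Definition tilted_form (lambda : R) f : R :=
  mean rho (fun eta => f eta *
    \sum_(i < N) c eta i * (expR lambda * f (flip eta i) - f eta)).

(** By reversibility, f(eta)^2 and f(flip eta)^2 have the same mean against the rate, so the cross
    term is a difference between the mean of the total rate and the Dirichlet form. *)
Lemma tilted_formE lambda f : tilted_form lambda f =
  (expR lambda - 1) * mean rho (fun eta => total_rate eta * f eta ^+ 2) -
  expR lambda * kcm_dirichlet f.
Proof.
have E i : mean rho (fun eta => c eta i * (f (flip eta i) - f eta) ^+ 2) =
    2 * (mean rho (fun eta => c eta i * f eta ^+ 2) -
         mean rho (fun eta => c eta i * (f eta * f (flip eta i)))).
  transitivity (mean rho (fun eta => c eta i * f (flip eta i) ^+ 2) +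
     (mean rho (fun eta => c eta i * f eta ^+ 2) +
      - 2 * mean rho (fun eta => c eta i * (f eta * f (flip eta i))))).
    by rewrite -meanZ -!meanD; apply: eq_mean => eta; ring.
  by rewrite (mean_rate_flip i (fun eta => f eta ^+ 2)); ring.
transitivity (\sum_(i < N) (expR lambda * mean rho (fun eta => c eta i * (f eta * f (flip eta i))) -
    mean rho (fun eta => c eta i * f eta ^+ 2))).
  transitivity (\sum_(i < N) mean rho (fun eta =>
     expR lambda * (c eta i * (f eta * f (flip eta i))) - c eta i * f eta ^+ 2)).
    by rewrite -mean_sum; apply: eq_mean => eta; rewrite mulr_sumr; apply: eq_bigr => i _; ring.
  by apply: eq_bigr => i _; rewrite meanB meanZ.
rewrite /kcm_dirichlet; under [in RHS]eq_bigr do rewrite E.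
rewrite -[in RHS]mulr_sumr mulKf// sumrB.
have -> : mean rho (fun eta => total_rate eta * f eta ^+ 2) =
    \sum_(i < N) mean rho (fun eta => c eta i * f eta ^+ 2).
  by rewrite -mean_sum; apply: eq_mean => eta; rewrite mulr_suml.
by rewrite sumrB -mulr_sumr; ring.
Qed.

Lemma kcm_dirichlet_ge0 f : 0 <= kcm_dirichlet f.
Proof.
rewrite mulr_ge0 ?invr_ge0//; apply: sumr_ge0 => i _; apply: mean_ge0 => // eta.
by rewrite mulr_ge0 ?sqr_ge0 ?rate_ge0.
Qed.

(** Averaging over the flipped site replaces the two rates by [rho * (1 - rho)] for each of the two
    values, and the factor 1/2 cancels this multiplicity. *)
Lemma kcm_dirichletE f :
  kcm_dirichlet f = mean rho (fun eta => \sum_(i < N) constr eta i * local_dirichlet rho i f eta).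
Proof.
rewrite /kcm_dirichlet mean_sum mulr_sumr; apply: eq_bigr => i _.
rewrite -(mean_avg rho (pred1 i)) -[RHS](mean_avg rho (pred1 i)) -meanZ.
apply: eq_mean => eta; rewrite !avg1 /local_dirichlet.
have cE : constr (upd eta i true) i = constr (upd eta i false) i.
  by rewrite -(flip_upd eta i false) constraint_flip.
rewrite /rate cE !flip_upd /= !ffunE eqxx /=.
by field.
Qed.

Lemma east_le_constraint eta i : east_constraint eta i <= constr eta i :> R.
Proof.
have key (a b : bool) : 1 - b%:R <= 1 - a%:R * b%:R :> R by case: a; case: b => /=; lra.
by rewrite /east_constraint /constraint occS; case: m; [exact: lexx|exact: key|exact: key].
Qed.

Lemma east_dirichlet_le f : mean rho (east_dirichlet_on rho 0 N f) <= kcm_dirichlet f.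
Proof.
rewrite kcm_dirichletE; apply: ler_mean => // eta; rewrite /east_dirichlet_on.
rewrite (eq_bigl xpredT); last by move=> j; rewrite /intv ltn_ord.
by apply: ler_sum => i _; rewrite ler_wpM2r ?local_dirichlet_ge0 ?east_le_constraint.
Qed.

Lemma kapp_tilted_generator lambda f eta :
  kapp (tilted_generator (@generator R m rho N) lambda) f eta =
  \sum_(i < N) c eta i * (expR lambda * f (flip eta i) - f eta).
Proof.
rewrite /kapp /tilted_generator /generator.
transitivity (\sum_(y : config N) \sum_(i < N) c eta i *
  ((flip eta i == y)%:R * (tilt lambda eta y * f y) - (eta == y)%:R * (tilt lambda eta y * f y))).
  by apply: eq_bigr => y _; rewrite mulr_sumr mulr_suml; apply: eq_bigr => i _; ring.
rewrite exchange_big; apply: eq_bigr => i _; rewrite -mulr_sumr; congr (_ * _).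
have pick x (F : config N -> R) : \sum_(y : config N) (x == y)%:R * F y = F x.
  rewrite (bigD1 x)//= eqxx mul1r big1 ?addr0// => y.
  by rewrite eq_sym => /negbTE ->; rewrite mul0r.
rewrite sumrB !pick /tilt eqxx mul1r; congr (_ * _ - _).
by rewrite eq_sym (negbTE (flip_neq eta i)).
Qed.

Lemma wform_tilted_generator lambda f :
  wform w f (kapp (tilted_generator (@generator R m rho N) lambda) f) = tilted_form lambda f.
Proof. by apply: eq_bigr => eta _; rewrite kapp_tilted_generator. Qed.

Lemma tilted_generator_sym lambda x y :
  w x * tilted_generator (@generator R m rho N) lambda x y =
  w y * tilted_generator (@generator R m rho N) lambda y x.
Proof.
have [->//|xy] := eqVneq x y.
have yx : y != x by rewrite eq_sym.
rewrite /tilted_generator /tilt (negbTE xy) (negbTE yx) mulrCA [RHS]mulrCA; congr (_ * _).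
rewrite /generator !mulr_sumr; apply: eq_bigr => i _.
rewrite (negbTE xy) (negbTE yx) !subr0.
have [<-|ne] := eqVneq (flip x i) y.
  by rewrite flipK eqxx !mulr1 detailed_balance.
have -> : (flip y i == x) = false.
  by apply/negbTE; apply: contra ne => /eqP <-; rewrite flipK.
by rewrite !mulr0.
Qed.

End kcm_forms.

(** * Local equilibrium *)

Lemma sum_window N a b : (\sum_(i < N) (a <= i < b) = minn N b - minn N a)%N.
Proof. by elim: N => [|N IH]; rewrite ?big_ord0 ?big_ord_recr /= ?IH; lia. Qed.

(** The windows of [r] occupied sites are disjoint: each of their sites is charged to the last empty
    site before it. *)
Lemma sum_filled_after_empty N (eta : config N) r :
  (r * \sum_(y < N) last_empty eta y (y.+1 + r) <= N)%N.
Proof.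
have win (y : 'I_N) : (r * last_empty eta y (y.+1 + r) <=
    \sum_(z < N) (y < z)%N * last_empty eta y z.+1)%N.
  have [/andP[ny full]|] := boolP (last_empty eta y (y.+1 + r)); last by rewrite muln0.
  have yr : (y.+1 + r <= N)%N.
    case: r full => [|r] full; first by rewrite addn0.
    by rewrite leqNgt; apply/negP => h; rewrite allfilled_gt// in full; lia.
  rewrite muln1; apply: (@leq_trans (\sum_(z < N) (y.+1 <= z < y.+1 + r))).
    by rewrite sum_window; lia.
  apply: leq_sum => z _; case: (boolP (y.+1 <= z < y.+1 + r)%N) => //= yz.
  have -> : (y < z)%N by lia.
  rewrite mul1n lt0b /last_empty ny/=.
  by apply/allfilledP => x xz; move/allfilledP: full => h; apply: h; lia.
rewrite big_distrr /=; apply: leq_trans (leq_sum _ (fun y _ => win y)) _.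
rewrite exchange_big /=; apply: (@leq_trans (\sum_(z < N) 1)).
  apply: leq_sum => z _.
  apply: (@leq_trans (\sum_(0 <= y < z.+1) last_empty eta y z.+1)); last first.
    by rewrite sum_last_empty//; case: (~~ _).
  rewrite -(big_mkord xpredT (fun y => (y < z)%N * last_empty eta y z.+1)%N).
  rewrite (@big_cat_nat _ _ _ z.+1 0 N)//= [X in (_ + X)%N]big1_seq ?addn0; last first.
    by move=> y /andP[_]; rewrite mem_index_iota => yz; rewrite (_ : (y < z)%N = false)//; lia.
  by apply: leq_sum => y _; case: (y < z)%N; rewrite ?mul1n.
by rewrite sum1_card card_ord.
Qed.

Definition bulk_site N (i : 'I_N) : bool := (0 < i)%N && (i.+1 < N)%N.

Lemma boundary_le2 N : (\sum_(i < N | ~~ bulk_site i) 1 <= 2)%N.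
Proof.
apply: (@leq_trans (\sum_(i < N) ((0 <= i < 1) + (N.-1 <= i < N)))%N).
  rewrite big_mkcond; apply: leq_sum => i _; rewrite /bulk_site.
  by case: ifP => //; have := ltn_ord i; lia.
by rewrite big_split; have := sum_window N 0 1; have := sum_window N N.-1 N => /=; lia.
Qed.

Section local_equilibrium.
Context {R : realType}.
Variables (m : kcm) (rho : R).
Hypothesis hrho : 0 < rho < 1.
Variable N : nat.
Implicit Types (f g : config N -> R) (eta xi zeta : config N).

Local Notation c := (@rate R m rho N).
Local Notation A := (@mean_activity R m rho).
Local Notation C := (east_gap_const rho).

Lemma mean_rate (i : 'I_N) : bulk_site i -> mean rho (c^~ i) = A.
Proof. by move=> /andP[i0 iN]; apply: mean_rateE; lia. Qed.

Lemma filled_resample_in (S : pred 'I_N) xi eta (j : 'I_N) : S j ->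
  filled (resample S xi eta) j = filled xi j.
Proof. by move=> Sj; rewrite !filled_ord ffunE Sj. Qed.

Lemma occ_bulk_site eta (i : 'I_N) : bulk_site i -> occ m eta i.+1.-1 = filled eta i.-1.
Proof. by move=> /andP[i0 _]; rewrite -[in LHS](prednK i0). Qed.

Lemma rate_resample (S : pred 'I_N) xi eta i : bulk_site i ->
  (forall j : 'I_N, (i.-1 <= j <= i.+1)%N -> S j) -> c (resample S xi eta) i = c xi i.
Proof.
move=> ii hS; have [i0 iN] := andP ii.
rewrite /rate /constraint occS -/(i.+1.-1) !occ_bulk_site// ffunE hS; last by lia.
have pN : (i.-1 < N)%N by lia.
have hp := @filled_resample_in S xi eta (Ordinal pN) (hS (Ordinal pN) ltac:(move=> /=; lia)).
have hs := @filled_resample_in S xi eta (Ordinal iN) (hS (Ordinal iN) ltac:(move=> /=; lia)).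
by rewrite /= in hp hs; rewrite hp hs.
Qed.

Lemma avg_rate (S : pred 'I_N) eta i : bulk_site i ->
  (forall j : 'I_N, (i.-1 <= j <= i.+1)%N -> S j) -> avg rho S (c^~ i) eta = A.
Proof.
by move=> ii hS; rewrite -(mean_rate ii); apply: eq_mean => xi; rewrite rate_resample.
Qed.

Lemma mean_activity_bounds : 0 < A < 1.
Proof.
have [r0 r1] := andP hrho; rewrite /mean_activity.
have x0 : 0 < 2 * rho * (1 - rho) by rewrite !mulr_gt0//; lra.
have x1 : 2 * rho * (1 - rho) < 1.
  by have : 0 <= (rho - (1 - rho)) ^+ 2 := sqr_ge0 _; lra.
have key (y : R) : 0 < y <= 1 -> 0 < 2 * rho * (1 - rho) * y < 1.
  move=> /andP[y0 y1]; rewrite mulr_gt0//=.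
  by apply: le_lt_trans x1; rewrite ler_piMr// ltW.
have r2 : 0 < 1 - rho ^+ 2 <= 1.
  have : 0 <= rho ^+ 2 := sqr_ge0 _; have : rho * rho < rho * 1 by rewrite ltr_pM2l.
  by rewrite expr2; lra.
case: m; [|exact: key..].
by rewrite expr2 mulrA; apply: key; lra.
Qed.

(* [c - A] has zero average, so [g ^+ 2] can be replaced by [(g - a) * (g + a)], where [a] is the
   average of [g]. *)
Lemma local_equilibrium_pointwise (S : pred 'I_N) g eta i (e : R) : 0 < e -> bulk_site i ->
  (forall j : 'I_N, (i.-1 <= j <= i.+1)%N -> S j) ->
  `|avg rho S (fun zeta => (c zeta i - A) * g zeta ^+ 2) eta| <=
  4 * e * avg rho S (fun zeta => g zeta ^+ 2) eta + (4 * e)^-1 * local_var rho S g eta.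
Proof.
move=> e0 ii hS; set a := avg rho S g eta.
have cA0 : avg rho S (fun zeta => (c zeta i - A) * a ^+ 2) eta = 0.
  have -> : avg rho S (fun zeta => (c zeta i - A) * a ^+ 2) eta =
      a ^+ 2 * (avg rho S (c^~ i) eta - A).
    rewrite -{2}(mean_cst rho N A) -meanB -meanZ.
    by apply: eq_mean => xi; rewrite mulrC.
  by rewrite avg_rate// subrr mulr0.
have -> : avg rho S (fun zeta => (c zeta i - A) * g zeta ^+ 2) eta =
    avg rho S (fun zeta => (c zeta i - A) * ((g zeta - a) * (g zeta + a))) eta.
  rewrite -[LHS]subr0 -cA0 -meanB; apply: eq_mean => xi; ring.
apply: le_trans (ler_norm_mean hrho _) _.
have [A0 A1] := andP mean_activity_bounds.
apply: (@le_trans _ _ (avg rho S (fun zeta => e * (g zeta + a) ^+ 2 + (4 * e)^-1 * (g zeta - a) ^+ 2) eta)).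
  apply: ler_mean => // xi; set z := resample S xi eta.
  have c01 := rate_bounds m hrho z i.
  rewrite normrM; apply: (@le_trans _ _ `|(g z - a) * (g z + a)|).
    by rewrite ler_piMl// ler_norml; case/andP: c01 => ? ?; lra.
  have h1 : 0 <= e * ((g z + a) - (2 * e)^-1 * (g z - a)) ^+ 2 by rewrite mulr_ge0 ?sqr_ge0 ?ltW.
  have h2 : 0 <= e * ((g z + a) + (2 * e)^-1 * (g z - a)) ^+ 2 by rewrite mulr_ge0 ?sqr_ge0 ?ltW.
  have E1 : e * ((g z + a) - (2 * e)^-1 * (g z - a)) ^+ 2 =
    e * (g z + a) ^+ 2 + (4 * e)^-1 * (g z - a) ^+ 2 - (g z - a) * (g z + a).
    by field; rewrite gt_eqF.
  have E2 : e * ((g z + a) + (2 * e)^-1 * (g z - a)) ^+ 2 =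
    e * (g z + a) ^+ 2 + (4 * e)^-1 * (g z - a) ^+ 2 + (g z - a) * (g z + a).
    by field; rewrite gt_eqF.
  by rewrite ler_norml; lra.
rewrite [leLHS]meanD !meanZ -/(local_var rho S g eta) lerD2r.
rewrite -mulrA mulrCA ler_wpM2l ?(ltW e0)//.
have -> : mean rho (fun xi => (g (resample S xi eta) + a) ^+ 2) =
    avg rho S (fun zeta => g zeta ^+ 2) eta + 3 * a ^+ 2.
  transitivity (mean rho (fun xi => g (resample S xi eta) ^+ 2 +
    (2 * a * g (resample S xi eta) + a ^+ 2))); first by apply: eq_mean => xi; ring.
  rewrite !meanD meanZ mean_cst -/(avg rho S g eta) -/a.
  by rewrite /avg; ring.
have := avg_sqr_le hrho S g eta; rewrite -/a; lra.
Qed.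


(** The window starts at [i.+2], so wherever its last empty site is, the three sites that determine
    the rate at [i] lie to its left and are resampled. *)
Lemma local_equilibrium_site g i r (e : R) : 0 < e -> bulk_site i ->
  `|mean rho (fun eta => (~~ allfilled eta i.+2 (i.+2 + r))%:R *
     ((c eta i - A) * g eta ^+ 2))| <=
  4 * e * mean rho (fun eta => g eta ^+ 2) +
  (4 * e)^-1 * C ^+ r.+3 * mean rho (east_dirichlet_on rho i.-1 (i.+2 + r) g).
Proof.
move=> e0 ii; have [i0 iN] := andP ii.
set b := i.+2; set d := (b + r)%N.
have bd : (b <= d)%N by rewrite leq_addr.
have ab : (i.-1 <= b)%N by rewrite /b; lia.
have -> : mean rho (fun eta => (~~ allfilled eta b d)%:R * ((c eta i - A) * g eta ^+ 2)) =
    \sum_(b <= x < d) mean rho (fun eta => (last_empty eta x d)%:R * ((c eta i - A) * g eta ^+ 2)).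
  rewrite -mean_sum; apply: eq_mean => eta.
  by rewrite -mulr_suml -natr_sum sum_last_empty.
apply: le_trans (ler_norm_sum _ _ _) _.
apply: (@le_trans _ _ (\sum_(b <= x < d)
   (4 * e * mean rho (fun eta => (last_empty eta x d)%:R * g eta ^+ 2) +
    (4 * e)^-1 * mean rho (fun eta => (last_empty eta x d)%:R * local_var rho (intv i.-1 x) g eta)))).
  rewrite big_nat [leRHS]big_nat; apply: ler_sum => x /andP[bx xd].
  have ind := @indep_last_empty N R i.-1 x d.
  rewrite -(mean_indepM rho _ ind) -(mean_indepM rho (fun eta => g eta ^+ 2) ind) -!meanZ -meanD.
  apply: le_trans (ler_norm_mean hrho _) _; apply: ler_mean => // eta.
  have := @local_equilibrium_pointwise (intv i.-1 x) g eta i e e0 ii.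
  move=> /(_ ltac:(move=> j; rewrite /intv; move: bx; rewrite /b; lia)) h.
  rewrite normrM ger0_norm//.
  by case: (last_empty eta x d) => /=; rewrite ?mul1r ?mul0r ?mulr0 ?addr0.
rewrite big_split /= -!mulr_sumr; apply: lerD.
  rewrite ler_wpM2l ?mulr_ge0 ?(ltW e0)// -mean_sum; apply: ler_mean => // eta.
  rewrite -mulr_suml -natr_sum sum_last_empty// ler_piMl ?sqr_ge0//.
  by case: (~~ _).
rewrite -mulrA ler_wpM2l ?invr_ge0 ?mulr_ge0 ?(ltW e0)//.
apply: le_trans (sum_mean_local_var_le hrho g ab bd) _.
by rewrite (_ : d - i.-1 = r.+3)%N//; rewrite /d /b; lia.
Qed.

(** A fixed site belongs to at most [k.+3] of these windows. *)
Lemma sum_bulk_le (k : nat) (X : 'I_N -> R) :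
  (forall j, 0 <= X j) ->
  \sum_(i < N | bulk_site i) \sum_(j | intv (i.-1) (i.+2 + k) j) X j <= (k.+3)%:R * \sum_(j < N) X j.
Proof.
move=> X0; under eq_bigr do rewrite big_mkcond.
rewrite exchange_big mulr_sumr; apply: ler_sum => j _ /=.
apply: (@le_trans _ _ (\sum_(i < N) (j.+1 - k.+2 <= i < j.+2)%N%:R * X j)).
  rewrite big_mkcond; apply: ler_sum => i _; rewrite /bulk_site /intv.
  case: ifP => ii; last by rewrite mulr_ge0.
  case: ifP => ij; last by rewrite mulr_ge0.
  by rewrite (_ : (_ <= _ < _)%N = true) ?mul1r//; lia.
rewrite -mulr_suml -natr_sum sum_window ler_wpM2r// ler_nat; lia.
Qed.

(* A site next to a full window flips only if it or one of its neighbours is empty, and then the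
   last empty site before the window is one of these three. *)
Lemma rate_filled_le eta i r : bulk_site i ->
  c eta i * (allfilled eta i.+2 (i.+2 + r))%:R <=
  \sum_(y < N | intv i.-1 (i.+2 + 0) y) (last_empty eta y (y.+1 + r))%:R.
Proof.
move=> ii; have [i0 iN] := andP ii.
have [full|_] := boolP (allfilled eta i.+2 (i.+2 + r)); last by rewrite mulr0 sumr_ge0.
rewrite mulr1.
have [full3|nfull3] := boolP (allfilled eta i.-1 (i.+2 + 0)).
  rewrite /rate /constraint !occS.
  move/allfilledP: full3 => h.
  have h2 : filled eta i.+1 by apply: h; lia.
  have h1 : filled eta i.-1 by apply: h; lia.
  rewrite (_ : match m with East => _ | _ => _ end = 0) ?mul0r ?sumr_ge0//.
  by rewrite occ_bulk_site// h1 h2; case: m; rewrite ?mulr1 subrr.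
apply: le_trans (rate_le1 m hrho eta i) _.
have := sum_last_empty eta (_ : (i.-1 <= i.+2 + 0)%N); rewrite nfull3 => /(_ ltac:(lia)) h.
have {h} : (0 < \sum_(i.-1 <= x < i.+2 + 0) last_empty eta x (i.+2 + 0))%N by rewrite h.
rewrite lt0n sum_nat_seq_neq0 => /hasP[x]; rewrite mem_index_iota => xi /=.
rewrite eqb0 negbK => /andP[nx fx].
have xN : (x < N)%N by lia.
rewrite (bigD1 (Ordinal xN))//= (_ : last_empty _ _ _ = true) ?lerDl ?sumr_ge0//.
rewrite /last_empty nx/=; apply/allfilledP => z xz.
have [zi|iz] := ltnP z (i.+2 + 0).
  by move/allfilledP: fx; apply; lia.
by move/allfilledP: full; apply; lia.
Qed.

Definition equilibrium_const (e : R) (r : nat) : R := (4 * e)^-1 * C ^+ r.+3 * r.+3%:R.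

Let sum_local_equilibrium g r e : 0 < e ->
  \sum_(i < N | bulk_site i)
     (4 * e * mean rho (fun eta => g eta ^+ 2) +
      (4 * e)^-1 * C ^+ r.+3 * mean rho (east_dirichlet_on rho i.-1 (i.+2 + r) g)) <=
  4 * e * N%:R * mean rho (fun eta => g eta ^+ 2) +
  equilibrium_const e r * kcm_dirichlet m rho g.
Proof.
move=> e0; have g0 : 0 <= mean rho (fun eta => g eta ^+ 2) by apply: mean_ge0 => // eta; exact: sqr_ge0.
have C1 := east_gap_const_ge1 hrho.
rewrite big_split /=; apply: lerD.
  rewrite sumr_const -[_ *+ _]mulr_natr mulrAC ler_wpM2r// ler_wpM2l ?mulr_ge0 ?(ltW e0)//.
  by rewrite ler_nat -[leqRHS]card_ord max_card.
have C0 : 0 <= C by lra.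
rewrite -mulr_sumr /equilibrium_const -(mulrA _ r.+3%:R).
apply: ler_wpM2l; first by rewrite mulr_ge0 ?exprn_ge0// invr_ge0 mulr_ge0// ltW.
apply: le_trans (ler_wpM2l _ (east_dirichlet_le m hrho g)) => //.
rewrite -mean_sum -meanZ; apply: ler_mean => // eta.
rewrite /east_dirichlet_on [X in _ * X](eq_bigl xpredT); last by move=> j; rewrite /intv ltn_ord.
by apply: sum_bulk_le => // j; exact: east_term_ge0.
Qed.

(** For an upper bound full windows need no localization: a flip next to one is charged to an empty
    site followed by [r] occupied ones. There are at most N / r such sites, each charged at most
    three times. *)
Lemma mean_total_rate_le g r e : 0 < e -> (0 < r)%N ->
  mean rho (fun eta => total_rate m rho eta * g eta ^+ 2) <=
  (A * N%:R + 2 + 3 * N%:R / r%:R + 4 * e * N%:R) * mean rho (fun eta => g eta ^+ 2) +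
  equilibrium_const e r * kcm_dirichlet m rho g.
Proof.
move=> e0 r0.
have [A0 A1] := andP mean_activity_bounds.
have r0' : 0 < r%:R :> R by rewrite ltr0n.
have boundary eta : \sum_(i < N | ~~ bulk_site i) c eta i <= 2.
  apply: le_trans (ler_sum _ (fun i _ => rate_le1 m hrho eta i)) _.
  rewrite (_ : \sum_(i < N | _) 1 = (\sum_(i < N | ~~ bulk_site i) 1)%N%:R) ?ler_nat ?boundary_le2//.
  by rewrite natr_sum.
have filled_part eta : \sum_(i < N | bulk_site i) c eta i * (allfilled eta i.+2 (i.+2 + r))%:R <=
    3 * N%:R / r%:R.
  apply: le_trans (ler_sum _ (fun i ii => rate_filled_le eta r ii)) _.
  apply: le_trans (sum_bulk_le 0 _) _ => //.
  rewrite -mulrA ler_wpM2l// ler_pdivlMr// mulrC -natr_sum -natrM ler_nat.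
  exact: sum_filled_after_empty.
pose part (i : 'I_N) eta := (~~ allfilled eta i.+2 (i.+2 + r))%:R * ((c eta i - A) * g eta ^+ 2).
have pt eta : total_rate m rho eta * g eta ^+ 2 <=
    (A * N%:R + 2 + 3 * N%:R / r%:R) * g eta ^+ 2 + \sum_(i < N | bulk_site i) part i eta.
  rewrite /total_rate (bigID (@bulk_site N))/= -subr_ge0.
  have -> : \sum_(i < N | bulk_site i) c eta i =
     \sum_(i < N | bulk_site i) (c eta i * (allfilled eta i.+2 (i.+2 + r))%:R) +
     \sum_(i < N | bulk_site i) (A * (~~ allfilled eta i.+2 (i.+2 + r))%:R) +
     \sum_(i < N | bulk_site i) ((~~ allfilled eta i.+2 (i.+2 + r))%:R * (c eta i - A)).
    rewrite -!big_split; apply: eq_bigr => i _ /=.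
    by case: allfilled => /=; ring.
  have -> : \sum_(i < N | bulk_site i) part i eta =
      (\sum_(i < N | bulk_site i) ((~~ allfilled eta i.+2 (i.+2 + r))%:R * (c eta i - A))) * g eta ^+ 2.
    by rewrite mulr_suml; apply: eq_bigr => i _; rewrite /part mulrA.
  have hA : \sum_(i < N | bulk_site i) (A * (~~ allfilled eta i.+2 (i.+2 + r))%:R) <= A * N%:R.
    apply: (@le_trans _ _ (\sum_(i < N) A)); last by rewrite sumr_const card_ord mulr_natr.
    rewrite big_mkcond; apply: ler_sum => i _.
    by case: ifP => _; rewrite ?(ltW A0)//; case: allfilled; rewrite ?mulr0 ?mulr1 ?(ltW A0).
  have h1 := boundary eta; have h2 := filled_part eta.
  set x1 := (\sum_(i < N | _) (c eta i * _)) in h2 *; set x2 := (\sum_(i < N | _) (A * _)) in hA *.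
  set x3 := (\sum_(i < N | _) (_ * (_ - A))).
  set x4 := (\sum_(i < N | ~~ _) _) in h1 *.
  rewrite (_ : _ - _ = ((A * N%:R - x2) + (2 - x4) + (3 * N%:R / r%:R - x1)) * g eta ^+ 2); last by ring.
  by rewrite mulr_ge0 ?sqr_ge0//; lra.
apply: le_trans (ler_mean hrho pt) _.
rewrite meanD meanZ [in leRHS]mulrDl -[leRHS]addrA lerD2l mean_sum.
apply: le_trans (sum_local_equilibrium g r e0).
apply: ler_sum => i ii; apply: le_trans (ler_norm _) _.
exact: local_equilibrium_site.
Qed.

(** Full windows do lower the rate; their weight stays as a separate term, to be controlled by the
    localization. *)
Lemma mean_total_rate_ge g r e : 0 < e ->
  (A * (N%:R - 2) - 4 * e * N%:R) * mean rho (fun eta => g eta ^+ 2) -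
  mean rho (fun eta => (\sum_(i < N) allfilled eta i.+2 (i.+2 + r))%:R * g eta ^+ 2) -
  equilibrium_const e r * kcm_dirichlet m rho g <=
  mean rho (fun eta => total_rate m rho eta * g eta ^+ 2).
Proof.
move=> e0.
have [A0 A1] := andP mean_activity_bounds.
pose part (i : 'I_N) eta := (~~ allfilled eta i.+2 (i.+2 + r))%:R * ((c eta i - A) * g eta ^+ 2).
have card_int : A * (N%:R - 2) <= \sum_(i < N | bulk_site i) A.
  have : N%:R <= \sum_(i < N | bulk_site i) (1 : R) + 2.
    rewrite -[in leLHS](card_ord N) -sum1_card natr_sum (bigID (@bulk_site N))/= lerD2l.
    rewrite (_ : \sum_(i < N | _) 1 = (\sum_(i < N | ~~ bulk_site i) 1)%N%:R) ?ler_nat ?boundary_le2//.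
    by rewrite natr_sum.
  move=> h; rewrite (_ : \sum_(i < N | _) A = A * \sum_(i < N | bulk_site i) 1).
    by rewrite ler_wpM2l ?(ltW A0)//; lra.
  by rewrite mulr_sumr; apply: eq_bigr => i _; rewrite mulr1.
have pt eta : A * (N%:R - 2) * g eta ^+ 2 -
    (\sum_(i < N) allfilled eta i.+2 (i.+2 + r))%:R * g eta ^+ 2 +
    \sum_(i < N | bulk_site i) part i eta <= total_rate m rho eta * g eta ^+ 2.
  have -> : \sum_(i < N | bulk_site i) part i eta =
      (\sum_(i < N | bulk_site i) ((~~ allfilled eta i.+2 (i.+2 + r))%:R * (c eta i - A))) * g eta ^+ 2.
    by rewrite mulr_suml; apply: eq_bigr => i _; rewrite /part mulrA.
  rewrite -mulrBl -mulrDl ler_wpM2r ?sqr_ge0// /total_rate [leRHS](bigID (@bulk_site N))/=.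
  have : 0 <= \sum_(i < N | ~~ bulk_site i) c eta i by apply: sumr_ge0 => i _; exact: rate_ge0.
  have : \sum_(i < N | bulk_site i) A +
    \sum_(i < N | bulk_site i) ((~~ allfilled eta i.+2 (i.+2 + r))%:R * (c eta i - A)) <=
    \sum_(i < N | bulk_site i) c eta i + (\sum_(i < N) allfilled eta i.+2 (i.+2 + r))%:R.
    rewrite -big_split /=.
    apply: (@le_trans _ _ (\sum_(i < N | bulk_site i) (c eta i + (allfilled eta i.+2 (i.+2 + r))%:R))).
      apply: ler_sum => i _; have := rate_ge0 m hrho eta i.
      by case: allfilled => /=; lra.
    rewrite big_split /= lerD2l natr_sum big_mkcond; apply: ler_sum => i _.
    by case: ifP.
  lra.
apply: le_trans (ler_mean hrho pt).
rewrite meanD meanB meanZ mean_sum mulrBl -!addrA.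
have h : - (4 * e * N%:R * mean rho (fun eta => g eta ^+ 2) +
      equilibrium_const e r * kcm_dirichlet m rho g) <=
    \sum_(i < N | bulk_site i) mean rho (part i).
  rewrite lerNl; apply: le_trans (sum_local_equilibrium g r e0).
  rewrite -sumrN; apply: ler_sum => i ii; apply: le_trans (ler_norm _) _; rewrite normrN.
  exact: local_equilibrium_site.
by move: h; lra.
Qed.

End local_equilibrium.

(** * Localization *)

Section localization.
Context {R : realType}.
Variables (m : kcm) (rho : R).
Hypothesis hrho : 0 < rho < 1.
Variable N : nat.
Implicit Types (f g : config N -> R) (eta xi zeta : config N).

Local Notation c := (@rate R m rho N).

Section quadratic_partition.
Variables (K : finType) (chi : K -> config N -> R).
Hypothesis chi1 : forall eta, \sum_k chi k eta ^+ 2 = 1.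

Let Z (i : 'I_N) eta := \sum_k (chi k (flip eta i) - chi k eta) ^+ 2.

(* IMS localization: expanding the squares, the cross terms [f eta * f (flip eta i)] are only
   multiplied by the squared increments of the partition of unity. *)
Lemma kcm_dirichlet_localize f (b : R) :
  (forall eta, \sum_(i < N) c eta i * Z i eta <= b) ->
  \sum_k kcm_dirichlet m rho (fun eta => chi k eta * f eta) <=
  kcm_dirichlet m rho f + 2^-1 * b * mean rho (fun eta => f eta ^+ 2).
Proof.
move=> Zb.
have split_i i eta : \sum_k c eta i * (chi k (flip eta i) * f (flip eta i) - chi k eta * f eta) ^+ 2 =
   c eta i * (f (flip eta i) - f eta) ^+ 2 + c eta i * (f eta * f (flip eta i) * Z i eta).
  rewrite -mulr_sumr -mulrDr; congr (_ * _).
  have ZE : Z i eta = 2 - 2 * \sum_k chi k (flip eta i) * chi k eta.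
    transitivity (\sum_k (chi k (flip eta i) ^+ 2 + chi k eta ^+ 2 -
      2 * (chi k (flip eta i) * chi k eta))); first by apply: eq_bigr => k _; ring.
    by rewrite sumrB big_split /= !chi1 -mulr_sumr; ring.
  transitivity (\sum_k (f (flip eta i) ^+ 2 * chi k (flip eta i) ^+ 2 + f eta ^+ 2 * chi k eta ^+ 2 -
      2 * (f eta * f (flip eta i)) * (chi k (flip eta i) * chi k eta))).
    by apply: eq_bigr => k _; ring.
  by rewrite sumrB big_split /= -!mulr_sumr !chi1 ZE; ring.
rewrite /kcm_dirichlet -mulr_sumr -mulrA -mulrDr ler_wpM2l ?invr_ge0//.
rewrite exchange_big /=.
have -> : \sum_(i < N) \sum_k mean rho (fun eta =>
      c eta i * (chi k (flip eta i) * f (flip eta i) - chi k eta * f eta) ^+ 2) =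
    \sum_(i < N) mean rho (fun eta => c eta i * (f (flip eta i) - f eta) ^+ 2) +
    \sum_(i < N) mean rho (fun eta => c eta i * (f eta * f (flip eta i) * Z i eta)).
  rewrite -big_split; apply: eq_bigr => i _ /=.
  by rewrite -mean_sum -meanD; apply: eq_mean => eta; rewrite split_i.
rewrite lerD2l.
apply: (@le_trans _ _ (\sum_(i < N) mean rho (fun eta => c eta i * (f eta ^+ 2 * Z i eta)))).
  apply: ler_sum => i _.
  have symZ : mean rho (fun eta => c eta i * (f (flip eta i) ^+ 2 * Z i eta)) =
      mean rho (fun eta => c eta i * (f eta ^+ 2 * Z i eta)).
    rewrite -(mean_rate_flip m rho i (fun eta => f eta ^+ 2 * Z i eta)).
    apply: eq_mean => eta; congr (_ * (_ * _)); apply: eq_bigr => k _.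
    by rewrite flipK -sqrrN opprB.
  suff : 2 * mean rho (fun eta => c eta i * (f eta * f (flip eta i) * Z i eta)) <=
      mean rho (fun eta => c eta i * (f (flip eta i) ^+ 2 * Z i eta)) +
      mean rho (fun eta => c eta i * (f eta ^+ 2 * Z i eta)) by rewrite symZ; lra.
  rewrite -meanD -meanZ; apply: ler_mean => // eta.
  have c0 := rate_ge0 m hrho eta i.
  have Z0 : 0 <= Z i eta by apply: sumr_ge0 => k _; exact: sqr_ge0.
  rewrite -subr_ge0 [leRHS](_ : _ = c eta i * (Z i eta * (f eta - f (flip eta i)) ^+ 2)).
    exact: mulr_ge0 c0 (mulr_ge0 Z0 (sqr_ge0 _)).
  by ring.
rewrite -mean_sum -meanZ; apply: ler_mean => // eta.
rewrite (eq_bigr (fun i => f eta ^+ 2 * (c eta i * Z i eta))); last by move=> i _; ring.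
by rewrite -mulr_sumr mulrC ler_wpM2r ?sqr_ge0.
Qed.

Lemma tilted_form_localize f (lambda b : R) : lambda <= 0 -> 0 <= b ->
  (forall eta, \sum_(i < N) c eta i * Z i eta <= b) ->
  tilted_form m rho lambda f <=
  \sum_k tilted_form m rho lambda (fun eta => chi k eta * f eta) +
  2^-1 * b * mean rho (fun eta => f eta ^+ 2).
Proof.
move=> l0 b0 Zb; rewrite tilted_formE// (eq_bigr _ (fun k _ => tilted_formE m rho lambda _)).
rewrite sumrB -[X in _ <= X - _ + _]mulr_sumr -[X in _ <= _ - X + _]mulr_sumr.
have -> : \sum_k mean rho (fun eta => total_rate m rho eta * (chi k eta * f eta) ^+ 2) =
    mean rho (fun eta => total_rate m rho eta * f eta ^+ 2).
  rewrite -mean_sum; apply: eq_mean => eta.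
  rewrite -mulr_sumr; congr (_ * _).
  by under eq_bigr do rewrite exprMn; rewrite -mulr_suml chi1 mul1r.
have e1 : expR lambda <= 1 by rewrite expR_le1.
have := kcm_dirichlet_localize f Zb.
have f0 : 0 <= mean rho (fun eta => f eta ^+ 2) by apply: mean_ge0 => // eta; exact: sqr_ge0.
move=> /(ler_wpM2l (expR_ge0 lambda)); rewrite mulrDr.
have : expR lambda * (2^-1 * b * mean rho (fun eta => f eta ^+ 2)) <=
    1 * (2^-1 * b * mean rho (fun eta => f eta ^+ 2)).
  by rewrite ler_wpM2r// !mulr_ge0// invr_ge0.
lra.
Qed.

End quadratic_partition.

Lemma constraint_neq0 eta (i : 'I_N) : constraint m eta i != 0 :> R ->
  ~~ [&& (0 < i)%N, filled eta i.-1 & filled eta i.+1].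
Proof.
apply: contraNN => /and3P[i0 f1 f2]; apply/eqP; rewrite /constraint !occS f2.
have -> : occ m eta i.+1.-1 = filled eta i.-1 by rewrite -[in LHS](prednK i0).
by rewrite f1; case: m; rewrite ?mulr1 subrr.
Qed.

Variable r0 : nat.

(** [s < k] excludes windows that truncated subtraction would cut at the left end; those sticking
    out on the right are never filled. *)
Definition window_filled (k s : nat) eta : bool :=
  (s < k)%N && allfilled eta (k - s.+1) (k + s.+2).

(** The windows are nested, so this is the radius, capped at [r0], of the largest filled window
    centred at [k]. *)
Definition depth (k : nat) eta : nat := \sum_(s < r0) window_filled k s eta.

(* A legal flip has an empty neighbour, so it can only take place at an end of a filled window. *)
Lemma depth_flip_near eta (i : 'I_N) k : constraint m eta i != 0 :> R ->
  (((depth k (flip eta i))%:R - (depth k eta)%:R) ^+ 2 : R) <= (k - r0 <= i < k + r0.+1)%N%:R.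
Proof.
move=> legal.
have legal' : constraint m (flip eta i) i != 0 :> R by rewrite constraint_flip.
have inside zeta s : constraint m zeta i != 0 :> R -> (k - s.+1 < i < k + s.+1)%N ->
    window_filled k s zeta = false.
  move=> /constraint_neq0 nc ki; apply: contraNF nc => /andP[sk /allfilledP full].
  by rewrite !full; lia.
have outside s : ~~ (k - s.+1 <= i < k + s.+2)%N ->
    window_filled k s (flip eta i) = window_filled k s eta.
  move=> out; rewrite /window_filled; congr (_ && _).
  apply: eq_in_all => x; rewrite mem_index_iota => xi.
  by apply: (@occ_flip m _ eta i x.+1); apply: contra out; rewrite eqSS => /eqP <-.
have same s : ~~ ((s < k)%N && ((i == k - s.+1 :> nat) || (i == k + s.+1 :> nat))%N) ->
    window_filled k s (flip eta i) = window_filled k s eta.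
  move=> edge; have [sk|ks] := ltnP s k; last by rewrite /window_filled ltnNge ks.
  have [out|/negPn inn] := boolP (~~ (k - s.+1 <= i < k + s.+2)%N); first exact: outside.
  by rewrite !inside//; lia.
rewrite /depth !natr_sum -sumrB.
(* For [i != k], the only index whose window has [i] as an end: its radius [s0.+1] is the distance
   from [i] to [k]. *)
pose s0 := ((k - i) + (i - k)).-1.
have [s0r|rs0] := ltnP s0 r0; last first.
  rewrite big1 ?expr0n//= => s _; rewrite same ?subrr//.
  by move: rs0; have := ltn_ord s; rewrite /s0; lia.
rewrite (bigD1 (Ordinal s0r))//= big1 ?addr0; last first.
  move=> s; rewrite -val_eqE /= => ss0; rewrite same ?subrr//.
  by move: ss0; rewrite /s0; lia.
have [near|far] := boolP (k - r0 <= i < k + r0.+1)%N.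
  by do 2 case: window_filled; rewrite /= ?subrr ?subr0 ?sub0r ?sqrrN ?expr1n ?expr0n ?lexx ?ler01.
by rewrite same ?subrr ?expr0n//; move: far s0r; rewrite /s0; lia.
Qed.


Lemma sum_shift_le (a : nat) (G : nat -> nat) : (forall k, (N <= k)%N -> G k = 0%N) ->
  (\sum_(i < N) G (i + a) <= \sum_(k < N) G k)%N.
Proof.
move=> G0; rewrite -(big_mkord xpredT (fun i => G (i + a)%N)) -(big_mkord xpredT G).
have -> : (\sum_(0 <= i < N) G (i + a) = \sum_(a <= k < N + a) G k)%N.
  by rewrite -{2}(add0n a) big_addn addnK.
apply: (@leq_trans (\sum_(0 <= k < N + a) G k)).
  by rewrite (@big_cat_nat _ _ _ a 0 (N + a))//= ?leq_addl// leq_addl.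
rewrite (@big_cat_nat _ _ _ N 0 (N + a))//= ?leq_addr// [X in (_ + X)%N]big1_seq ?addn0//.
by move=> k /andP[_]; rewrite mem_index_iota => /andP[/G0].
Qed.

Lemma depth_ge k eta : (N <= k)%N -> depth k eta = 0%N.
Proof.
by move=> Nk; rewrite /depth big1// => s _; rewrite /window_filled allfilled_gt ?andbF//; lia.
Qed.

(** A full window of length [r0.*2.+1] starting at [i.+2] is centred at [i + r0.+2], where the depth
    reaches its maximum [r0]. *)
Lemma sum_allfilled_depth eta :
  (r0 ^ 2 * \sum_(i < N) allfilled eta i.+2 (i.+2 + r0.*2.+1) <= \sum_(k < N) depth k eta ^ 2)%N.
Proof.
apply: leq_trans (@sum_shift_le r0.+2 (fun k => depth k eta ^ 2)%N _); last first.
  by move=> k kN; rewrite depth_ge.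
rewrite big_distrr /=; apply: leq_sum => i _.
have [full|_] := boolP (allfilled eta i.+2 _); last by rewrite muln0.
rewrite muln1 (_ : depth _ _ = r0)// /depth.
rewrite (eq_bigr (fun=> 1%N)) ?sum1_card ?card_ord// => s _.
rewrite /window_filled (_ : (s < i + r0.+2)%N = true) /=; last by have := ltn_ord s; lia.
rewrite (_ : allfilled _ _ _ = true)//; apply/allfilledP => x xi.
by move/allfilledP: full; apply; have := ltn_ord s; lia.
Qed.

Definition pair_supported (j : nat) f :=
  forall eta, ~~ (filled eta j && filled eta j.+1) -> f eta = 0.

Lemma depth_pair k eta : ~~ (filled eta k && filled eta k.+1) -> depth k eta = 0%N.
Proof.
move=> nf; rewrite /depth big1// => s _; apply/eqP; rewrite eqb0.
apply: contra nf => /andP[sk /allfilledP full].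
by rewrite !full//; lia.
Qed.

Variable delta : R.
Hypotheses (N_gt0 : (0 < N)%N) (r0_gt0 : (0 < r0)%N) (delta_gt0 : 0 < delta).

(** The partition is the direction of the vector [v]. Component 0 dominates where few sites have a
    large depth; component [k.+1] vanishes unless [k] is the centre of a filled window. *)
Let v (k : nat) eta : R := if k is k'.+1 then delta * (depth k' eta)%:R else Num.sqrt N%:R.
Let V eta : R := \sum_(k < N.+1) v k eta ^+ 2.
Let chi (k : 'I_N.+1) eta := v k eta / Num.sqrt (V eta).

Let NR_gt0 : 0 < N%:R :> R. Proof. by rewrite ltr0n. Qed.

Let VE eta : V eta = N%:R + delta ^+ 2 * (\sum_(k < N) depth k eta ^ 2)%N%:R.
Proof.
rewrite /V big_ord_recl /= sqr_sqrtr ?ler0n//; congr (_ + _).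
by rewrite natr_sum mulr_sumr; apply: eq_bigr => k _; rewrite natrX exprMn.
Qed.

Let V_ge eta : N%:R <= V eta.
Proof. by rewrite VE lerDl mulr_ge0 ?sqr_ge0. Qed.

Let V_gt0 eta : 0 < V eta. Proof. exact: lt_le_trans (V_ge eta). Qed.

Let sqrtV_gt0 eta : 0 < Num.sqrt (V eta). Proof. by rewrite sqrtr_gt0. Qed.

Let chi1 eta : \sum_k chi k eta ^+ 2 = 1.
Proof.
under eq_bigr do rewrite expr_div_n sqr_sqrtr ?(ltW (V_gt0 eta))//.
by rewrite -mulr_suml -/(V eta) divff// gt_eqF.
Qed.

(** The squared distance between v / |v| and v' / |v'| is at most |v - v'|^2 / (|v| |v'|), and both
    norms are at least sqrt N. *)
Let chi_diff eta zeta : \sum_k (chi k zeta - chi k eta) ^+ 2 <=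
  delta ^+ 2 / N%:R * \sum_(k < N) ((depth k zeta)%:R - (depth k eta)%:R) ^+ 2.
Proof.
set n := Num.sqrt (V eta); set n' := Num.sqrt (V zeta).
have n0 : 0 < n by exact: sqrtV_gt0.
have n'0 : 0 < n' by exact: sqrtV_gt0.
have nE : n ^+ 2 = V eta by rewrite sqr_sqrtr// ltW.
have n'E : n' ^+ 2 = V zeta by rewrite sqr_sqrtr// ltW.
have nn : N%:R <= n * n'.
  rewrite -ler_sqr ?nnegrE ?mulr_ge0 ?(ltW n0) ?(ltW n'0)// exprMn nE n'E expr2.
  by rewrite ler_pM.
set B := \sum_(k < N) _.
have B0 : 0 <= B by apply: sumr_ge0 => k _; exact: sqr_ge0.
pose ip := \sum_(k < N.+1) v k eta * v k zeta.
have dv : delta ^+ 2 * B = n ^+ 2 + n' ^+ 2 - 2 * ip.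
  transitivity (\sum_(k < N.+1) (v k zeta - v k eta) ^+ 2).
    rewrite big_ord_recl /= subrr expr0n add0r /B mulr_sumr.
    by apply: eq_bigr => k _; ring.
  rewrite nE n'E /V /ip mulr_sumr -big_split -sumrB /=.
  by apply: eq_bigr => k _; ring.
have -> : \sum_k (chi k zeta - chi k eta) ^+ 2 = 2 - 2 * (ip / (n * n')).
  transitivity (\sum_k (chi k zeta ^+ 2 + chi k eta ^+ 2 -
      2 / (n * n') * (v k eta * v k zeta))).
    by apply: eq_bigr => k _; rewrite /chi -/n -/n'; field; rewrite !gt_eqF.
  by rewrite sumrB big_split /= !chi1 -mulr_sumr -/ip; field; rewrite !gt_eqF.
apply: (@le_trans _ _ (delta ^+ 2 * B / (n * n'))).
  rewrite dv -subr_ge0 (_ : _ - _ = (n - n') ^+ 2 / (n * n')); last by field; rewrite !gt_eqF.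
  by rewrite divr_ge0 ?sqr_ge0// mulr_ge0// ltW.
rewrite [leRHS]mulrAC; apply: ler_wpM2l; first exact: mulr_ge0 (sqr_ge0 _) B0.
by rewrite lef_pV2 ?posrE// mulr_gt0.
Qed.

(** At most N(2 r0 + 1) pairs of a flipped site and a changed depth occur, and N cancels the 1 / N
    of [chi_diff]. *)
Let chi_energy eta :
  \sum_(i < N) c eta i * \sum_k (chi k (flip eta i) - chi k eta) ^+ 2 <=
  delta ^+ 2 * (r0.*2.+1)%:R.
Proof.
apply: (@le_trans _ _ (\sum_(i < N) delta ^+ 2 / N%:R *
   \sum_(k < N) (k - r0 <= i < k + r0.+1)%N%:R)).
  apply: ler_sum => i _.
  have rhs0 : 0 <= delta ^+ 2 / N%:R * \sum_(k < N) (k - r0 <= i < k + r0.+1)%N%:R.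
    by rewrite mulr_ge0 ?divr_ge0 ?sqr_ge0// sumr_ge0.
  have [c0|legal] := eqVneq (constraint m eta i : R) 0.
    by rewrite /rate c0 !mul0r.
  apply: (@le_trans _ _ (1 * \sum_k (chi k (flip eta i) - chi k eta) ^+ 2)).
    by rewrite ler_wpM2r ?rate_le1// sumr_ge0// => k _; exact: sqr_ge0.
  rewrite mul1r; apply: le_trans (chi_diff _ _) _.
  rewrite ler_wpM2l ?divr_ge0 ?sqr_ge0//; apply: ler_sum => k _.
  exact: depth_flip_near.
rewrite -mulr_sumr exchange_big /=.
apply: (@le_trans _ _ (delta ^+ 2 / N%:R * \sum_(k < N) (r0.*2.+1)%:R)).
  rewrite ler_wpM2l ?divr_ge0 ?sqr_ge0//; apply: ler_sum => k _.
  by rewrite -natr_sum sum_window ler_nat; lia.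
rewrite sumr_const card_ord -[X in _ * X]mulr_natl mulrA divfK//.
by rewrite gt_eqF.
Qed.

(** The witness is component 0 times [f]. Every other component is supported on an occupied pair and
    costs at least [Sig], its rate term being nonpositive for [lambda <= 0]. On the witness, chi_0^2
    = N / V, and V controls the number of full windows through the squared depths. *)
Lemma tilted_form_localize_pair f (lambda Sig : R) : lambda <= 0 -> 0 <= Sig ->
  (forall j g, pair_supported j g ->
    Sig * mean rho (fun eta => g eta ^+ 2) <= kcm_dirichlet m rho g) ->
  exists g, [/\ mean rho (fun eta => g eta ^+ 2) <= mean rho (fun eta => f eta ^+ 2),
    tilted_form m rho lambda f <= tilted_form m rho lambda g -
      expR lambda * Sig * (mean rho (fun eta => f eta ^+ 2) - mean rho (fun eta => g eta ^+ 2)) +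
      2^-1 * (delta ^+ 2 * (r0.*2.+1)%:R) * mean rho (fun eta => f eta ^+ 2) &
    mean rho (fun eta => (\sum_(i < N) allfilled eta i.+2 (i.+2 + r0.*2.+1))%:R * g eta ^+ 2) <=
      N%:R / (delta ^+ 2 * r0%:R ^+ 2) * mean rho (fun eta => f eta ^+ 2)].
Proof.
move=> l0 Sig0 hSig.
pose g eta := chi ord0 eta * f eta.
have sq_split : mean rho (fun eta => f eta ^+ 2) =
    mean rho (fun eta => g eta ^+ 2) +
    \sum_(k < N) mean rho (fun eta => (chi (lift ord0 k) eta * f eta) ^+ 2).
  rewrite -mean_sum -meanD; apply: eq_mean => eta.
  rewrite -[LHS]mul1r -(chi1 eta) big_ord_recl mulrDl; congr (_ + _); first by rewrite -exprMn.
  by rewrite mulr_suml; apply: eq_bigr => k _; rewrite -exprMn.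
have sum0 : 0 <= \sum_(k < N) mean rho (fun eta => (chi (lift ord0 k) eta * f eta) ^+ 2).
  by apply: sumr_ge0 => k _; apply: mean_ge0 => // eta; exact: sqr_ge0.
exists g; split; first by rewrite sq_split lerDl.
- have b0 : 0 <= delta ^+ 2 * (r0.*2.+1)%:R by rewrite mulr_ge0 ?sqr_ge0.
  apply: le_trans (tilted_form_localize chi1 f l0 b0 chi_energy) _.
  rewrite lerD2r big_ord_recl lerD2l sq_split addrAC subrr add0r mulr_sumr -sumrN.
  apply: ler_sum => k _; rewrite tilted_formE.
  set h := (fun eta => chi (lift ord0 k) eta * f eta).
  have hk : pair_supported k h.
    move=> eta nf; rewrite /h /chi /v /= /bump /= add0n.
    by rewrite depth_pair// mulr0 !mul0r.
  have h1 : (expR lambda - 1) * mean rho (fun eta => total_rate m rho eta * h eta ^+ 2) <= 0.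
    rewrite mulr_le0_ge0 ?subr_le0 ?expR_le1//; apply: mean_ge0 => // eta.
    by rewrite mulr_ge0 ?sqr_ge0// sumr_ge0// => i _; exact: rate_ge0.
  have h2 := ler_wpM2l (expR_ge0 lambda) (hSig _ _ hk).
  by move: h1 h2; rewrite mulrA; lra.
rewrite -meanZ; apply: ler_mean => // eta.
rewrite /g exprMn mulrA ler_wpM2r ?sqr_ge0//.
rewrite /chi /= expr_div_n !sqr_sqrtr ?ler0n ?(ltW (V_gt0 eta))//.
rewrite mulrCA ler_wpM2l ?ler0n// ler_pdivrMr// mulrC ler_pdivlMr; last first.
  by rewrite mulr_gt0// exprn_gt0// ltr0n.
rewrite VE mulrC -mulrA -natrX -natrM.
apply: (@le_trans _ _ (delta ^+ 2 * (\sum_(k < N) depth k eta ^ 2)%N%:R)); last by rewrite lerDr.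
by rewrite ler_wpM2l ?sqr_ge0// ler_nat sum_allfilled_depth.
Qed.

End localization.

(** * Inserting occupied sites *)

Section insertion.
Context {R : realType}.
Variables (m : kcm) (rho : R).

Section one_site.
Variables (n : nat) (p : 'I_n.+1).
Implicit Types (eta : config n) (f : config n -> R).

Definition insert_filled eta : config n.+1 :=
  [ffun j => if unlift p j is Some k then eta k else true].

Definition delete_site (zeta : config n.+1) : config n := [ffun j => zeta (lift p j)].

Definition extend_filled f (zeta : config n.+1) : R := (zeta p)%:R * f (delete_site zeta).

Lemma insert_filledK : cancel insert_filled delete_site.
Proof. by move=> eta; apply/ffunP => j; rewrite !ffunE liftK. Qed.

Lemma insert_filled_at eta : insert_filled eta p.
Proof. by rewrite ffunE unlift_none. Qed.

Lemma insert_filled_lift eta j : insert_filled eta (lift p j) = eta j.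
Proof. by rewrite ffunE liftK. Qed.

Lemma delete_siteK (zeta : config n.+1) : zeta p -> insert_filled (delete_site zeta) = zeta.
Proof.
move=> zp; apply/ffunP => j; rewrite ffunE; case: unliftP => [k ->|->]; last by rewrite zp.
by rewrite ffunE.
Qed.

Lemma extend_filled_insert f eta : extend_filled f (insert_filled eta) = f eta.
Proof. by rewrite /extend_filled insert_filled_at mul1r insert_filledK. Qed.

Lemma extend_filled_flip f eta j :
  extend_filled f (flip (insert_filled eta) (lift p j)) = f (flip eta j).
Proof.
rewrite /extend_filled ffunE (negbTE (neq_lift p j)) insert_filled_at mul1r; congr f.
apply/ffunP => k; rewrite !ffunE liftK (inj_eq (@lift_inj _ p)).
by case: eqP.
Qed.

Lemma mean_extend (F : config n.+1 -> R) : (forall zeta : config n.+1, ~~ zeta p -> F zeta = 0) ->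
  mean rho F = rho * mean rho (fun eta => F (insert_filled eta)).
Proof.
move=> F0; rewrite /mean (bigID (fun zeta : config n.+1 => zeta p))/= [X in _ + X]big1 ?addr0; last first.
  by move=> zeta /F0 ->; rewrite mulr0.
rewrite (reindex_onto insert_filled delete_site); last by move=> zeta; exact: delete_siteK.
rewrite mulr_sumr; apply: eq_big => [eta|eta _].
  by rewrite insert_filled_at insert_filledK eqxx.
rewrite mulrA; congr (_ * _).
rewrite /bernoulli_weight (bigD1_ord p)//= insert_filled_at; congr (_ * _).
by apply: eq_bigr => j _; rewrite insert_filled_lift.
Qed.

Lemma filled_insert eta x : filled (insert_filled eta) x =
  if (x < p)%N then filled eta x else if (x == p)%N then true else filled eta x.-1.
Proof.
have [xn|nx] := ltnP x n.+1; last first.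
  rewrite filled_ge//; case: ltnP => xp; first by have := ltn_ord p; lia.
  by case: eqP => [e|_]; [have := ltn_ord p; lia|rewrite filled_ge//; lia].
rewrite -[x in LHS]/(nat_of_ord (Ordinal xn)) filled_ord.
case: (unliftP p (Ordinal xn)) => [j jE|pE].
  rewrite jE insert_filled_lift -filled_ord.
  have xE : x = bump p j by move/(congr1 val): jE.
  rewrite xE /bump; case: (leqP p j) => pj /=.
    rewrite add1n (_ : (j.+1 < p)%N = false); last by lia.
    by rewrite (_ : (j.+1 == p :> nat) = false)//; lia.
  by rewrite add0n pj.
by rewrite pE insert_filled_at -(congr1 val pE) /= ltnn eqxx.
Qed.

End one_site.

(** The new site goes between [i] and [i.+1], both occupied on the support of [f]. It is blocked for
    East and FA-1f alike, its neighbours still see an occupied site on that side, and the norm and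
    the form both acquire the factor [rho], its own weight. *)
Lemma extend_filledP n (i : nat) (f : config n -> R) : (i.+1 < n)%N -> pair_supported i f ->
  exists g : config n.+1 -> R, [/\ pair_supported i g,
    mean rho (fun eta => g eta ^+ 2) = rho * mean rho (fun eta => f eta ^+ 2) &
    forall lambda, tilted_form m rho lambda g = rho * tilted_form m rho lambda f].
Proof.
move=> i1n supp.
have i1n' : (i.+1 < n.+1)%N by lia.
pose p : 'I_n.+1 := Ordinal i1n'.
have supp' (eta : config n) : f eta != 0 -> filled eta i /\ filled eta i.+1.
  by move=> f0; apply/andP; apply: contraNT f0 => /supp ->.
exists (extend_filled p f); split.
- move=> zeta nf; have [zp|nzp] := boolP (zeta p); last by rewrite /extend_filled (negbTE nzp) mul0r.
  rewrite /extend_filled (supp (delete_site p zeta)) ?mulr0//.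
  apply: contra nf => /andP[fi fi1].
  have := delete_siteK zp => <-; rewrite !filled_insert /= ltnSn fi ltnn eqxx//.
- rewrite (mean_extend (p := p)); last first.
    by move=> zeta /negbTE zp; rewrite /extend_filled zp mul0r expr0n.
  by congr (_ * _); apply: eq_mean => eta; rewrite extend_filled_insert.
move=> lambda; rewrite /tilted_form (mean_extend (p := p)); last first.
  by move=> zeta /negbTE zp; rewrite {1}/extend_filled zp !mul0r.
congr (_ * _); apply: eq_mean => eta; rewrite extend_filled_insert.
have [->|f0] := eqVneq (f eta) 0; first by rewrite !mul0r.
have [fi fi1] := supp' _ f0.
congr (_ * _); rewrite (bigD1_ord p)//=.
have -> : rate m rho (insert_filled p eta) p = 0.
  rewrite /rate (_ : constraint _ _ _ = 0) ?mul0r//.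
  apply: contraTeq isT => /constraint_neq0 /=.
  rewrite !filled_insert /= ltnSn fi ltnNge leqnSn/= (_ : (i.+2 == i.+1) = false); last by lia.
  by rewrite fi1.
rewrite mul0r add0r; apply: eq_bigr => j _.
rewrite extend_filled_flip; congr (_ * _).
rewrite /rate insert_filled_lift; congr (_ * _).
have hr : filled (insert_filled p eta) (lift p j).+1 = filled eta j.+1.
  rewrite filled_insert /= /bump; case: (leqP i.+1 j) => ij /=.
    rewrite add1n (_ : (j.+2 < i.+1)%N = false); last by lia.
    by rewrite (_ : (j.+2 == i.+1) = false)//; lia.
  rewrite add0n; have [ji|ji] := ltnP j.+1 i.+1 => //.
  have e : j.+1 = i.+1 by lia.
  by rewrite e eqxx fi1.
have hl : occ m (insert_filled p eta) (lift p j).+1.-1 = occ m eta j.+1.-1.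
  have [ij|ij] := leqP i.+1 j.
    have -> : lift p j = j.+1 :> nat by rewrite /= /bump ij.
    rewrite -[LHS]/(occ m (insert_filled p eta) j.+1) -[RHS]/(occ m eta j).
    case: (nat_of_ord j) ij => [//|k] ij.
    rewrite !occS filled_insert (_ : (k.+1 < p)%N = false); last by move=> /=; lia.
    by have [[->]|//] := eqVneq k.+1 (p : nat); rewrite fi.
  have -> : lift p j = j :> nat by rewrite /= /bump leqNgt ij.
  rewrite -[LHS]/(occ m (insert_filled p eta) j) -[RHS]/(occ m eta j).
  case: (nat_of_ord j) ij => [//|k] ij.
  by rewrite !occS filled_insert (_ : (k < p)%N = true)//=; lia.
by rewrite /constraint hl !occS hr.
Qed.

Lemma extend_filled_iter n (i N : nat) (f : config n -> R) : 0 < rho -> (i.+1 < n)%N ->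
  pair_supported i f -> 0 < mean rho (fun eta => f eta ^+ 2) -> (n <= N)%N ->
  exists g : config N -> R, 0 < mean rho (fun eta => g eta ^+ 2) /\
    forall lambda, tilted_form m rho lambda g * mean rho (fun eta => f eta ^+ 2) =
      tilted_form m rho lambda f * mean rho (fun eta => g eta ^+ 2).
Proof.
move=> r0 i1n supp f0 nN; rewrite -(subnKC nN).
suff [g [_ g0 gE]] : exists g : config (n + (N - n)) -> R, [/\ pair_supported i g,
    0 < mean rho (fun eta => g eta ^+ 2) &
    forall lambda, tilted_form m rho lambda g * mean rho (fun eta => f eta ^+ 2) =
      tilted_form m rho lambda f * mean rho (fun eta => g eta ^+ 2)] by exists g.
elim: (N - n)%N => [|k [g [gs g0 gE]]]; first by rewrite addn0; exists f.
rewrite addnS; have [|h [hs h0 hE]] := @extend_filledP (n + k) i g _ gs; first by lia.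
exists h; split => //; first by rewrite h0 mulr_gt0.
by move=> lambda; rewrite hE h0 -mulrA gE; ring.
Qed.

End insertion.

(** * The scaling limit *)

Section variational.
Context {R : realType}.
Variables (m : kcm) (rho : R).
Hypothesis hrho : 0 < rho < 1.

Local Notation A := (@mean_activity R m rho).
Local Notation norm2 f := (mean rho (fun eta => f eta ^+ 2)).

Let norm2_ge0 N (f : config N -> R) : 0 <= norm2 f.
Proof. by apply: mean_ge0 => // eta; exact: sqr_ge0. Qed.

Definition surface_costs : set R := [set x | exists n i (f : config n -> R),
  [/\ pair_supported i f, 0 < norm2 f & x = kcm_dirichlet m rho f / norm2 f]].

Definition surface_cost : R := inf surface_costs.

Let pair_in_range n i (f : config n -> R) : pair_supported i f -> 0 < norm2 f -> (i.+1 < n)%N.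
Proof.
move=> supp; apply: contraTT => nin; rewrite -leNgt /mean big1// => eta _.
rewrite supp ?expr0n ?mulr0//.
by rewrite [filled eta i.+1]filled_ge ?andbF//; lia.
Qed.

Let surface_costs_lb : exists2 s, 0 < s & lbound surface_costs s.
Proof.
have [s s0 hs] := east_killing_gap hrho.
exists s => // x [n [i [f [supp f0 ->]]]].
have i1n := pair_in_range supp f0.
have i_n : (i < n)%N by lia.
rewrite ler_pdivlMr//; apply: le_trans (east_dirichlet_le m hrho f).
apply: (hs n (Ordinal i_n)) => eta ne; apply: supp.
have -> : filled eta i = eta (Ordinal i_n) by rewrite -filled_ord.
by rewrite (negbTE ne).
Qed.

(** Two sites suffice; on an empty set [inf] would be a default value. *)
Let surface_costs_nonempty : surface_costs !=set0.
Proof.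
pose f (eta : config 2) : R := (filled eta 0 && filled eta 1)%:R.
exists (kcm_dirichlet m rho f / norm2 f), 2%N, 0%N, f; split=> //.
  by move=> eta /negbTE nf; rewrite /f nf.
pose e : config 2 := [ffun=> true].
have fe : f e = 1.
  have fE (j : 'I_2) : filled e j by rewrite filled_ord ffunE.
  by rewrite /f (fE ord0) (fE ord_max).
rewrite /mean (bigD1 e)//= fe expr1n mulr1 ltr_pwDl ?bernoulli_weight_gt0//.
by apply: sumr_ge0 => eta _; rewrite mulr_ge0 ?sqr_ge0// ltW// bernoulli_weight_gt0.
Qed.

Let has_inf_surface : has_inf surface_costs.
Proof. by split => //; have [s _ h] := surface_costs_lb; exists s. Qed.

Lemma surface_cost_gt0 : 0 < surface_cost.
Proof.
have [s s0 h] := surface_costs_lb.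
by apply: lt_le_trans s0 _; apply: lb_le_inf.
Qed.

Lemma surface_cost_le N j (g : config N -> R) : pair_supported j g ->
  surface_cost * norm2 g <= kcm_dirichlet m rho g.
Proof.
move=> supp; have [g0|g0] := leP (norm2 g) 0.
  have -> : norm2 g = 0 by apply/eqP; rewrite eq_le g0 norm2_ge0.
  by rewrite mulr0 kcm_dirichlet_ge0.
rewrite -ler_pdivlMr//; apply: inf_lbound; first by case: has_inf_surface.
by exists N, j, g.
Qed.

Section scaling.
Variable alpha : R.

Let lam (N : nat) : R := alpha / N%:R.
(** The total rate is of order [N], so this is the effective coefficient of the mean rate per site;
    it tends to [alpha]. *)
Let u (N : nat) : R := N%:R * (expR (lam N) - 1).

Let cvg_lam : lam N @[N --> \oo] --> (0 : R).
Proof.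
rewrite -(mulr0 alpha); apply: cvgM; first exact: cvg_cst.
have h : (n.+1%:R^-1 : R) @[n --> \oo] --> (0 : R) by exact: cvg_harmonic.
by rewrite -cvg_shiftS.
Qed.

Let cvg_expR_lam : expR (lam N) @[N --> \oo] --> (1 : R).
Proof. by rewrite -(expR0 R); apply: continuous_cvg; [exact: continuous_expR|exact: cvg_lam]. Qed.

Let u_bounds N : (0 < N)%N -> alpha <= u N <= alpha * expR (lam N).
Proof.
move=> N0; have NR : 0 < N%:R :> R by rewrite ltr0n.
have aE : alpha = N%:R * lam N by rewrite /lam mulrC divfK// gt_eqF.
rewrite {1 2}aE /u -mulrA !ler_pM2l//.
have h1 := expR_ge1Dx (lam N); have h2 := expR_ge1Dx (- lam N).
apply/andP; split; first by lra.
have : (1 - lam N) * expR (lam N) <= 1.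
  by rewrite -[leRHS](expR0 R) -(addNr (lam N)) expRD ler_wpM2r ?expR_ge0.
lra.
Qed.

Let cvg_u : u N @[N --> \oo] --> alpha.
Proof.
apply: (@squeeze_cvgr _ _ _ _ (fun=> alpha) (fun N => alpha * expR (lam N))).
- by near=> N; apply: u_bounds; near: N; exact: nbhs_infty_gt.
- exact: cvg_cst.
- by rewrite -[X in _ --> X]mulr1; apply: cvgM; [exact: cvg_cst|exact: cvg_expR_lam].
Unshelve. all: by end_near.
Qed.

Let cvg_inv : (N%:R^-1 : R) @[N --> \oo] --> (0 : R).
Proof.
have h : (n.+1%:R^-1 : R) @[n --> \oo] --> (0 : R) by exact: cvg_harmonic.
by rewrite -cvg_shiftS.
Qed.

Let lam_factor N : (0 < N)%N -> expR (lam N) - 1 = u N / N%:R.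
Proof. by move=> N0; rewrite /u mulrAC divff ?mul1r// pnatr_eq0 -lt0n. Qed.

Let mean_total_rate_near N : `|mean rho (@total_rate R m rho N) - A * N%:R| <= 2.
Proof.
have [A0 A1] := andP (mean_activity_bounds m hrho).
have -> : A * N%:R = \sum_(i < N) A by rewrite sumr_const card_ord mulr_natr.
rewrite /total_rate mean_sum -sumrB (bigID (@bulk_site N))/= big1 ?add0r; last first.
  by move=> i ii; rewrite mean_rate ?subrr.
apply: le_trans (ler_norm_sum _ _ _) _.
apply: (@le_trans _ _ (\sum_(i < N | ~~ bulk_site i) 1)).
  apply: ler_sum => i _.
  have c0 : 0 <= mean rho (fun eta : config N => rate m rho eta i).
    by apply: mean_ge0 => // eta; exact: rate_ge0.
  have c1 : mean rho (fun eta : config N => rate m rho eta i) <= 1.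
    by rewrite -[leRHS](mean_cst rho N 1); apply: ler_mean => // eta; exact: rate_le1.
  by rewrite ler_norml; lra.
rewrite (_ : \sum_(i < N | _) 1 = (\sum_(i < N | ~~ bulk_site i) 1)%N%:R).
  by rewrite ler_nat boundary_le2.
by rewrite natr_sum.
Qed.

Lemma tilted_form_lower_mean (e : R) : 0 < e -> \forall N \near \oo,
  exists f : config N -> R, 0 < norm2 f /\ (A * alpha - e) * norm2 f <= tilted_form m rho (lam N) f.
Proof.
move=> e0.
have cv : u N * A - 2 * `|u N| * N%:R^-1 @[N --> \oo] --> alpha * A - 2 * `|alpha| * 0.
  apply: cvgB; first by apply: cvgM; [exact: cvg_u|exact: cvg_cst].
  apply: cvgM; last exact: cvg_inv.
  by apply: cvgM; [exact: cvg_cst|apply: cvg_norm; exact: cvg_u].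
have lt : A * alpha - e < alpha * A - 2 * `|alpha| * 0 by lra.
have ev := cvgr_ge _ cv _ lt.
near=> N.
have N0 : (0 < N)%N by near: N; exact: nbhs_infty_gt.
have NR : 0 < N%:R :> R by rewrite ltr0n.
exists (fun=> 1).
have n1 : norm2 (fun _ : config N => 1 : R) = 1.
  by rewrite -[RHS](mean_cst rho N); apply: eq_mean => eta; rewrite expr1n.
rewrite n1; split=> //; rewrite mulr1 tilted_formE.
have -> : kcm_dirichlet m rho (fun _ : config N => 1 : R) = 0.
  rewrite /kcm_dirichlet big1 ?mulr0// => i _.
  by rewrite -[RHS](mean_cst rho N); apply: eq_mean => eta; rewrite subrr expr0n mulr0.
rewrite mulr0 subr0.
have -> : mean rho (fun eta : config N => total_rate m rho eta * 1 ^+ 2) =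
    mean rho (@total_rate R m rho N).
  by apply: eq_mean => eta; rewrite expr1n mulr1.
have hN : A * alpha - e <= u N * A - 2 * `|u N| * N%:R^-1 by near: N; exact: ev.
apply: le_trans hN _; rewrite lam_factor//.
have := mean_total_rate_near N; set H := mean _ _ => hH.
rewrite -subr_ge0.
have -> : u N / N%:R * H - (u N * A - 2 * `|u N| / N%:R) =
    (2 * `|u N| + u N * (H - A * N%:R)) / N%:R by field; rewrite gt_eqF.
rewrite divr_ge0 ?(ltW NR)//.
have : `|u N * (H - A * N%:R)| <= `|u N| * 2 by rewrite normrM ler_wpM2l.
by rewrite ler_norml => /andP[]; lra.
Unshelve. all: by end_near.
Qed.

Lemma tilted_form_lower_surface (e : R) : 0 < e -> \forall N \near \oo,
  exists f : config N -> R, 0 < norm2 f /\ (- surface_cost - e) * norm2 f <= tilted_form m rho (lam N) f.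
Proof.
move=> e0; have e20 : 0 < e / 2 by rewrite divr_gt0.
have [x [n [i [f [supp f0 ->]]]]] := inf_adherent e20 has_inf_surface.
rewrite -/surface_cost => hx.
have i1n := pair_in_range supp f0.
have r0 : 0 < rho by case/andP: hrho.
set D := kcm_dirichlet m rho f in hx *.
have cv : tilted_form m rho (lam N) f / norm2 f @[N --> \oo] --> (0 - D) / norm2 f.
  apply: cvgM; last exact: cvg_cst.
  under eq_fun do rewrite tilted_formE.
  rewrite (_ : 0 - D = (1 - 1) * mean rho (fun eta => total_rate m rho eta * f eta ^+ 2) - 1 * D);
    last by ring.
  apply: cvgB; apply: cvgM; try exact: cvg_cst; try exact: cvg_expR_lam.
  by apply: cvgB; [exact: cvg_expR_lam|exact: cvg_cst].
have lt : - surface_cost - e < (0 - D) / norm2 f by rewrite sub0r mulNr; lra.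
have ev := cvgr_ge _ cv _ lt.
near=> N.
have nN : (n <= N)%N by near: N; exact: nbhs_infty_ge.
have [g [g0 gE]] := extend_filled_iter m r0 i1n supp f0 nN.
exists g; split => //.
have hN : - surface_cost - e <= tilted_form m rho (lam N) f / norm2 f by near: N; exact: ev.
apply: (@le_trans _ _ (tilted_form m rho (lam N) f / norm2 f * norm2 g)).
  by rewrite ler_wpM2r// ltW.
by rewrite mulrAC -gE mulfK// gt_eqF.
Unshelve. all: by end_near.
Qed.

Let tilted_form_upper_nonneg (e : R) : 0 <= alpha -> 0 < e ->
  \forall N \near \oo, forall f : config N -> R,
  tilted_form m rho (lam N) f <= (A * alpha + e) * norm2 f.
Proof.
move=> a0 e0.
(* The window term and the equilibrium term contribute [d] and [4 * d], and [5 * alpha * d < e]. *)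
pose d := e / (16 * (alpha + 1)).
have a1 : 0 < 16 * (alpha + 1) by rewrite mulr_gt0// ltr_wpDl.
have d0 : 0 < d by rewrite divr_gt0.
have [r r0 hr] : exists2 r : nat, (0 < r)%N & 3 / r%:R <= d.
  have : \forall r \near \oo, (0 < r)%N /\ 3 / d < r%:R.
    by near=> r; split; near: r; [exact: nbhs_infty_gt|exact: nbhs_infty_gtr].
  move=> /filter_ex[r [r0 hr]]; exists r => //.
  rewrite ler_pdivrMr ?ltr0n// mulrC -ler_pdivrMr//; exact: ltW.
pose K := equilibrium_const rho d r.
(* Once this product is at most 1, the error [K * D(f)] of the rate bound is absorbed by the
   Dirichlet term of the tilted form. *)
have cv1 : (expR (lam N) - 1) * K @[N --> \oo] --> (1 - 1) * K.
  by apply: cvgM; [apply: cvgB; [exact: cvg_expR_lam|exact: cvg_cst]|exact: cvg_cst].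
have lt1 : (1 - 1) * K < 1 by rewrite subrr mul0r.
have ev1 := cvgr_le _ cv1 _ lt1.
have cv2 : u N * (A + 2 * N%:R^-1 + d + 4 * d) @[N --> \oo] --> alpha * (A + 2 * 0 + d + 4 * d).
  apply: cvgM; first exact: cvg_u.
  apply: cvgD; last exact: cvg_cst.
  apply: cvgD; last exact: cvg_cst.
  apply: cvgD; first exact: cvg_cst.
  by apply: cvgM; [exact: cvg_cst|exact: cvg_inv].
have lt2 : alpha * (A + 2 * 0 + d + 4 * d) < A * alpha + e.
  have : 16 * (alpha + 1) * d = e by rewrite /d mulrC divfK// gt_eqF.
  have : 0 <= alpha * d by rewrite mulr_ge0// ltW.
  lra.
have ev2 := cvgr_le _ cv2 _ lt2.
near=> N => f.
have N0 : (0 < N)%N by near: N; exact: nbhs_infty_gt.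
have NR : 0 < N%:R :> R by rewrite ltr0n.
have h1 : (expR (lam N) - 1) * K <= 1 by near: N; exact: ev1.
have h2 : u N * (A + 2 * N%:R^-1 + d + 4 * d) <= A * alpha + e by near: N; exact: ev2.
rewrite tilted_formE.
have u0 : 0 <= u N by case/andP: (u_bounds N0) => h _; exact: le_trans h.
have x0 : 0 <= expR (lam N) - 1 by rewrite lam_factor// divr_ge0// ltW.
have := mean_total_rate_le m hrho f d0 r0; rewrite -/K.
move=> /(ler_wpM2l x0) hH.
have D0 := kcm_dirichlet_ge0 m hrho f.
have f0 := norm2_ge0 f.
apply: (@le_trans _ _ ((expR (lam N) - 1) *
    ((A * N%:R + 2 + 3 * N%:R / r%:R + 4 * d * N%:R) * norm2 f))).
  move: hH; rewrite mulrDr.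
  have : ((expR (lam N) - 1) * K) * kcm_dirichlet m rho f <= 1 * kcm_dirichlet m rho f.
    by rewrite ler_wpM2r.
  have : 0 <= (expR (lam N) - 1) * kcm_dirichlet m rho f by rewrite mulr_ge0.
  lra.
rewrite mulrA ler_wpM2r//; apply: le_trans h2; rewrite lam_factor//.
have -> : u N / N%:R * (A * N%:R + 2 + 3 * N%:R / r%:R + 4 * d * N%:R) =
    u N * (A + 2 * N%:R^-1 + 3 / r%:R + 4 * d).
  by field; rewrite !gt_eqF// ltr0n.
by rewrite ler_wpM2l//; lra.
Unshelve. all: by end_near.
Qed.

Let tilted_form_upper_neg (e : R) : alpha < 0 -> 0 < e ->
  \forall N \near \oo, forall f : config N -> R,
  tilted_form m rho (lam N) f <= (Num.max (A * alpha) (- surface_cost) + e) * norm2 f.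
Proof.
move=> a0 e0; set M := Num.max _ _.
have Sig0 := surface_cost_gt0.
have [q q0 hq] : exists2 q : nat, (0 < q)%N & (- alpha + 2) * 4 / e <= q%:R.
  have : \forall r \near \oo, (0 < r)%N /\ (- alpha + 2) * 4 / e < r%:R.
    by near=> r; split; near: r; [exact: nbhs_infty_gt|exact: nbhs_infty_gtr].
  by move=> /filter_ex[r [r0 hr]]; exists r => //; exact: ltW.
have qR : 0 < q%:R :> R by rewrite ltr0n.
have q1 : 1 <= q%:R :> R by rewrite ler1n.
(* With these powers, [delta ^+ 2 * r0] and [(delta * r0) ^- 2] are both [q ^- 2]. *)
pose r0 := (q ^ 4)%N; pose delta : R := q%:R ^- 3.
have r0_gt0 : (0 < r0)%N by rewrite expn_gt0 q0.
have delta0 : 0 < delta by rewrite invr_gt0 exprn_gt0.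
pose d := e / (32 * (- alpha + 1)).
have a1 : 0 < 32 * (- alpha + 1) by rewrite mulr_gt0//; lra.
have d0 : 0 < d by rewrite divr_gt0.
have dE : 32 * (- alpha + 1) * d = e by rewrite /d mulrC divfK// gt_eqF.
pose r := r0.*2.+1.
pose K := equilibrium_const rho d r.
have cv1 : expR (lam N) + (expR (lam N) - 1) * K @[N --> \oo] --> 1 + (1 - 1) * K.
  apply: cvgD; first exact: cvg_expR_lam.
  by apply: cvgM; [apply: cvgB; [exact: cvg_expR_lam|exact: cvg_cst]|exact: cvg_cst].
have lt1 : 0 < 1 + (1 - 1) * K by rewrite subrr mul0r addr0.
have ev1 := cvgr_ge _ cv1 _ lt1.
have cv2 : u N * (A * (1 - 2 * N%:R^-1) - 4 * d) @[N --> \oo] --> alpha * (A * (1 - 2 * 0) - 4 * d).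
  apply: cvgM; first exact: cvg_u.
  apply: cvgB; last exact: cvg_cst.
  apply: cvgM; first exact: cvg_cst.
  apply: cvgB; first exact: cvg_cst.
  by apply: cvgM; [exact: cvg_cst|exact: cvg_inv].
have lt2 : alpha * (A * (1 - 2 * 0) - 4 * d) < A * alpha + e / 4 by lra.
have ev2 := cvgr_le _ cv2 _ lt2.
have cv3 : - (expR (lam N) * surface_cost) @[N --> \oo] --> - (1 * surface_cost).
  by apply: cvgN; apply: cvgM; [exact: cvg_expR_lam|exact: cvg_cst].
have lt3 : - (1 * surface_cost) < - surface_cost + e / 4 by lra.
have ev3 := cvgr_le _ cv3 _ lt3.
near=> N => f.
have N0 : (0 < N)%N by near: N; exact: nbhs_infty_gt.
have NR : 0 < N%:R :> R by rewrite ltr0n.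
have h1 : 0 <= expR (lam N) + (expR (lam N) - 1) * K by near: N; exact: ev1.
have h2 : u N * (A * (1 - 2 * N%:R^-1) - 4 * d) <= A * alpha + e / 4 by near: N; exact: ev2.
have h3 : - (expR (lam N) * surface_cost) <= - surface_cost + e / 4 by near: N; exact: ev3.
have l0 : lam N <= 0 by rewrite mulr_le0_ge0 ?invr_ge0 ?(ltW NR)// ltW.
have x0 : expR (lam N) - 1 <= 0 by rewrite subr_le0 expR_le1.
have u0 : u N <= 0 by rewrite mulr_ge0_le0// ltW.
have u1 : alpha <= u N by case/andP: (u_bounds N0).
have [g [gf Qf Fg]] := @tilted_form_localize_pair R m rho hrho N r0 delta N0 r0_gt0 delta0
  f (lam N) surface_cost l0 (ltW Sig0) (fun j h => @surface_cost_le N j h).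
have f0 := norm2_ge0 f; have g0 := norm2_ge0 g.
have D0 := kcm_dirichlet_ge0 m hrho g.
have := mean_total_rate_ge m hrho g r d0; rewrite -/K.
set F := mean rho (fun eta => (_)%:R * g eta ^+ 2) in Fg *.
set H := mean rho (fun eta => total_rate m rho eta * g eta ^+ 2) => hH.
have Qg : tilted_form m rho (lam N) g <=
    (A * alpha + e / 4) * norm2 g + - alpha / q%:R ^+ 2 * norm2 f.
  rewrite tilted_formE -/H.
  have := ler_wnM2l x0 hH => {}hH.
  have : 0 <= (expR (lam N) + (expR (lam N) - 1) * K) * kcm_dirichlet m rho g.
    by rewrite mulr_ge0.
  have e1 : (expR (lam N) - 1) * ((A * (N%:R - 2) - 4 * d * N%:R) * norm2 g) =
      u N * (A * (1 - 2 * N%:R^-1) - 4 * d) * norm2 g.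
    by rewrite lam_factor//; field; rewrite gt_eqF.
  have e2 : u N * (A * (1 - 2 * N%:R^-1) - 4 * d) * norm2 g <= (A * alpha + e / 4) * norm2 g.
    by rewrite ler_wpM2r.
  have e3 : - (expR (lam N) - 1) * F <= - alpha / q%:R ^+ 2 * norm2 f.
    apply: (@le_trans _ _ (- (expR (lam N) - 1) * (N%:R / (delta ^+ 2 * r0%:R ^+ 2) * norm2 f))).
      by rewrite ler_wpM2l// oppr_ge0.
    rewrite lam_factor// mulrA ler_wpM2r//.
    have -> : - (u N / N%:R) * (N%:R / (delta ^+ 2 * r0%:R ^+ 2)) = - u N / q%:R ^+ 2.
      by rewrite /delta /r0 natrX; field; rewrite !gt_eqF.
    by rewrite ler_wpM2r ?invr_ge0 ?sqr_ge0// lerN2.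
  move: hH; rewrite 2!(mulrBr (expR (lam N) - 1)) e1; lra.
apply: le_trans Qf _; apply: le_trans (lerD (lerD Qg (lexx _)) (lexx _)) _.
have M1 : A * alpha <= M by rewrite le_max lexx.
have M2 : - surface_cost <= M by rewrite le_max lexx orbT.
have k1 : (A * alpha + e / 4) * norm2 g <= (M + e / 4) * norm2 g by rewrite ler_wpM2r//; lra.
have k2 : - (expR (lam N) * surface_cost) * (norm2 f - norm2 g) <= (M + e / 4) * (norm2 f - norm2 g).
  by rewrite ler_wpM2r ?subr_ge0//; lra.
(* The partition error and the weight of full windows are both of order [q ^- 2]; together they are
   at most [(- alpha + 2) / q], and [q] was chosen to make this small against [e]. *)
have k3 : - alpha / q%:R ^+ 2 * norm2 f + 2^-1 * (delta ^+ 2 * (r0.*2.+1)%:R) * norm2 f <= e / 2 * norm2 f.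
  rewrite -mulrDl ler_wpM2r//.
  apply: (@le_trans _ _ ((- alpha + 2) / q%:R)).
    have -> : (r0.*2.+1)%:R = 2 * q%:R ^+ 4 + 1 :> R.
      by rewrite -addn1 natrD -muln2 natrM /r0 natrX mulrC.
    rewrite /delta.
    have -> : (- alpha + 2) / q%:R = (- alpha + 2) * q%:R / q%:R ^+ 2 by field; rewrite gt_eqF.
    have -> : - alpha / q%:R ^+ 2 + 2^-1 * ((q%:R ^- 3) ^+ 2 * (2 * q%:R ^+ 4 + 1)) =
      (- alpha + 1 + 2^-1 * q%:R ^- 4) / q%:R ^+ 2 by field; rewrite gt_eqF.
    rewrite ler_wpM2r ?invr_ge0 ?sqr_ge0//.
    have : (q%:R ^- 4 : R) <= 1 by rewrite invf_le1 ?exprn_gt0// exprn_ege1.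
    have : (- alpha + 2) * 1 <= (- alpha + 2) * q%:R by rewrite ler_wpM2l//; lra.
    lra.
  rewrite ler_pdivrMr//; move: hq; rewrite ler_pdivrMr// [e / 2 * _]mulrC.
  by move: e0; lra.
have ef : 0 <= e * norm2 f by rewrite mulr_ge0// ltW.
lra.
Unshelve. all: by end_near.
Qed.

Lemma tilted_form_upper (e : R) : 0 < e -> \forall N \near \oo, forall f : config N -> R,
  tilted_form m rho (lam N) f <= (Num.max (A * alpha) (- surface_cost) + e) * norm2 f.
Proof.
move=> e0; have [a0|a0] := leP 0 alpha; last exact: tilted_form_upper_neg.
apply: filterS (tilted_form_upper_nonneg a0 e0) => N h f.
apply: le_trans (h f) _; rewrite ler_wpM2r ?norm2_ge0// lerD2r.
by rewrite le_max lexx.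
Qed.

End scaling.
End variational.

(** * From Rayleigh quotients to the scaled activity *)

Section scaled_limit.
Context {R : realType}.
Variables (m : kcm) (rho : R).
Hypothesis hrho : 0 < rho < 1.

Local Notation A := (@mean_activity R m rho).
Local Notation norm2 f := (mean rho (fun eta => f eta ^+ 2)).

Definition rayleigh_quotients N (lambda : R) : set R := [set x |
  exists f : config N -> R, 0 < norm2 f /\ x = tilted_form m rho lambda f / norm2 f].

Let has_sup_rayleigh N lambda : has_sup (rayleigh_quotients N lambda).
Proof.
split.
  exists (tilted_form m rho lambda (fun _ : config N => 1) / norm2 (fun _ : config N => 1)), (fun=> 1).
  split=> //; rewrite (@eq_mean _ _ _ _ (fun=> 1)) ?mean_cst//.
  by move=> eta; rewrite expr1n.
exists (`|expR lambda - 1| * N%:R) => x [f [f0 ->]].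
rewrite ler_pdivrMr// tilted_formE.
have h1 : 0 <= expR lambda * kcm_dirichlet m rho f by rewrite mulr_ge0 ?expR_ge0 ?kcm_dirichlet_ge0.
have H0 : 0 <= mean rho (fun eta => total_rate m rho eta * f eta ^+ 2).
  apply: mean_ge0 => // eta; rewrite mulr_ge0 ?sqr_ge0// sumr_ge0// => i _.
  exact: rate_ge0.
have H1 : mean rho (fun eta => total_rate m rho eta * f eta ^+ 2) <= N%:R * norm2 f.
  rewrite -meanZ; apply: ler_mean => // eta; rewrite ler_wpM2r ?sqr_ge0//.
  rewrite /total_rate -[in leRHS](card_ord N) -sum1_card natr_sum.
  by apply: ler_sum => i _; exact: rate_le1.
have h2 : (expR lambda - 1) * mean rho (fun eta => total_rate m rho eta * f eta ^+ 2) <=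
    `|expR lambda - 1| * mean rho (fun eta => total_rate m rho eta * f eta ^+ 2).
  by rewrite ler_wpM2r// ler_norm.
have h3 : `|expR lambda - 1| * mean rho (fun eta => total_rate m rho eta * f eta ^+ 2) <=
    `|expR lambda - 1| * (N%:R * norm2 f) by rewrite ler_wpM2l.
by move: h1 h2 h3; rewrite mulrA; lra.
Qed.

Lemma kcm_scgfE N d (T : measurableType d) (P : probability T R) (X : R -> T -> config N)
    (lambda : R) : kcm_process m rho P X ->
  activity_scgf P X lambda = (sup (rayleigh_quotients N lambda))%:E.
Proof.
move=> pX; have hs := has_sup_rayleigh N lambda.
have nE (f : config N -> R) : wform (@bernoulli_weight R rho N) f f = norm2 f.
  by apply: eq_bigr => eta _; rewrite expr2.
have mp : markov_process P X (@bernoulli_weight R rho N) (@generator R m rho N) := pX.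
have mu0 (x : config N) : 0 < bernoulli_weight rho x by exact: bernoulli_weight_gt0.
apply: (activity_scgf_rayleigh mu0 (bernoulli_weight_sum1 rho N)
  (tilted_generator_sym m rho lambda) mp) => [f|e e0].
  rewrite wform_tilted_generator nE.
  have [f0|f0] := leP (norm2 f) 0; last first.
    by rewrite -ler_pdivrMr//; apply: sup_upper_bound => //; exists f.
  have fz eta : f eta = 0.
    have sq0 xi : 0 <= bernoulli_weight rho xi * f xi ^+ 2.
      by rewrite mulr_ge0 ?sqr_ge0// ltW// bernoulli_weight_gt0.
    have /eqP : norm2 f = 0 by apply/eqP; rewrite eq_le f0 sumr_ge0.
    rewrite psumr_eq0// => /allP/(_ eta); rewrite mem_index_enum => /(_ isT).
    by rewrite mulf_eq0 gt_eqF ?bernoulli_weight_gt0//= expf_eq0 /= => /eqP.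
  have -> : norm2 f = 0.
    by rewrite -[RHS](mean_cst rho N); apply: eq_mean => eta; rewrite fz expr0n.
  rewrite mulr0 (_ : tilted_form _ _ _ _ = 0)//.
  by rewrite -[RHS](mean_cst rho N); apply: eq_mean => eta; rewrite fz mul0r.
have [x [f [f0 ->]] hx] := sup_adherent e0 hs.
exists f; rewrite wform_tilted_generator nE; split => //.
by rewrite -ler_pdivlMr// ltW.
Qed.

(** The suprema of the quotients actually converge, so the upper limit is a limit. The lower bound
    uses the test function of whichever term attains the maximum. *)
Lemma limn_esup_kcm_scgf (d : nat -> measure_display)
    (T : forall N : nat, measurableType (d N))
    (P : forall N : nat, probability (T N) R)
    (X : forall N : nat, R -> T N -> config N) (alpha : R) :
  (forall N : nat, kcm_process m rho (P N) (X N)) ->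
  limn_esup (fun N : nat => activity_scgf (P N) (X N) (alpha / N%:R)) =
  (Num.max (A * alpha) (- surface_cost m rho))%:E.
Proof.
move=> pX.
have -> : (fun N : nat => activity_scgf (P N) (X N) (alpha / N%:R)) =
    (fun N => (sup (rayleigh_quotients N (alpha / N%:R)))%:E).
  by apply/funext => N; rewrite kcm_scgfE.
set M := Num.max _ _.
suff cv : sup (rayleigh_quotients N (alpha / N%:R)) @[N --> \oo] --> M.
  suff /cvg_limn_einf_sup[] : (sup (rayleigh_quotients N (alpha / N%:R)))%:E @[N --> \oo] --> M%:E.
    by [].
  by apply/fine_cvgP; split; [exact: nearW|exact: cv].
apply/cvgrPdist_le => e e0.
have low : \forall N \near \oo, exists f : config N -> R, 0 < norm2 f /\
    (M - e) * norm2 f <= tilted_form m rho (alpha / N%:R) f.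
  rewrite /M; case: leP => _; first exact: tilted_form_lower_surface.
  exact: tilted_form_lower_mean.
have up := tilted_form_upper m hrho alpha e0.
near=> N; rewrite ler_distlC; apply/andP; split.
  have [f [f0 hf]] : exists f : config N -> R, 0 < norm2 f /\
    (M - e) * norm2 f <= tilted_form m rho (alpha / N%:R) f by near: N; exact: low.
  apply: (@le_trans _ _ (tilted_form m rho (alpha / N%:R) f / norm2 f)).
    by rewrite ler_pdivlMr.
  by apply: sup_upper_bound => //; exists f.
apply: ge_sup; first by have [] := has_sup_rayleigh N (alpha / N%:R).
move=> x [f [f0 ->]]; rewrite ler_pdivrMr//.
by move: f {f0}; near: N; exact: up.
Unshelve. all: by end_near.
Qed.

End scaled_limit.

Theorem theorem2p1 (R : realType) (m : kcm) (rho : R) (hrho : 0 < rho < 1) :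
  exists alpha0 alpha1 Sigma : R,
    [/\ alpha1 < alpha0, alpha0 < 0, 0 < Sigma &
      forall (d : nat -> measure_display)
        (T : forall N : nat, measurableType (d N))
        (P : forall N : nat, probability (T N) R)
        (X : forall N : nat, R -> T N -> config N),
        (forall N : nat, kcm_process m rho (P N) (X N)) ->
        let phi (alpha : R) : \bar R :=
          limn_esup (fun N : nat =>
            activity_scgf (P N) (X N) (alpha / N%:R)) in
        (forall alpha : R, alpha0 < alpha ->
          phi alpha = (mean_activity m rho * alpha)%:E) /\
        (forall alpha : R, alpha < alpha1 -> phi alpha = (- Sigma)%:E)].
Proof.
have [A0 _] := andP (mean_activity_bounds m hrho); set A := mean_activity m rho in A0 *.
have S0 := surface_cost_gt0 m hrho; set S := surface_cost m rho in S0.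
have SA : 0 < S / A by rewrite divr_gt0.
(* The lines [A * alpha] and [- S] cross at [- (S / A)], which serves as [alpha0]; any smaller
   number would do for [alpha1]. *)
exists (- (S / A)), (- (S / A) - 1), S; split => //; [by lra|by rewrite oppr_lt0|].
move=> d T P X pX phi; split => alpha ha; rewrite /phi (limn_esup_kcm_scgf hrho _ pX) -/A -/S.
  congr EFin; apply: max_idPl.
  have := ltW ha; rewrite lerNl -(ler_pM2l A0) mulrN mulrCA divff ?mulr1 ?gt_eqF//; lra.
congr EFin; apply: max_idPr.
have : alpha <= - (S / A) by lra.
by rewrite -(ler_pM2l A0) mulrN mulrCA divff ?mulr1// gt_eqF.
Qed.
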